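(* Let $K$ be an algebraically closed field and let $A=\Lambda_9'$. Then: (i) $\dim_K HH^0(A)=5$. (ii) $\dim_K HH^1(A)=1$ if $\mathrm{char}(K)\neq 2$, and $\dim_K HH^1(A)=2$ if $\mathrm{char}(K)=2$. (iii) $\dim_K HH^2(A)=0$ if $\mathrm{char}(K)\neq 2$, and $\dim_K HH^2(A)=3$ if $\mathrm{char}(K)=2$.
   Context: For a finite-dimensional $K$-algebra $A$, $HH^n(A)=\mathrm{Ext}^n_{A^e}(A,A)$ with $A^e=A^{\mathrm{op}}\otimes_K A$ is the $n$-th Hochschild cohomology space. Paths are composed from left to right ($\alpha\beta$ means first $\alpha$, then $\beta$). $\Lambda_9'$ is the bound quiver algebra of the quiver with vertices $1,2,3,4$ and arrows $\alpha:1\to4$, $\beta:4\to1$, $\xi:2\to4$, $\varepsilon:4\to2$, $\gamma:3\to4$, $\delta:4\to3$, with relations $\beta\alpha+\varepsilon\xi+\delta\gamma=0$, $\alpha\beta=0$, $\xi\varepsilon=0$, $\gamma\delta=0$. *)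

(* Defs.v *)
From HB Require Import structures.
From mathcomp Require Import all_boot all_order all_algebra.
From mathcomp Require Import boolp finmap.
From mathcomp.multinomials Require Import monalg.

Set Implicit Arguments.
Unset Strict Implicit.
Unset Printing Implicit Defensive.

Import GRing.Theory.
Local Open Scope ring_scope.
Local Open Scope quotient_scope.

(* The basis element p of {malg R[G]}; locked, as unification tends to unfold
   monomials of {malg R[G]} at great cost. *)
HB.lock Definition bvec (R : nzRingType) (G : choiceType) (p : G) : {malg R[G]} :=
  << p >>.
Canonical bvec_unlockable := Unlockable bvec.unlock.
Arguments bvec {R G} p.

Lemma mcoeff_bvec (R : nzRingType) (G : choiceType) (p q : G) :
  (bvec p : {malg R[G]})@_q = (p == q)%:R.
Proof. by rewrite unlock mcoeffU. Qed.

Section LinearExtension.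
Variables (K : nzRingType) (G : choiceType) (V : lmodType K).
Implicit Types (f g : {malg K[G]}) (h : G -> V).

Definition lext h f : V := \sum_(p <- msupp f) f@_p *: h p.

Lemma lextEw h (d : {fset G}) f : (msupp f `<=` d)%fset ->
  lext h f = \sum_(p <- d) f@_p *: h p.
Proof.
move=> le; rewrite [LHS](big_fset_incl _ le) => //= x xd /mcoeff_outdom ->.
by rewrite scale0r.
Qed.

Lemma lext_is_linear h : linear (lext h).
Proof.
move=> k f g /=; pose d := (msupp f `|` msupp g)%fset.
rewrite (@lextEw h d); last first.
  apply: fsubset_trans (msuppD_le _ _) _.
  apply: fsetSU; exact: msuppZ_le.
rewrite (@lextEw h d f) ?fsubsetUl //.
rewrite (@lextEw h d g) ?fsubsetUr //.
rewrite scaler_sumr -big_split; apply: eq_bigr => p _ /=.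
by rewrite mcoeffD mcoeffZ scalerDl scalerA.
Qed.

HB.instance Definition _ h := GRing.isLinear.Build K {malg K[G]} V _ (lext h)
  (lext_is_linear h).

Lemma lextU h p : lext h (bvec p) = h p.
Proof. by rewrite unlock (lextEw _ msuppU_le) big_seq_fset1 mcoeffUU scale1r. Qed.

Lemma malg_scaleU f p : << f@_p *g p >> = f@_p *: bvec p.
Proof. by apply/malgP => q; rewrite mcoeffZ mcoeff_bvec mcoeffU mulr_natr. Qed.

Lemma eq_malg_linear (F1 F2 : {malg K[G]} -> V) : linear F1 -> linear F2 ->
  (forall p, F1 (bvec p) = F2 (bvec p)) -> F1 =1 F2.
Proof.
move=> l1 l2 eqF f.
have z (F : {malg K[G]} -> V) : linear F -> F 0 = 0.
  move=> lF; have := lF 1 0 0.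
  by rewrite !scale1r addr0 => /esym/eqP; rewrite -subr_eq0 addrK => /eqP.
rewrite [f]monalgE; elim: (enum_fset _) => [|p s IH].
  by rewrite big_nil !z.
by rewrite big_cons malg_scaleU l1 l2 eqF IH.
Qed.

End LinearExtension.

(* The product on the vector space with basis G determined by the products
   op p q of basis elements, where op p q may be any linear combination. *)
HB.lock Definition bmul (K : fieldType) (G : choiceType)
  (op : G -> G -> {malg K[G]}) (f g : {malg K[G]}) : {malg K[G]} :=
  lext (fun p => lext (op p) g) f.
Canonical bmul_unlockable := Unlockable bmul.unlock.

Section BilinearProduct.
Variables (K : fieldType) (G : choiceType) (op : G -> G -> {malg K[G]}).
Local Notation mul := (bmul op).
Implicit Types (f g h : {malg K[G]}).

Lemma bmulUU p q : mul (bvec p) (bvec q) = op p q.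
Proof. by rewrite unlock !lextU. Qed.

Lemma bmul_linearl g : linear (mul^~ g).
Proof. by move=> k f f'; rewrite unlock linearP. Qed.

Lemma bmul_linearr f : linear (mul f).
Proof.
move=> k g g'; rewrite unlock /lext scaler_sumr -big_split.
apply: eq_bigr => p _ /=.
by rewrite -!/(lext _ _) linearP scalerDr !scalerA mulrC.
Qed.

Lemma bmulDl : left_distributive mul +%R.
Proof. by move=> f f' g; have := bmul_linearl g 1 f f'; rewrite !scale1r. Qed.

Lemma bmulDr : right_distributive mul +%R.
Proof. by move=> f g g'; have := bmul_linearr f 1 g g'; rewrite !scale1r. Qed.

Lemma bmul0l g : mul 0 g = 0.
Proof. by rewrite unlock linear0. Qed.

Lemma bmul0r f : mul f 0 = 0.
Proof. by rewrite unlock /lext big1 // => p _; rewrite msupp0 big_nil scaler0. Qed.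

Lemma bmulZl k f g : k *: mul f g = mul (k *: f) g.
Proof. by rewrite unlock linearZ. Qed.

Lemma bmulZr k f g : k *: mul f g = mul f (k *: g).
Proof. by have := bmul_linearr f k g 0; rewrite bmul0r !addr0. Qed.

Lemma bmulA :
  (forall p q r, mul (bvec p) (op q r) = mul (op p q) (bvec r)) ->
  associative mul.
Proof.
move=> opA f g h; move: f.
apply: eq_malg_linear => [k x y|k x y|p].
- exact: bmul_linearl.
- by rewrite (bmul_linearl g k x y); exact: bmul_linearl.
move: g; apply: eq_malg_linear => [k x y|k x y|q].
- by rewrite (bmul_linearl h k x y); exact: bmul_linearr.
- by rewrite (bmul_linearr (bvec p) k x y); exact: bmul_linearl.
move: h; apply: eq_malg_linear => [k x y|k x y|r].
- by rewrite (bmul_linearr (bvec q) k x y); exact: bmul_linearr.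
- exact: bmul_linearr.
by rewrite (bmulUU q r) (bmulUU p q) opA.
Qed.

Lemma bmul1 u : (forall p, mul u (bvec p) = bvec p) -> left_id u mul.
Proof.
by move=> up; apply: eq_malg_linear => [||p] //; apply: bmul_linearr.
Qed.

Lemma bmulu u : (forall p, mul (bvec p) u = bvec p) -> right_id u mul.
Proof.
by move=> up; apply: eq_malg_linear => [||p] //; apply: bmul_linearl.
Qed.

End BilinearProduct.

Section Ideals.
Variables (K : fieldType) (L : algType K).

Definition two_sided_ideal (J : L -> Prop) : Prop :=
  [/\ J 0,
      forall x y, J x -> J y -> J (x - y),
      forall a x, J x -> J (a * x)
    & forall x a, J x -> J (x * a)].

Definition ideal_gen (S : L -> Prop) (x : L) : Prop :=
  forall J : L -> Prop, two_sided_ideal J -> (forall s, S s -> J s) -> J x.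

Lemma ideal_genP S : two_sided_ideal (ideal_gen S).
Proof.
split=> [J [] //|x y Sx Sy J iJ SJ|a x Sx J iJ SJ|x a Sx J iJ SJ];
  case: (iJ) => J0 JB Jl Jr.
- by apply: JB; [apply: Sx|apply: Sy].
- by apply: Jl; apply: Sx.
- by apply: Jr; apply: Sx.
Qed.

Lemma ideal_gen_sub (S : L -> Prop) s : S s -> ideal_gen S s.
Proof. by move=> Ss J _; apply. Qed.

Definition ideal_pred (S : L -> Prop) : {pred L} := fun x => `[< ideal_gen S x >].

Lemma ideal_predP S x : reflect (ideal_gen S x) (x \in ideal_pred S).
Proof. exact: asboolP. Qed.

Lemma ideal_pred_zmod S : zmod_closed (ideal_pred S).
Proof.
have [J0 JB _ _] := ideal_genP S.
split=> [|x y /ideal_predP Sx /ideal_predP Sy]; apply/ideal_predP => //.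
exact: JB.
Qed.

HB.instance Definition _ S :=
  GRing.isZmodClosed.Build L (ideal_pred S) (ideal_pred_zmod S).

Lemma ideal_predMl S a x : x \in ideal_pred S -> a * x \in ideal_pred S.
Proof.
by move=> /ideal_predP Sx; apply/ideal_predP; case: (ideal_genP S) => _ _ + _; apply.
Qed.

Lemma ideal_predMr S x a : x \in ideal_pred S -> x * a \in ideal_pred S.
Proof.
by move=> /ideal_predP Sx; apply/ideal_predP; case: (ideal_genP S) => _ _ _; apply.
Qed.

Lemma ideal_predZ S k x : x \in ideal_pred S -> k *: x \in ideal_pred S.
Proof. by rewrite -[x in k *: x]mul1r scalerAl; apply: ideal_predMl. Qed.

End Ideals.

(* MathComp rings of type nzRingType are nontrivial, whence the properness
   argument, which is otherwise not used. *)
Definition quot_alg (K : fieldType) (L : algType K) (S : L -> Prop)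
  (proper : ~ ideal_gen S 1) : Type := Quotient.quot (ideal_pred S).

Section QuotientAlgebra.
Variables (K : fieldType) (L : algType K) (S : L -> Prop).
Variable proper : ~ ideal_gen S 1.
Local Notation I := (ideal_pred S).
Local Notation Q := (quot_alg proper).

HB.instance Definition _ := GRing.Zmodule.on Q.

Definition quot_pi (x : L) : Q := \pi_(Quotient.quot I) x.
Definition quot_repr (x : Q) : L := repr (x : Quotient.quot I).

Lemma quot_reprK x : quot_pi (quot_repr x) = x.
Proof. exact: reprK. Qed.

Lemma quot_piE x y : (quot_pi x = quot_pi y) <-> ideal_gen S (x - y).
Proof.
rewrite /quot_pi; split.
  by move=> /eqP; rewrite -Quotient.idealrBE => /ideal_predP.
by move=> /ideal_predP; rewrite Quotient.idealrBE => /eqP.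
Qed.

Lemma quot_piD x y : quot_pi (x + y) = quot_pi x + quot_pi y.
Proof. by rewrite /quot_pi !piE. Qed.

Definition quot_mul (x y : Q) : Q := quot_pi (quot_repr x * quot_repr y).
Definition quot_scale (k : K) (x : Q) : Q := quot_pi (k *: quot_repr x).

Lemma quot_repr_pi x : ideal_gen S (quot_repr (quot_pi x) - x).
Proof. by apply/quot_piE; rewrite quot_reprK. Qed.

Lemma quot_mulE x y : quot_mul (quot_pi x) (quot_pi y) = quot_pi (x * y).
Proof.
apply/quot_piE/ideal_predP.
have /ideal_predP rx := quot_repr_pi x; have /ideal_predP ry := quot_repr_pi y.
set X := quot_repr (quot_pi x) in rx *; set Y := quot_repr (quot_pi y) in ry *.
have -> : X * Y - x * y = (X - x) * Y + x * (Y - y).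
  by rewrite mulrBl mulrBr addrA subrK.
by apply: rpredD; [apply: ideal_predMr|apply: ideal_predMl].
Qed.

Lemma quot_scaleE k x : quot_scale k (quot_pi x) = quot_pi (k *: x).
Proof.
apply/quot_piE/ideal_predP; rewrite -scalerBr; apply: ideal_predZ.
apply/ideal_predP; exact: quot_repr_pi.
Qed.

Lemma quot_ind (P : Q -> Prop) : (forall x, P (quot_pi x)) -> forall x, P x.
Proof. by move=> h x; rewrite -(quot_reprK x). Qed.

Lemma quot_mulA : associative quot_mul.
Proof.
by do 3![elim/quot_ind=> ?]; rewrite !quot_mulE mulrA.
Qed.
Lemma quot_mul1 : left_id (quot_pi 1) quot_mul.
Proof. by elim/quot_ind=> x; rewrite quot_mulE mul1r. Qed.
Lemma quot_mulr1 : right_id (quot_pi 1) quot_mul.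
Proof. by elim/quot_ind=> x; rewrite quot_mulE mulr1. Qed.
Lemma quot_mulDl : left_distributive quot_mul +%R.
Proof.
elim/quot_ind=> x; elim/quot_ind=> y; elim/quot_ind=> z.
by rewrite -quot_piD !quot_mulE -quot_piD mulrDl.
Qed.
Lemma quot_mulDr : right_distributive quot_mul +%R.
Proof.
elim/quot_ind=> x; elim/quot_ind=> y; elim/quot_ind=> z.
by rewrite -quot_piD !quot_mulE -quot_piD mulrDr.
Qed.
Lemma quot_1neq0 : quot_pi 1 != 0.
Proof.
apply/eqP => h; apply: proper; rewrite -[1]subr0; apply/quot_piE.
by rewrite h /quot_pi piE.
Qed.

HB.instance Definition _ := GRing.Zmodule_isNzRing.Build Q
  quot_mulA quot_mul1 quot_mulr1 quot_mulDl quot_mulDr quot_1neq0.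

Lemma quot_scaleA a b v : quot_scale a (quot_scale b v) = quot_scale (a * b) v.
Proof. by elim/quot_ind: v => v; rewrite !quot_scaleE scalerA. Qed.
Lemma quot_scale1 : left_id 1 quot_scale.
Proof. by elim/quot_ind=> v; rewrite quot_scaleE scale1r. Qed.
Lemma quot_scaleDr : right_distributive quot_scale +%R.
Proof.
move=> k; do 2![elim/quot_ind=> ?].
by rewrite -quot_piD !quot_scaleE -quot_piD scalerDr.
Qed.
Lemma quot_scaleDl v : {morph quot_scale^~ v : a b / a + b}.
Proof.
by move=> a b; elim/quot_ind: v => v; rewrite /= !quot_scaleE -quot_piD scalerDl.
Qed.

HB.instance Definition _ := GRing.Zmodule_isLmodule.Build K Q
  quot_scaleA quot_scale1 quot_scaleDr quot_scaleDl.

Lemma quot_scalerAl (k : K) (u v : Q) : k *: (u * v) = (k *: u) * v.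
Proof.
elim/quot_ind: u => u; elim/quot_ind: v => v.
change (quot_scale k (quot_mul (quot_pi u) (quot_pi v))
  = quot_mul (quot_scale k (quot_pi u)) (quot_pi v)).
by rewrite !(quot_mulE, quot_scaleE) scalerAl.
Qed.
Lemma quot_scalerAr (k : K) (u v : Q) : k *: (u * v) = u * (k *: v).
Proof.
elim/quot_ind: u => u; elim/quot_ind: v => v.
change (quot_scale k (quot_mul (quot_pi u) (quot_pi v))
  = quot_mul (quot_pi u) (quot_scale k (quot_pi v))).
by rewrite !(quot_mulE, quot_scaleE) scalerAr.
Qed.

HB.instance Definition _ := GRing.Lmodule_isLalgebra.Build K Q quot_scalerAl.
HB.instance Definition _ := GRing.Lalgebra_isAlgebra.Build K Q quot_scalerAr.

Lemma quot_piM x y : quot_pi (x * y) = quot_pi x * quot_pi y.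
Proof. by rewrite -quot_mulE. Qed.
Lemma quot_pi1 : quot_pi 1 = 1. Proof. by []. Qed.
Lemma quot_piZ k x : quot_pi (k *: x) = k *: quot_pi x.
Proof. by rewrite -quot_scaleE. Qed.

End QuotientAlgebra.

Record quiver := Quiver {
  qvert : finType;
  qarr : finType;
  qsrc : qarr -> qvert;
  qtgt : qarr -> qvert;
  qvert_gt0 : (0 < #|qvert|)%N
}.

Section Paths.
Variable Q : quiver.

(* [qwalk v s]: the arrows of s, read from left to right, form a path
   starting at v. *)
Fixpoint qwalk (v : qvert Q) (s : seq (qarr Q)) : bool :=
  if s is a :: s' then (qsrc a == v) && qwalk (qtgt a) s' else true.

(* A path is its starting vertex together with its sequence of arrows;
   the starting vertex is needed to tell apart the trivial paths. *)
Definition qpath : Type := {p : qvert Q * seq (qarr Q) | qwalk p.1 p.2}.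
HB.instance Definition _ := Choice.on qpath.
HB.instance Definition _ := SubType.on qpath.

Definition psrc (p : qpath) : qvert Q := (val p).1.
Definition parrs (p : qpath) : seq (qarr Q) := (val p).2.
Definition ptgt (p : qpath) : qvert Q := last (psrc p) (map (@qtgt Q) (parrs p)).

Definition trivial_path (v : qvert Q) : qpath := Sub (v, [::]) isT.

Lemma arrow_walk (a : qarr Q) : qwalk (qsrc a) [:: a].
Proof. by rewrite /= eqxx. Qed.
Definition arrow_path (a : qarr Q) : qpath := Sub (qsrc a, [:: a]) (arrow_walk a).

(* Composition from left to right; [pcompE] shows that insub does not fail. *)
Definition pcomp (p q : qpath) : option qpath :=
  if ptgt p == psrc q then insub (psrc p, parrs p ++ parrs q) else None.

Lemma qwalk_cat v s t :
  qwalk v (s ++ t) = qwalk v s && qwalk (last v (map (@qtgt Q) s)) t.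
Proof. by elim: s v => [//|a s IH] v /=; rewrite IH andbA. Qed.

Lemma pcompE p q : ptgt p = psrc q ->
  exists2 r, pcomp p q = Some r & val r = (psrc p, parrs p ++ parrs q).
Proof.
move=> pq; rewrite /pcomp pq eqxx.
have w : qwalk (psrc p) (parrs p ++ parrs q).
  by rewrite qwalk_cat (valP p) -/(ptgt p) pq (valP q).
by exists (Sub (psrc p, parrs p ++ parrs q) w); rewrite ?insubT ?SubK.
Qed.

Lemma pcompN p q : ptgt p != psrc q -> pcomp p q = None.
Proof. by rewrite /pcomp => /negPf ->. Qed.

Lemma pcompP p q r : pcomp p q = Some r ->
  [/\ ptgt p = psrc q, psrc r = psrc p, ptgt r = ptgt q
    & parrs r = parrs p ++ parrs q].
Proof.
have [pq|pq] := eqVneq (ptgt p) (psrc q); last by rewrite pcompN.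
have [r' -> vr] := pcompE pq; case=> <-; split=> //; rewrite /psrc /parrs ?vr //.
by rewrite /ptgt /psrc /parrs vr /= map_cat last_cat -/(psrc p) -/(ptgt p) pq.
Qed.

Lemma qpath_inj p q : psrc p = psrc q -> parrs p = parrs q -> p = q.
Proof.
move=> h1 h2; apply: val_inj; move: h1 h2; rewrite /psrc /parrs.
by case: (val p) (val q) => [? ?] [? ?] /= -> ->.
Qed.

Lemma pcompA p q r : obind (pcomp p) (pcomp q r) = obind (pcomp^~ r) (pcomp p q).
Proof.
case E1: (pcomp q r) => [s|] /=; case E2: (pcomp p q) => [t|] //=.
- have [a1 a2 a3 a4] := pcompP E1; have [b1 b2 b3 b4] := pcompP E2.
  have ps : ptgt p = psrc s by rewrite a2.
  have tr : ptgt t = psrc r by rewrite b3.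
  have [x ex _] := pcompE ps; have [y ey _] := pcompE tr; rewrite ex ey.
  have [_ x2 _ x4] := pcompP ex; have [_ y2 _ y4] := pcompP ey.
  by congr Some; apply: qpath_inj; rewrite ?x2 ?y2 ?b2 // x4 y4 a4 b4 catA.
- have [a1 a2 a3 a4] := pcompP E1; apply: pcompN; rewrite a2.
  by apply: contraPneq E2 => /pcompE[x ->].
- have [b1 b2 b3 b4] := pcompP E2; apply/esym/pcompN; rewrite b3.
  by apply: contraPneq E1 => /pcompE[x ->].
Qed.

Lemma pcomp_trivl v p : pcomp (trivial_path v) p = if v == psrc p then Some p else None.
Proof.
have [vp|vp] := eqVneq v (psrc p); last by rewrite pcompN.
have [r er _] := @pcompE (trivial_path v) p vp.
have [_ r2 _ r4] := pcompP er; rewrite er.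
by congr Some; apply: qpath_inj; rewrite ?r2 ?r4.
Qed.

Lemma pcomp_trivr p v : pcomp p (trivial_path v) = if v == ptgt p then Some p else None.
Proof.
rewrite eq_sym; have [vp|vp] := eqVneq (ptgt p) v; last by rewrite pcompN.
have [r er _] := @pcompE p (trivial_path v) vp.
have [_ r2 _ r4] := pcompP er; rewrite er.
by congr Some; apply: qpath_inj; rewrite ?r2 ?r4 // cats0.
Qed.

End Paths.

Definition path_alg (K : fieldType) (Q : quiver) : Type := {malg K[qpath Q]}.

Section PathAlgebra.
Variables (K : fieldType) (Q : quiver).
Local Notation KQ := (path_alg K Q).

HB.instance Definition _ := GRing.Lmodule.on KQ.

Definition path_elt (p : qpath Q) : KQ := bvec p.
Definition qidem (v : qvert Q) : KQ := path_elt (trivial_path v).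
Definition qarrow (a : qarr Q) : KQ := path_elt (arrow_path a).

Definition path_op (p q : qpath Q) : {malg K[qpath Q]} :=
  if pcomp p q is Some r then bvec r else 0.

Lemma path_opE p q : path_op p q = if pcomp p q is Some r then bvec r else 0.
Proof. by []. Qed.

Definition path_one : KQ := \sum_(v : qvert Q) qidem v.

Local Notation mul := (bmul path_op : KQ -> KQ -> KQ).

Lemma path_mulA : associative mul.
Proof.
apply: bmulA => p q r; have := pcompA p q r.
rewrite (path_opE q r) (path_opE p q).
case: (pcomp q r) => [s|]; case: (pcomp p q) => [t|] /= e.
- by rewrite (bmulUU path_op p s) (bmulUU path_op t r) path_opE e.
- by rewrite (bmulUU path_op p s) bmul0l path_opE e.
- by rewrite (bmulUU path_op t r) bmul0r path_opE -e.
by rewrite bmul0l bmul0r.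
Qed.

Lemma path_mul1 : left_id path_one mul.
Proof.
apply: bmul1 => p; rewrite /path_one (bigD1 (psrc p)) //= bmulDl bmulUU.
rewrite path_opE pcomp_trivl eqxx.
suff -> : bmul path_op (\sum_(v | v != psrc p) qidem v) (bvec p) = 0.
  by rewrite addr0.
apply: (big_ind (fun x => bmul path_op x (bvec p) = 0)); first exact: bmul0l.
  by move=> x y hx hy; rewrite bmulDl hx hy addr0.
by move=> v vp; rewrite bmulUU path_opE pcomp_trivl (negPf vp).
Qed.

Lemma path_mulr1 : right_id path_one mul.
Proof.
apply: bmulu => p; rewrite /path_one (bigD1 (ptgt p)) //= bmulDr bmulUU.
rewrite path_opE pcomp_trivr eqxx.
suff -> : bmul path_op (bvec p) (\sum_(v | v != ptgt p) qidem v) = 0.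
  by rewrite addr0.
apply: (big_ind (fun x => bmul path_op (bvec p) x = 0)); first exact: bmul0r.
  by move=> x y hx hy; rewrite bmulDr hx hy addr0.
by move=> v vp; rewrite bmulUU path_opE pcomp_trivr (negPf vp).
Qed.

Lemma path_oneE v : path_one@_(trivial_path v) = 1.
Proof.
rewrite /path_one raddf_sum (bigD1 v) //= mcoeff_bvec eqxx big1 ?addr0 // => w wv.
rewrite mcoeff_bvec; case: eqP => // /(congr1 (@psrc Q)) h.
by rewrite [w]h eqxx in wv.
Qed.

Lemma path_1neq0 : path_one != 0.
Proof.
have /card_gt0P[v _] := qvert_gt0 Q.
by apply/eqP => /malgP/(_ (trivial_path v)); rewrite path_oneE mcoeff0 => /eqP;
  rewrite oner_eq0.
Qed.

HB.instance Definition _ := GRing.Zmodule_isNzRing.Build KQ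
  path_mulA path_mul1 path_mulr1 (@bmulDl _ _ path_op) (@bmulDr _ _ path_op)
  path_1neq0.
HB.instance Definition _ :=
  GRing.Lmodule_isLalgebra.Build K KQ (@bmulZl _ _ path_op).
HB.instance Definition _ :=
  GRing.Lalgebra_isAlgebra.Build K KQ (@bmulZr _ _ path_op).

Lemma path_eltM (p q : qpath Q) :
  path_elt p * path_elt q = if pcomp p q is Some r then path_elt r else 0.
Proof. exact: bmulUU. Qed.

Lemma mcoeff_trivialM (f g : KQ) v :
  (f * g)@_(trivial_path v) = f@_(trivial_path v) * g@_(trivial_path v).
Proof.
set e := trivial_path v.
pose F1 (f : {malg K[qpath Q]}) : K^o := ((f : KQ) * g)@_e.
pose F2 (f : {malg K[qpath Q]}) : K^o := f@_e * g@_e.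
apply: (@eq_malg_linear K (qpath Q) K^o F1 F2) => {f} [k x y|k x y|p].
- rewrite /F1 mulrDl -scalerAl mcoeffD mcoeffZ; reflexivity.
- by rewrite /F2 mcoeffD mcoeffZ mulrDl -mulrA.
rewrite /F1 /F2 {F1 F2}; move: g.
pose F1 (g : {malg K[qpath Q]}) : K^o := ((bvec p : KQ) * (g : KQ))@_e.
pose F2 (g : {malg K[qpath Q]}) : K^o := (bvec p : {malg K[qpath Q]})@_e * g@_e.
apply: (@eq_malg_linear K (qpath Q) K^o F1 F2) => [k x y|k x y|q].
- rewrite /F1 mulrDr -scalerAr mcoeffD mcoeffZ; reflexivity.
- by rewrite /F2 mcoeffD mcoeffZ mulrDr mulrCA.
rewrite /F1 /F2 (path_eltM p q) !mcoeff_bvec.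
have [pe|pe] := eqVneq p e; have [qe|qe] := eqVneq q e; rewrite ?mulr1 ?mulr0 ?mul0r.
- by rewrite pe qe pcomp_trivl eqxx /path_elt mcoeff_bvec eqxx.
- rewrite pe pcomp_trivl; case: ifP => _; last by rewrite mcoeff0.
  by rewrite /path_elt mcoeff_bvec (negPf qe).
- rewrite qe pcomp_trivr; case: ifP => _; last by rewrite mcoeff0.
  by rewrite /path_elt mcoeff_bvec (negPf pe).
case E: (pcomp p q) => [r|]; last by rewrite mcoeff0.
have [h1 h2 h3 h4] := pcompP E.
rewrite /path_elt mcoeff_bvec; case: eqP => // re; case/eqP: pe.
have /esym/eqP := h4; rewrite re /parrs /= -size_eq0 size_cat addn_eq0.
case/andP=> /nilP p0 _; apply: qpath_inj; last by rewrite /parrs p0.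
by rewrite -h2 re.
Qed.

Lemma arrow_ideal_proper (S : KQ -> Prop) :
  (forall r v, S r -> r@_(trivial_path v) = 0) -> ~ ideal_gen S 1.
Proof.
move=> hS /(_ (fun f => forall v, f@_(trivial_path v) = 0)) h.
have /card_gt0P[v _] := qvert_gt0 Q.
suff : (1 : K) = 0 by move/eqP; rewrite oner_eq0.
rewrite -(path_oneE v); apply: h => [|r Sr w]; last exact: hS.
split=> [w|f g hf hg w|f g hg w|f g hf w].
- exact: mcoeff0.
- by rewrite mcoeffB hf hg subrr.
- by rewrite mcoeff_trivialM hg mulr0.
- by rewrite mcoeff_trivialM hf mul0r.
Qed.

End PathAlgebra.

Section ConverseAlgebra.
Variables (K : fieldType) (A : algType K).

HB.instance Definition _ := GRing.Lmodule.on A^c%type.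

Local Notation cmul := ( *%R : A^c%type -> A^c%type -> A^c%type).

Lemma converse_scalerAl (k : K) (u v : A^c%type) :
  k *: cmul u v = cmul (k *: u) v.
Proof. exact: (@scalerAr K A k v u). Qed.
Lemma converse_scalerAr (k : K) (u v : A^c%type) :
  k *: cmul u v = cmul u (k *: v).
Proof. exact: (@scalerAl K A k v u). Qed.

HB.instance Definition _ :=
  GRing.Lmodule_isLalgebra.Build K A^c%type converse_scalerAl.
HB.instance Definition _ :=
  GRing.Lalgebra_isAlgebra.Build K A^c%type converse_scalerAr.

End ConverseAlgebra.

(* The monoid algebra of the multiplicative monoid A x B. *)
Definition pair_alg (K : fieldType) (A B : algType K) : Type :=
  {malg K[(A * B)%type]}.

Section TensorProduct.
Variables (K : fieldType) (A B : algType K).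
Local Notation P := (pair_alg A B).

HB.instance Definition _ := GRing.Lmodule.on P.

Definition pair_elt (a : A) (b : B) : P := bvec (a, b).

Definition pair_op (p q : A * B) : {malg K[(A * B)%type]} :=
  bvec (p.1 * q.1, p.2 * q.2).

Lemma pair_mulA : associative (bmul pair_op : P -> P -> P).
Proof. by apply: bmulA => p q r; rewrite !bmulUU /pair_op /= !mulrA. Qed.
Lemma pair_mul1 : left_id (pair_elt 1 1) (bmul pair_op : P -> P -> P).
Proof. by apply: bmul1 => -[a b]; rewrite bmulUU /pair_op /= !mul1r. Qed.
Lemma pair_mulr1 : right_id (pair_elt 1 1) (bmul pair_op : P -> P -> P).
Proof. by apply: bmulu => -[a b]; rewrite bmulUU /pair_op /= !mulr1. Qed.
Lemma pair_1neq0 : pair_elt 1 1 != 0.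
Proof. apply/eqP => /malgP/(_ (1, 1)); rewrite mcoeff_bvec mcoeff0 eqxx.
by move/eqP; rewrite oner_eq0. Qed.

HB.instance Definition _ := GRing.Zmodule_isNzRing.Build P
  pair_mulA pair_mul1 pair_mulr1 (@bmulDl _ _ pair_op) (@bmulDr _ _ pair_op)
  pair_1neq0.
HB.instance Definition _ :=
  GRing.Lmodule_isLalgebra.Build K P (@bmulZl _ _ pair_op).
HB.instance Definition _ :=
  GRing.Lalgebra_isAlgebra.Build K P (@bmulZr _ _ pair_op).

Lemma pair_eltM a b a' b' :
  pair_elt a b * pair_elt a' b' = pair_elt (a * a') (b * b').
Proof. exact: bmulUU. Qed.

Inductive tensor_rel : P -> Prop :=
| TensorDl a a' b :
    tensor_rel (pair_elt (a + a') b - (pair_elt a b + pair_elt a' b))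
| TensorDr a b b' :
    tensor_rel (pair_elt a (b + b') - (pair_elt a b + pair_elt a b'))
| TensorZl k a b : tensor_rel (pair_elt (k *: a) b - k *: pair_elt a b)
| TensorZr k a b : tensor_rel (pair_elt a (k *: b) - k *: pair_elt a b).

(* The linear span of the bilinearity relations is already an ideal, so this
   is the usual tensor product of algebras. *)
Definition tensor_alg (proper : ~ ideal_gen tensor_rel 1) : algType K :=
  quot_alg proper.

End TensorProduct.

Section EnvelopingAlgebra.
Variables (K : fieldType) (A : algType K).
Local Notation P := (@pair_alg K A^c%type A).

Definition env_act (t : P) (x : A) : A :=
  lext (fun p : A^c%type * A => p.2 * x * (p.1 : A)) t.

Lemma env_actU a b x : env_act (pair_elt a b) x = b * x * (a : A).
Proof. exact: lextU. Qed.

Lemma env_act_linearl x : linear (env_act^~ x).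
Proof. by move=> k s t; rewrite /env_act linearP. Qed.

Lemma env_act_linearr t : linear (env_act t).
Proof.
move=> k x y; rewrite /env_act /lext scaler_sumr -big_split.
apply: eq_bigr => p _ /=.
by rewrite mulrDr mulrDl -scalerAr -scalerAl scalerDr !scalerA mulrC.
Qed.

Lemma env_actB s t x : env_act (s - t) x = env_act s x - env_act t x.
Proof. by rewrite /env_act linearB. Qed.

Lemma env_actD s t x : env_act (s + t) x = env_act s x + env_act t x.
Proof. by rewrite /env_act linearD. Qed.

Lemma env_actZ k t x : env_act (k *: t) x = k *: env_act t x.
Proof. by rewrite /env_act linearZ. Qed.

Lemma env_act0 t : env_act t 0 = 0.
Proof. by rewrite /env_act /lext big1 // => p _; rewrite mulr0 mul0r scaler0. Qed.

Lemma env_act1 x : env_act 1 x = x.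
Proof. by rewrite env_actU mul1r [x * _]mulr1. Qed.

Lemma env_actM (s t : P) x : env_act (s * t) x = env_act s (env_act t x).
Proof.
pose F1 (s : {malg K[(A^c * A)%type]}) : A := env_act ((s : P) * t) x.
pose F2 (s : {malg K[(A^c * A)%type]}) : A := env_act s (env_act t x).
apply: (@eq_malg_linear K (A^c * A)%type A F1 F2) => {s} [k s s'|k s s'|p].
- by rewrite /F1 mulrDl -scalerAl env_act_linearl.
- by rewrite /F2 env_act_linearl.
rewrite /F1 /F2 {F1 F2}; move: t.
pose F1 (t : {malg K[(A^c * A)%type]}) : A := env_act ((bvec p : P) * (t : P)) x.
pose F2 (t : {malg K[(A^c * A)%type]}) : A := env_act (bvec p) (env_act t x).
apply: (@eq_malg_linear K (A^c * A)%type A F1 F2) => [k t t'|k t t'|q].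
- by rewrite /F1 mulrDr -scalerAr env_act_linearl.
- by rewrite /F2 env_act_linearl env_act_linearr.
rewrite /F1 /F2 {F1 F2}; case: p q => [a b] [c d]; rewrite (pair_eltM a b c d).
by rewrite !env_actU !mulrA.
Qed.

Lemma env_act_ideal t : ideal_gen (@tensor_rel K A^c%type A) t ->
  forall x, env_act t x = 0.
Proof.
move=> /(_ (fun t => forall x, env_act t x = 0)); apply; last first.
  move=> s; case=> [a a' b|a b b'|k a b|k a b] x;
    rewrite env_actB ?env_actD ?env_actZ !env_actU; apply/eqP; rewrite subr_eq0.
  - by rewrite [_ * (_ + _)]mulrDr.
  - by rewrite !mulrDl.
  - exact/eqP/(esym (@scalerAr K A k (b * x) a)).
  - by rewrite -!scalerAl.
split=> [x|s t' hs ht x|s t' ht x|s t' hs x].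
- by rewrite /env_act linear0.
- by rewrite env_actB hs ht subrr.
- by rewrite env_actM ht env_act0.
- by rewrite env_actM hs.
Qed.

Lemma env_proper : ~ ideal_gen (@tensor_rel K A^c%type A) 1.
Proof.
move=> /env_act_ideal/(_ 1); rewrite env_act1 => /eqP.
by rewrite oner_eq0.
Qed.

Definition env : algType K := tensor_alg env_proper.

Definition tens (a : A^c%type) (b : A) : env := quot_pi env_proper (pair_elt a b).

Lemma tensM (a b a' b' : A) :
  tens a b * tens a' b' = tens (a' * a : A) (b * b').
Proof. by rewrite -quot_piM pair_eltM. Qed.

Lemma tens11 : tens 1 1 = 1.
Proof. by []. Qed.

Lemma tens_linearl b : linear (tens^~ b).
Proof.
move=> k a a'; rewrite /= -quot_piZ -quot_piD.
transitivity (quot_pi env_proper (pair_elt (k *: a) b + pair_elt a' b)).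
  by apply/quot_piE; apply: ideal_gen_sub; apply: TensorDl.
rewrite !quot_piD; congr (_ + _).
by apply/quot_piE; apply: ideal_gen_sub; apply: TensorZl.
Qed.

Lemma tens_linearr a : linear (tens a).
Proof.
move=> k b b'; rewrite /= -quot_piZ -quot_piD.
transitivity (quot_pi env_proper (pair_elt a (k *: b) + pair_elt a b')).
  by apply/quot_piE; apply: ideal_gen_sub; apply: TensorDr.
rewrite !quot_piD; congr (_ + _).
by apply/quot_piE; apply: ideal_gen_sub; apply: TensorZr.
Qed.

(* A as a left module over A^op (x) A, where (a (x) b) acts by x |-> b x a. *)
Definition env_reg : Type := A.
HB.instance Definition _ := GRing.Zmodule.on env_reg.

Definition env_scale (t : env) (x : env_reg) : env_reg :=
  env_act (quot_repr t) x.

Lemma env_scaleE (t : P) x : env_scale (quot_pi env_proper t) x = env_act t x.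
Proof.
apply/eqP; rewrite -subr_eq0 -env_actB; apply/eqP.
by apply: env_act_ideal; apply: quot_repr_pi.
Qed.

Lemma env_scaleA (a b : env) x : env_scale a (env_scale b x) = env_scale (a * b) x.
Proof.
by elim/quot_ind: a => a; elim/quot_ind: b => b;
   rewrite -quot_piM !env_scaleE env_actM.
Qed.
Lemma env_scale1 : left_id (1 : env) env_scale.
Proof. by move=> x; rewrite -quot_pi1 env_scaleE env_act1. Qed.
Lemma env_scaleDr : right_distributive env_scale +%R.
Proof.
by move=> t x y; have := env_act_linearr (quot_repr t) 1 x y; rewrite !scale1r.
Qed.
Lemma env_scaleDl x : {morph env_scale^~ x : a b / a + b}.
Proof.
move=> a b; elim/quot_ind: a => a; elim/quot_ind: b => b.
by rewrite -quot_piD !env_scaleE env_actD.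
Qed.

HB.instance Definition _ := GRing.Zmodule_isLmodule.Build env env_reg
  env_scaleA env_scale1 env_scaleDr env_scaleDl.

Lemma tens_scaleE a b (x : env_reg) : tens a b *: x = b * (x : A) * (a : A).
Proof. by rewrite -env_actU -env_scaleE. Qed.

End EnvelopingAlgebra.

Section Ext.
Variables (K : fieldType) (R : algType K).

Definition projective (P : lmodType R) : Prop :=
  forall (X Y : lmodType R) (g : {linear X -> Y}) (f : {linear P -> Y}),
    (forall y, exists x, g x = y) ->
    exists h : {linear P -> X}, forall p, g (h p) = f p.

Record projective_resolution (M : lmodType R) := ProjectiveResolution {
  res_term : nat -> lmodType R;
  res_diff : forall n, {linear res_term n.+1 -> res_term n};
  res_aug : {linear res_term 0 -> M};
  res_projective : forall n, projective (res_term n);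
  res_aug_surj : forall m, exists x, res_aug x = m;
  res_exact0 : forall x, res_aug x = 0 <-> exists y, res_diff 0 y = x;
  res_exactS : forall n x,
    res_diff n x = 0 <-> exists y, res_diff n.+1 y = x
}.

Section Cohomology.
Variables (M N : lmodType R) (P : projective_resolution M) (n : nat).

(* Cocycles and coboundaries in degree n of the complex Hom_R(P, N). *)
Definition cocycle (f : {linear res_term P n -> N}) : Prop :=
  forall x, f (res_diff P n x) = 0.

Definition coboundary (f : res_term P n -> N) : Prop :=
  match n return (res_term P n -> N) -> Prop with
  | 0 => fun f => forall x, f x = 0
  | m.+1 => fun f => exists g : {linear res_term P m -> N},
                       forall x, f x = g (res_diff P m x)
  end f.

(* H^n(Hom_R(P, N)) has dimension d over K: some d cocycles represent a basis
   of the cocycles modulo the coboundaries. *)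
Definition cohomology_dim (d : nat) : Prop :=
  exists b : 'I_d -> {linear res_term P n -> N},
    (forall i, cocycle (b i)) /\
    (forall f : {linear res_term P n -> N}, cocycle f ->
       exists! c : 'rV[K]_d,
         coboundary (fun x => f x - \sum_i (c 0 i)%:A *: b i x)).

End Cohomology.

(* dim_K Ext^n_R(M, N) = d.  Ext does not depend on the projective resolution
   of M, and such resolutions exist, see
   [free_resolution] below. *)
Definition Ext_dim (n : nat) (M N : lmodType R) (d : nat) : Prop :=
  forall P : projective_resolution M, cohomology_dim N P n d.

End Ext.

Section KernelModule.
Variables (R : nzRingType) (U V : lmodType R) (h : {linear U -> V}).

Definition ker_pred : {pred U} := fun x => h x == 0.

Lemma ker_pred_submod : submod_closed ker_pred.
Proof.
split=> [|k x y]; rewrite /ker_pred /in_mem /= ?linear0 // => /eqP hx /eqP hy.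
by rewrite linearP hx hy scaler0 addr0.
Qed.

HB.instance Definition _ := GRing.isSubmodClosed.Build R U ker_pred
  ker_pred_submod.

Definition ker_mod : Type := {x : U | ker_pred x}.
HB.instance Definition _ := SubChoice.on ker_mod.
HB.instance Definition _ := [SubChoice_isSubLmodule of ker_mod by <:].

End KernelModule.

Section FreeResolution.
Variables (K : fieldType) (R : algType K).

Definition free_cover (M : lmodType R) : lmodType R := {malg R[M]}.

Definition cover_map (M : lmodType R) : {linear free_cover M -> M} :=
  lext (fun m : M => m).

Lemma cover_surj (M : lmodType R) (m : M) : exists x, cover_map M x = m.
Proof. by exists (bvec m); rewrite [LHS]lextU. Qed.

Lemma free_projective (M : lmodType R) : projective (free_cover M).
Proof.
move=> X Y g f gs.
have /choice[s hs] : forall m : M, exists x, g x = f (bvec m) by move=> m; apply: gs.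
exists (lext s) => p.
apply: (@eq_malg_linear R M Y (fun p => g (lext s p)) f) => [k x y|k x y|m].
- by rewrite !linearP.
- by rewrite linearP.
by rewrite lextU.
Qed.

Definition syzygy_step (M : lmodType R) : lmodType R := ker_mod (cover_map M).

Definition syzygy (M : lmodType R) (n : nat) : lmodType R :=
  iter n syzygy_step M.

Definition syz_incl (M : lmodType R) :
  {linear syzygy_step M -> free_cover M} := val.

Definition free_diff (M : lmodType R) (n : nat) :
    {linear free_cover (syzygy M n.+1) -> free_cover (syzygy M n)} :=
  syz_incl (syzygy M n) \o cover_map (syzygy M n.+1).

Lemma free_exact (M : lmodType R) (x : free_cover M) :
  cover_map M x = 0 <->
  exists y, syz_incl M (cover_map (syzygy_step M) y) = x.
Proof.
split=> [x0|[y <-]]; last first.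
  by move: (cover_map _ y) => z; apply/eqP; apply: (valP z).
have kx : ker_pred (cover_map M) x by apply/eqP.
have [y ey] := cover_surj (Sub x kx : syzygy_step M).
by exists y; rewrite ey; apply: SubK.
Qed.

Lemma syz_incl_eq0 (M : lmodType R) z : syz_incl M z = 0 <-> z = 0.
Proof.
by split=> [h|->]; [apply: val_inj; rewrite [LHS]h linear0|rewrite linear0].
Qed.

Lemma free_exactS (M : lmodType R) n (x : free_cover (syzygy M n.+1)) :
  free_diff M n x = 0 <-> exists y, free_diff M n.+1 y = x.
Proof.
split=> [/syz_incl_eq0/free_exact//|h].
by apply/syz_incl_eq0/free_exact.
Qed.

Definition free_resolution (M : lmodType R) : projective_resolution M :=
  @ProjectiveResolution K R M (fun n => free_cover (syzygy M n)) (free_diff M)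
    (cover_map M) (fun n => @free_projective (syzygy M n)) (@cover_surj M)
    (@free_exact M) (@free_exactS M).

End FreeResolution.

(* dim_K HH^n(A) = d, where HH^n(A) = Ext^n_(A^e)(A, A). *)
Definition HH_dim (K : fieldType) (A : algType K) (n d : nat) : Prop :=
  Ext_dim n (env_reg A : lmodType (env A)) (env_reg A : lmodType (env A)) d.

Inductive vertex := v1 | v2 | v3 | v4.

Definition vertex_ord (v : vertex) : 'I_4 :=
  inord (match v with v1 => 0 | v2 => 1 | v3 => 2 | v4 => 3 end).
Definition ord_vertex (i : 'I_4) : vertex := nth v1 [:: v1; v2; v3; v4] i.
Lemma vertex_ordK : cancel vertex_ord ord_vertex.
Proof. by case; rewrite /ord_vertex inordK. Qed.
HB.instance Definition _ := Finite.copy vertex (can_type vertex_ordK).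

Inductive arrow := alpha | beta | xi | epsilon | gamma | delta.

Definition arrow_ord (a : arrow) : 'I_6 :=
  inord (match a with alpha => 0 | beta => 1 | xi => 2
                    | epsilon => 3 | gamma => 4 | delta => 5 end).
Definition ord_arrow (i : 'I_6) : arrow :=
  nth alpha [:: alpha; beta; xi; epsilon; gamma; delta] i.
Lemma arrow_ordK : cancel arrow_ord ord_arrow.
Proof. by case; rewrite /ord_arrow inordK. Qed.
HB.instance Definition _ := Finite.copy arrow (can_type arrow_ordK).

Definition arrow_src (a : arrow) : vertex :=
  match a with
  | alpha => v1 | xi => v2 | gamma => v3
  | beta | epsilon | delta => v4
  end.
Definition arrow_tgt (a : arrow) : vertex :=
  match a with
  | alpha | xi | gamma => v4
  | beta => v1 | epsilon => v2 | delta => v3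
  end.

Lemma vertex_gt0 : (0 < #|{: vertex}|)%N.
Proof. by apply/card_gt0P; exists v1. Qed.

Definition quiver9 : quiver :=
  @Quiver vertex arrow arrow_src arrow_tgt vertex_gt0.

Section Lambda9'.
Variable K : fieldType.
Local Notation KQ := (path_alg K quiver9).
Local Notation "\[ a ]" := (@qarrow K quiver9 a) (at level 0).

Inductive relation9' : KQ -> Prop :=
| Rel_sum : relation9' (\[beta] * \[alpha] + \[epsilon] * \[xi]
                          + \[delta] * \[gamma])
| Rel_alphabeta : relation9' (\[alpha] * \[beta])
| Rel_xiepsilon : relation9' (\[xi] * \[epsilon])
| Rel_gammadelta : relation9' (\[gamma] * \[delta]).

Lemma relation9'_proper : ~ ideal_gen relation9' 1.
Proof.
apply: arrow_ideal_proper => r v.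
have a0 a : \[a]@_(trivial_path v) = 0.
  by rewrite mcoeff_bvec; case: eqP => // /(congr1 (@parrs _)).
by case; rewrite ?mcoeffD !mcoeff_trivialM !a0 ?mulr0 ?addr0.
Qed.

Definition Lambda9' : algType K := quot_alg relation9'_proper.

End Lambda9'.

(* Main.v *)
(* Ext is computed from any projective resolution, so it suffices to have the
   first three terms of one for A = KQ/I as a bimodule, where I is generated by
   relations r_j:
     (+)_j Ae (x) eA -> (+)_arrows Ae (x) eA -> (+)_vertices Ae (x) eA -> A,
   the second differential being the universal derivation D of KQ evaluated at the
   r_j.  It is exact since b (x) a |-> b D(s a), for a linear section s of
   KQ -> A, contracts it modulo the image of the second differential.

   Cochains are then families of elements of A parallel to the vertices, arrows
   or relations.  Write a_i, b_i for the arrows into and out of the vertex 4, and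
   put c_i = b_i a_i, so that c_1 + c_2 + c_3 = 0 and a_i b_i = 0; A has a basis of
   28 elements.  A 2-cochain has parts p_i e_i and p_4 e_4 and parts in the radical.
   The syzygy at the leaf i gives 2 p_i + p_j + p_k = 2 p_4, the one at 4 gives
   4 p_4 = 2 (p_1 + p_2 + p_3), so p = 0 unless char K = 2; the coboundaries have
   p = 0 and, only if char K = 2, one further constraint on the socle parts.
   In characteristic 2 three cocycles are needed.  A 2-cochain is a cocycle as
   soon as it factors through the second differential by a merely left A-linear
   map, and such maps are given by tables on the basis. *)
From HB Require Import structures.
From mathcomp Require Import all_boot all_order all_algebra.
From mathcomp Require Import boolp finmap ring.
From mathcomp.multinomials Require Import monalg.
Require Import Defs.

Set Implicit Arguments.
Unset Strict Implicit.
Unset Printing Implicit Defensive.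

Import GRing.Theory.
Local Open Scope ring_scope.

(** * Independence of the resolution *)

(** The algebra is the preprojective algebra of type D_4. The obstacle is degree 2, where a cocycle
    has to vanish on the kernel of the second differential: no generators of this kernel are
    determined, and two one-sided tests replace them. The syzygies that give necessary conditions
    are sums of (-1)^|x| x (x) x', with x in a basis of e_v A and x' in the dual basis, so that x x'
    is a socle element; hence only the identity parts of a cochain n survive in x n x'. Conversely,
    asking for a left A-linear factorization loses nothing: the terms and A are projective left
    modules, so the complex splits on that side and every cocycle factors in this way, whereas a
    factorization by a bimodule map would make it a coboundary. Linear independence of the 28
    elements is not obtained by rewriting paths: the arrows act by tables on a space with that
    basis, the relations act by zero, and the chosen paths send the coordinates of 1 to the basis
    vectors. The prime 2 enters through signs: if a_i goes to y_i a_i c_(i+1) and b_i to y'_i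
    c_(i+1) b_i, the relation at the leaf i sees y_i + y'_i, the one at 4 sees y_i - y'_i. *)

Section Comparison.
Variables (K : fieldType) (R : algType K) (M : lmodType R).
Implicit Types P Q : projective_resolution M.

Definition res_cycle P n : res_term P n -> Prop :=
  match n return res_term P n -> Prop with
  | 0 => fun x => res_aug P x = 0
  | m.+1 => fun x => res_diff P m x = 0
  end.

Lemma res_cycleP P n (x : res_term P n) :
  res_cycle x <-> exists y, res_diff P n y = x.
Proof. by case: n x => [|n] x; [apply: res_exact0|apply: res_exactS]. Qed.

Lemma res_cycle_diff P n (x : res_term P n.+1) : res_cycle (res_diff P n x).
Proof. by apply/res_cycleP; exists x. Qed.

(* Projectivity lifts maps along surjections only, and the differential is onto
   the submodule of cycles. *)
Definition cycle_pred P n : {pred res_term P n} := fun x => `[< res_cycle x >].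

Lemma cycle_pred_submod P n : submod_closed (@cycle_pred P n).
Proof.
case: n => [|n]; split=> [|k x y]; rewrite /cycle_pred /in_mem /=;
  try by apply/asboolP; rewrite /= linear0.
- by move=> /asboolP hx /asboolP hy; apply/asboolP;
    rewrite /= linearP hx hy scaler0 addr0.
- by move=> /asboolP hx /asboolP hy; apply/asboolP;
    rewrite /= linearP hx hy scaler0 addr0.
Qed.

HB.instance Definition _ P n :=
  GRing.isSubmodClosed.Build R (res_term P n) (@cycle_pred P n)
    (@cycle_pred_submod P n).

Definition cycle_mod P n : Type := {x : res_term P n | cycle_pred x}.
HB.instance Definition _ P n := SubChoice.on (cycle_mod P n).
HB.instance Definition _ P n := [SubChoice_isSubLmodule of cycle_mod P n by <:].

Lemma lift_cycle P n (L : lmodType R) (f : {linear L -> res_term P n}) :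
  projective L -> (forall x, res_cycle (f x)) ->
  exists h : {linear L -> res_term P n.+1}, forall x, res_diff P n (h x) = f x.
Proof.
move=> prL cf.
have cyc (x : res_term P n) : res_cycle x -> cycle_pred x by move/asboolP.
pose dz (x : res_term P n.+1) : cycle_mod P n := Sub _ (cyc _ (res_cycle_diff x)).
pose fz (x : L) : cycle_mod P n := Sub _ (cyc _ (cf x)).
have dzl : linear dz.
  by move=> k x y; apply: val_inj; rewrite /= linearP.
have fzl : linear fz.
  by move=> k x y; apply: val_inj; rewrite /= linearP.
pose dL : {linear res_term P n.+1 -> cycle_mod P n} :=
  HB.pack dz (GRing.isLinear.Build _ _ _ _ dz dzl).
pose fL : {linear L -> cycle_mod P n} :=
  HB.pack fz (GRing.isLinear.Build _ _ _ _ fz fzl).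
have [|h hE] := prL _ _ dL fL.
  case=> y yz; have /asboolP/res_cycleP[x xE] := yz.
  by exists x; apply: val_inj.
by exists h => x; have /(congr1 val) := hE x.
Qed.

Section ChainMap.
Variables P Q : projective_resolution M.

Definition cycle_map n (u : {linear res_term P n -> res_term Q n}) :=
  forall x, res_cycle x -> res_cycle (u x).

Lemma chain_map0 : {u : {linear res_term P 0 -> res_term Q 0} |
  forall x, res_aug Q (u x) = res_aug P x}.
Proof.
apply: cid; have [h hE] := res_projective (res_aug P) (@res_aug_surj _ _ _ Q).
by exists h.
Qed.

Lemma chain_mapS n (u : {linear res_term P n -> res_term Q n}) : cycle_map u ->
  {v : {linear res_term P n.+1 -> res_term Q n.+1} |
    forall x, res_diff Q n (v x) = u (res_diff P n x)}.
Proof.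
move=> cu; apply: cid; have [h hE] := lift_cycle (f := u \o res_diff P n)
  (@res_projective _ _ _ P n.+1) (fun x => cu _ (res_cycle_diff x)).
by exists h.
Qed.

(** The recursion only carries that cycles go to cycles, which is what lifting to the next degree
    requires; commutation with the differentials is recovered from each step in [chain_mapP]. *)
Fixpoint chain_map n : {u : {linear res_term P n -> res_term Q n} | cycle_map u} :=
  match n with
  | 0 => let: exist u uE := chain_map0 in
         exist _ u (fun x (xz : res_aug P x = 0) => etrans (uE x) xz)
  | m.+1 => let: exist u cu := chain_map m in
            let: exist v vE := chain_mapS cu in
            exist _ v (fun x (xz : res_diff P m x = 0) =>
              etrans (vE x) (etrans (congr1 u xz) (linear0 u)))
  end.

Lemma chain_mapP : exists u : forall n, {linear res_term P n -> res_term Q n},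
  (forall x, res_aug Q (u 0 x) = res_aug P x) /\
  (forall n x, res_diff Q n (u n.+1 x) = u n (res_diff P n x)).
Proof.
exists (fun n => projT1 (chain_map n)); split=> [x|n x] /=.
  by case: chain_map0.
by case: (chain_map n) => u cu /=; case: (chain_mapS cu).
Qed.

End ChainMap.

Section NullHomotopy.
Variables (P : projective_resolution M).
Variable w : forall n, {linear res_term P n -> res_term P n}.
Hypothesis w_aug : forall x, res_aug P (w 0 x) = 0.
Hypothesis w_diff : forall n x, res_diff P n (w n.+1 x) = w n (res_diff P n x).

(** The identity w = d h + h d on cycles, where its last term is zero. This weaker statement is all
    that the next degree uses, so it can serve as the invariant of the recursion. *)
Definition cycle_homotopy n (h : {linear res_term P n -> res_term P n.+1}) :=
  forall x, res_cycle x -> res_diff P n (h x) = w n x.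

Lemma homotopy_step n (h : {linear res_term P n -> res_term P n.+1}) :
  cycle_homotopy h ->
  {h' : {linear res_term P n.+1 -> res_term P n.+2} |
    forall x, res_diff P n.+1 (h' x) = w n.+1 x - h (res_diff P n x)}.
Proof.
move=> ch; apply: cid.
have fl : linear (fun x => w n.+1 x - h (res_diff P n x)).
  move=> k x y; rewrite (linearP (w n.+1)) (linearP (res_diff P n)) (linearP h).
  by rewrite scalerBr opprD addrACA.
pose f : {linear _ -> _} := HB.pack (fun x => w n.+1 x - h (res_diff P n x))
  (GRing.isLinear.Build _ _ _ _ _ fl).
have [|k kE] := lift_cycle (f := f) (@res_projective _ _ _ P n.+1); last by exists k.
move=> x /=; rewrite linearB /= w_diff ch ?subrr //; exact: res_cycle_diff.
Qed.

Lemma homotopy0 : {h : {linear res_term P 0 -> res_term P 1} |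
  forall x, res_diff P 0 (h x) = w 0 x}.
Proof.
by apply: cid; apply: lift_cycle => //; apply: res_projective.
Qed.

Fixpoint homotopy n :
    {h : {linear res_term P n -> res_term P n.+1} | cycle_homotopy h} :=
  match n with
  | 0 => let: exist h hE := homotopy0 in exist _ h (fun x _ => hE x)
  | m.+1 => let: exist h ch := homotopy m in
            let: exist h' hE := homotopy_step ch in
            exist _ h' (fun x (xz : res_diff P m x = 0) =>
              etrans (hE x) (etrans (congr1 (fun y => w m.+1 x - h y) xz)
                (etrans (congr1 (fun y => w m.+1 x - y) (linear0 h)) (subr0 _))))
  end.

Lemma homotopyP : exists h : forall n, {linear res_term P n -> res_term P n.+1},
  (forall x, w 0 x = res_diff P 0 (h 0 x)) /\
  (forall n x, w n.+1 x = res_diff P n.+1 (h n.+1 x) + h n (res_diff P n x)).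
Proof.
exists (fun n => projT1 (homotopy n)); split=> [x|n x] /=.
  by case: homotopy0 => h /= ->.
by case: (homotopy n) => h ch /=; case: (homotopy_step ch) => h' /= ->; rewrite subrK.
Qed.

(** By w = d h + h d, a cocycle f satisfies f w = f h d. *)
Lemma cocycle_null (N : lmodType R) n (f : {linear res_term P n -> N}) :
  cocycle f -> coboundary (N := N) (P := P) (n := n) (fun x => f (w n x)).
Proof.
have [h [h0 hS]] := homotopyP; case: n f => [|n] f cf /=.
  by move=> x; rewrite h0.
exists (f \o h n) => x /=.
by rewrite hS linearD cf add0r.
Qed.

End NullHomotopy.

Section CoboundaryOps.
Variables (N : lmodType R) (P : projective_resolution M) (n : nat).
Local Notation cob := (@coboundary K R M N P n).

Lemma coboundary_ext (f g : res_term P n -> N) : f =1 g -> cob f -> cob g.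
Proof.
case: n f g => [|m] f g fg /=; first by move=> f0 x; rewrite -fg.
by case=> h fh; exists h => x; rewrite -fg.
Qed.

Lemma coboundaryB (f g : res_term P n -> N) :
  cob f -> cob g -> cob (fun x => f x - g x).
Proof.
case: n f g => [|m] f g /=; first by move=> f0 g0 x; rewrite f0 g0 subrr.
by case=> h hE [k kE]; exists (h \- k) => x; rewrite hE kE.
Qed.

Lemma coboundary0 : cob (fun=> 0).
Proof. by case: n => [|m] //=; exists \0 => x. Qed.

Lemma coboundaryD (f g : res_term P n -> N) :
  cob f -> cob g -> cob (fun x => f x + g x).
Proof.
move=> hf hg; apply: coboundary_ext (coboundaryB hf (coboundaryB coboundary0 hg)).
by move=> x; rewrite sub0r opprK.
Qed.

Lemma coboundaryZ (k : K) (f : res_term P n -> N) :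
  cob f -> cob (fun x => k%:A *: f x).
Proof.
case: n f => [|m] f /=; first by move=> f0 x; rewrite f0 scaler0.
case=> h hE.
have hl : linear (fun x => k%:A *: h x).
  move=> r x y; rewrite linearP scalerDr !scalerA -scalerAl mul1r -scalerAr mulr1.
  by [].
pose kh : {linear res_term P m -> N} := HB.pack (fun x => k%:A *: h x)
  (GRing.isLinear.Build _ _ _ _ _ hl).
by exists kh => x; rewrite hE.
Qed.

Lemma coboundary_sum (I : finType) (f : I -> res_term P n -> N) :
  (forall i, cob (f i)) -> cob (fun x => \sum_i f i x).
Proof.
move=> hf; elim: (index_enum I) => [|i s IH].
  by apply: coboundary_ext coboundary0 => x; rewrite big_nil.
by apply: coboundary_ext (coboundaryD (hf i) IH) => x; rewrite big_cons.
Qed.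

Lemma cohomology_dimI d (b : 'I_d -> {linear res_term P n -> N}) :
  (forall i, cocycle (b i)) ->
  (forall f : {linear res_term P n -> N}, cocycle f ->
     exists c : 'I_d -> K, cob (fun x => f x - \sum_i (c i)%:A *: b i x)) ->
  (forall c : 'I_d -> K, cob (fun x => \sum_i (c i)%:A *: b i x) -> c =1 (fun=> 0)) ->
  cohomology_dim N P n d.
Proof.
move=> cb span indep; exists b; split=> // f cf.
have [c cE] := span f cf; exists (\row_i c i); split=> [|c' c'E].
  by apply: coboundary_ext cE => x; congr (_ - _); apply: eq_bigr => i _; rewrite mxE.
apply/rowP => i; rewrite mxE; apply/eqP; rewrite -subr_eq0; apply/eqP.
apply: (indep (fun i => c i - c' 0 i)).
apply: coboundary_ext (coboundaryB c'E cE) => x.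
rewrite opprB addrC addrA subrK -sumrB; apply: eq_bigr => j _.
by rewrite !scalerBl.
Qed.

End CoboundaryOps.

Lemma coboundary_comp (N : lmodType R) (P Q : projective_resolution M)
    (u : forall n, {linear res_term P n -> res_term Q n}) n
    (f : res_term Q n -> N) :
  (forall n x, res_diff Q n (u n.+1 x) = u n (res_diff P n x)) ->
  coboundary (P := Q) f -> coboundary (P := P) (fun x => f (u n x)).
Proof.
move=> uS; case: n f => [|n] f /=; first by move=> f0 x; rewrite f0.
by case=> h hE; exists (h \o u n) => x; rewrite hE uS.
Qed.

Lemma chain_map_homotopic (N : lmodType R) (P Q : projective_resolution M)
    (u : forall n, {linear res_term P n -> res_term Q n})
    (v : forall n, {linear res_term Q n -> res_term P n}) n
    (f : {linear res_term P n -> N}) :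
  (forall x, res_aug Q (u 0 x) = res_aug P x) ->
  (forall n x, res_diff Q n (u n.+1 x) = u n (res_diff P n x)) ->
  (forall x, res_aug P (v 0 x) = res_aug Q x) ->
  (forall n x, res_diff P n (v n.+1 x) = v n (res_diff Q n x)) ->
  cocycle f -> coboundary (P := P) (fun x => f x - f (v n (u n x))).
Proof.
move=> u0 uS v0 vS cf.
pose w m : {linear res_term P m -> res_term P m} := idfun \- (v m \o u m).
apply: (@coboundary_ext N P n (fun x => f (w n x))).
  by move=> x; rewrite /w /= linearB.
apply: cocycle_null cf => [x|m x]; rewrite /w /= linearB /=.
  by rewrite v0 u0 subrr.
by rewrite vS uS.
Qed.

(** The basis on [Q] is pulled back along a comparison map u; since f and f v u differ by a
    coboundary, the coefficients of f v on [Q] serve for f on [P]. *)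
Theorem Ext_dim_resolution (N : lmodType R) (Q : projective_resolution M) n d :
  cohomology_dim N Q n d -> Ext_dim n M N d.
Proof.
move=> [b [cb bE]] P.
have [u [u0 uS]] := chain_mapP P Q; have [v [v0 vS]] := chain_mapP Q P.
have comp_cocycle P1 P2 (t : forall n, {linear res_term P1 n -> res_term P2 n})
    (g : {linear res_term P2 n -> N}) :
    (forall n x, res_diff P2 n (t n.+1 x) = t n (res_diff P1 n x)) ->
    cocycle g -> cocycle (g \o t n : {linear res_term P1 n -> N}).
  by move=> tS cg x; rewrite /= -tS.
exists (fun i => b i \o u n); split=> [i|f cf]; first exact: comp_cocycle.
have [c [cE cU]] := bE (f \o v n) (comp_cocycle _ _ v f vS cf).
exists c; split=> [|c' c'E].
  apply: coboundary_ext (coboundaryD (chain_map_homotopic u0 uS v0 vS cf)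
    (coboundary_comp uS cE)) => x /=.
  by rewrite addrA subrK.
(* Uniqueness: the relation on [P] is pulled back along v, and each b_i u v is replaced by b_i up to
   a coboundary. *)
apply: cU; have hb i := chain_map_homotopic v0 vS u0 uS (cb i).
apply: coboundary_ext (coboundaryB (coboundary_comp vS c'E)
  (coboundary_sum (fun i => coboundaryZ (c' 0 i) (hb i)))) => x /=.
rewrite -addrA -opprD -big_split /=; congr (_ - _); apply: eq_bigr => i _.
by rewrite -scalerDr addrC subrK.
Qed.

End Comparison.

(** * Completing three terms to a resolution *)

Section ExtendResolution.
Variables (K : fieldType) (R : algType K) (M Q0 Q1 Q2 : lmodType R).
Variables (aug : {linear Q0 -> M}) (d1 : {linear Q1 -> Q0}) (d2 : {linear Q2 -> Q1}).
Hypotheses (pr0 : projective Q0) (pr1 : projective Q1) (pr2 : projective Q2).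
Hypothesis aug_surj : forall m, exists x, aug x = m.
Hypothesis exact0 : forall x, aug x = 0 <-> exists y, d1 y = x.
Hypothesis exact1 : forall x, d1 x = 0 <-> exists y, d2 y = x.

(** From degree 3 on this is the free resolution of the kernel of [d2], so that the higher syzygies
    of [M] need not be known. *)
Definition ext_term (n : nat) : lmodType R :=
  match n with
  | 0 => Q0 | 1 => Q1 | 2 => Q2
  | k.+3 => free_cover (syzygy (ker_mod d2) k)
  end.

Definition ker_incl : {linear ker_mod d2 -> Q2} := val.

Definition ext_diff (n : nat) : {linear ext_term n.+1 -> ext_term n} :=
  match n return {linear ext_term n.+1 -> ext_term n} with
  | 0 => d1 | 1 => d2
  | 2 => ker_incl \o cover_map (ker_mod d2)
  | k.+3 => free_diff (ker_mod d2) k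
  end.

Lemma ext_projective n : projective (ext_term n).
Proof. by case: n => [|[|[|k]]] //; apply: free_projective. Qed.

Lemma ker_incl_eq0 z : ker_incl z = 0 <-> z = 0.
Proof. by split=> [h|->]; [apply: val_inj; rewrite [LHS]h linear0|rewrite linear0]. Qed.

Lemma ext_exactS n x : ext_diff n x = 0 <-> exists y, ext_diff n.+1 y = x.
Proof.
case: n x => [|[|[|k]]] x //=.
- split=> [x0|[y <-]].
    have kx : ker_pred d2 x by apply/eqP.
    have [y ey] := cover_surj (Sub x kx : ker_mod d2).
    by exists y; rewrite ey; apply: SubK.
  by move: (cover_map _ y) => z; apply/eqP; apply: (valP z).
- split=> [/ker_incl_eq0/free_exact//|h].
  by apply/ker_incl_eq0/free_exact.
- exact: free_exactS.
Qed.

Definition ext_resolution : projective_resolution M :=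
  @ProjectiveResolution K R M ext_term ext_diff aug ext_projective aug_surj
    exact0 ext_exactS.

End ExtendResolution.

(** * Projective modules from idempotents *)

(* The direct sum of the left ideals R e_k, as the kernel of the endomorphism
   (x_k)_k |-> (x_k e_k - x_k)_k of R^I. *)
Section IdempotentModule.
Variables (R : nzRingType) (I : finType) (e : I -> R).
Hypothesis eK : forall k, e k * e k = e k.

Definition idem_defect (x : {ffun I -> R^o}) : {ffun I -> R^o} :=
  [ffun k => x k * e k - x k].

Lemma idem_defect_linear : linear idem_defect.
Proof.
move=> r x y; apply/ffunP => k; rewrite !ffunE /=.
by rewrite mulrDl -scalerAl scalerBr opprD addrACA.
Qed.

HB.instance Definition _ := GRing.isLinear.Build R {ffun I -> R^o} {ffun I -> R^o} _
  idem_defect idem_defect_linear.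

Definition idem_mod : lmodType R := ker_mod idem_defect.

Definition icomp (x : idem_mod) (k : I) : R := (val x : {ffun I -> R^o}) k.

Lemma icompK x k : icomp x k * e k = icomp x k.
Proof.
have /eqP/ffunP/(_ k) := valP x; rewrite !ffunE => /eqP.
by rewrite subr_eq0 => /eqP.
Qed.

Lemma idem_mod_eqP (x y : idem_mod) : (forall k, icomp x k = icomp y k) -> x = y.
Proof. by move=> xy; apply/val_inj/ffunP. Qed.

Lemma icompD x y k : icomp (x + y) k = icomp x k + icomp y k.
Proof. by rewrite /icomp /= ffunE. Qed.
Lemma icompZ r x k : icomp (r *: x) k = r * icomp x k.
Proof. by rewrite /icomp /= ffunE. Qed.
Lemma icomp0 k : icomp 0 k = 0.
Proof. by rewrite /icomp /= ffunE. Qed.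
Lemma icomp_sum (J : Type) (s : seq J) (F : J -> idem_mod) k :
  icomp (\sum_(j <- s) F j) k = \sum_(j <- s) icomp (F j) k.
Proof.
elim: s => [|j s IH]; first by rewrite !big_nil icomp0.
by rewrite !big_cons icompD IH.
Qed.

Lemma igen_subproof k : ker_pred idem_defect [ffun j => if j == k then e k else 0].
Proof.
apply/eqP/ffunP => j; rewrite !ffunE; case: eqP => [->|_].
  by rewrite eK subrr.
by rewrite mul0r subrr.
Qed.

(* Unification tends to unfold this term at great cost, whence the lock. *)
Definition igen k : idem_mod := locked (Sub _ (igen_subproof k)).

Lemma icomp_gen k j : icomp (igen k) j = if j == k then e k else 0.
Proof. by rewrite /icomp /igen -lock SubK ffunE. Qed.

Lemma igenK k : e k *: igen k = igen k.
Proof.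
by apply: idem_mod_eqP => j; rewrite icompZ !icomp_gen; case: eqP; rewrite ?eK ?mulr0.
Qed.

Lemma idem_modE x : x = \sum_k icomp x k *: igen k.
Proof.
apply: idem_mod_eqP => j; rewrite icomp_sum (bigD1 j) //= big1 => [|i ij].
  by rewrite icompZ icomp_gen eqxx icompK addr0.
by rewrite icompZ icomp_gen eq_sym (negPf ij) mulr0.
Qed.

Section Hom.
Variables (N : lmodType R).

Definition ihom (n : I -> N) (x : idem_mod) : N := \sum_k icomp x k *: n k.

Lemma ihom_linear n : linear (ihom n).
Proof.
move=> r x y; rewrite /ihom scaler_sumr -big_split; apply: eq_bigr => k _.
by rewrite icompD icompZ scalerDl scalerA.
Qed.

HB.instance Definition _ n := GRing.isLinear.Build R idem_mod N _ (ihom n)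
  (ihom_linear n).

Lemma ihom_gen n k : ihom n (igen k) = e k *: n k.
Proof.
rewrite /ihom (bigD1 k) //= big1 => [|j jk]; first by rewrite icomp_gen eqxx addr0.
by rewrite icomp_gen (negPf jk) scale0r.
Qed.

Lemma idem_mod_hom (f : {linear idem_mod -> N}) x :
  f x = \sum_k icomp x k *: f (igen k).
Proof. by rewrite {1}[x]idem_modE linear_sum; apply: eq_bigr => k _; rewrite linearZ. Qed.

Lemma idem_mod_homK (f : {linear idem_mod -> N}) k : e k *: f (igen k) = f (igen k).
Proof. by rewrite -linearZ /= igenK. Qed.

Lemma idem_mod_ext (f g : {linear idem_mod -> N}) :
  (forall k, f (igen k) = g (igen k)) -> f =1 g.
Proof.
by move=> fg x; rewrite !idem_mod_hom; apply: eq_bigr => k _; rewrite fg.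
Qed.

End Hom.
End IdempotentModule.

(** A preimage of a generator need not be fixed by its idempotent; multiplying it by [e k] repairs
    this without changing the image. *)
Lemma idem_mod_projective (K : fieldType) (R : algType K) (I : finType)
  (e : I -> R) (eK : forall k, e k * e k = e k) : projective (idem_mod e).
Proof.
move=> X Y g f gs.
have /choice[s hs] : forall k, exists x, g x = f (igen eK k) by move=> k; apply: gs.
exists (ihom s) => x.
pose gf : {linear idem_mod e -> Y} := g \o ihom s.
rewrite -[LHS]/(gf x); move: x; apply: (idem_mod_ext (eK := eK)) => k; rewrite /gf /=.
by rewrite ihom_gen linearZ /= hs idem_mod_homK.
Qed.

Section LinearOf.
Variables (K : fieldType) (U V : lmodType K) (f : U -> V).
Hypothesis lf : linear f.

Lemma linear_zero : f 0 = 0.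
Proof.
have := lf 1 0 0; rewrite !scale1r addr0 => /esym/eqP.
by rewrite -subr_eq0 addrK => /eqP.
Qed.

Lemma linear_scale k x : f (k *: x) = k *: f x.
Proof. by have := lf k x 0; rewrite linear_zero !addr0. Qed.

Lemma linear_add x y : f (x + y) = f x + f y.
Proof. by have := lf 1 x y; rewrite !scale1r. Qed.

End LinearOf.

(** * The enveloping algebra *)

Section EnvLift.
Variables (K : fieldType) (A : algType K).
Local Notation P := (@pair_alg K A^c%type A).

Lemma env_ind (T : env A -> Prop) :
  (forall x y, T x -> T y -> T (x + y)) -> (forall a b, T (tens a b)) ->
  forall t, T t.
Proof.
move=> TD Tt; elim/quot_ind=> t; rewrite [t](@monalgE _ _ t).
elim: (enum_fset _) => [|p s IH].
  by rewrite big_nil -(scale0r (0 : P)) quot_piZ scale0r -(linear_zero (tens_linearr 0)).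
rewrite big_cons quot_piD; apply: TD => //.
rewrite malg_scaleU quot_piZ; case: p => a b.
rewrite -[_ *: _]/(_ *: tens a b) -(linear_scale (tens_linearr a)); exact: Tt.
Qed.

Variables (V : lmodType K) (beta : A -> A -> V).
Hypothesis betal : forall b, linear (beta^~ b).
Hypothesis betar : forall a, linear (beta a).

Definition pair_lift (t : P) : V := lext (fun p : A^c%type * A => beta p.2 p.1) t.

Lemma pair_liftU (a : A^c%type) (b : A) : pair_lift (pair_elt a b) = beta b a.
Proof. exact: lextU. Qed.

Lemma pair_lift_linear : linear pair_lift.
Proof. by move=> k s t; rewrite /pair_lift linearP. Qed.
HB.instance Definition _ := GRing.isLinear.Build K P V _ pair_lift pair_lift_linear.

(** The multiples s t u are included so that the property cuts out an ideal; a bilinearity relation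
    multiplied by pure tensors is again one, which reduces the claim to [betal] and [betar]. *)
Lemma pair_lift_ideal t : ideal_gen (@tensor_rel K A^c%type A) t ->
  forall s u : P, pair_lift (s * t * u) = 0.
Proof.
move=> /(_ (fun t => forall s u : P, pair_lift (s * t * u) = 0)); apply.
  split=> [s u|x y hx hy s u|a x hx s u|x a hx s u].
  - by rewrite mulr0 mul0r linear0.
  - by rewrite mulrBr mulrBl linearB /= hx hy subrr.
  - by rewrite mulrA hx.
  - by rewrite mulrA -(mulrA _ a u) hx.
move=> r hr.
suff hU (a a' : A^c%type) b b' :
    pair_lift (pair_elt a b * r * pair_elt a' b') = 0.
  move=> s; pose F0 (s : {malg K[(A^c * A)%type]}) : V := 0.
  have lF0 : linear F0 by move=> k x y; rewrite /F0 scaler0 addr0.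
  have hs (a' : A^c%type) b' : pair_lift (s * r * pair_elt a' b') = 0.
    move: s; apply: (@eq_malg_linear K (A^c * A)%type V
      (fun s => pair_lift ((s : P) * r * pair_elt a' b')) F0) => // [k x y|[a b]].
      by rewrite !mulrDl -!scalerAl linearP.
    exact: hU.
  apply: (@eq_malg_linear K (A^c * A)%type V
    (fun u => pair_lift (s * r * (u : P))) F0) => // [k x y|[a b]].
    by rewrite mulrDr -scalerAr linearP.
  exact: hs.
case: hr => [x x' y|x y y'|k x y|k x y];
  rewrite mulrBr mulrBl ?mulrDr ?mulrDl -?scalerAr -?scalerAl !pair_eltM
    linearB ?linearD ?linearZ /= !pair_liftU.
- have := linear_add (betar (b * y * b')) (a * x * a' : A^c%type) (a * x' * a' : A^c%type).
  by rewrite -opprD mulrDr mulrDl /= => ->; rewrite subrr.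
- have := linear_add (betal (a * x * a' : A^c%type)) (b * y * b') (b * y' * b').
  by rewrite -opprD mulrDr mulrDl /= => ->; rewrite subrr.
- have := linear_scale (betar (b * y * b')) k (a * x * a' : A^c%type).
  by rewrite -scalerAr -scalerAl scalerN /= => ->; rewrite subrr.
- have := linear_scale (betal (a * x * a' : A^c%type)) k (b * y * b').
  by rewrite -scalerAr -scalerAl scalerN /= => ->; rewrite subrr.
Qed.

Definition env_lift (t : env A) : V := pair_lift (quot_repr t).

Lemma env_lift_pi (t : P) : env_lift (quot_pi (@env_proper K A) t) = pair_lift t.
Proof.
apply/eqP; rewrite -subr_eq0 -linearB /=; apply/eqP.
have := pair_lift_ideal (quot_repr_pi (@env_proper K A) t) 1 1.
by rewrite mul1r mulr1.
Qed.

Lemma env_liftE (a b : A) : env_lift (tens a b) = beta b a.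
Proof. by rewrite env_lift_pi pair_liftU. Qed.

Lemma env_liftD s t : env_lift (s + t) = env_lift s + env_lift t.
Proof.
elim/quot_ind: s => s; elim/quot_ind: t => t.
by rewrite -quot_piD !env_lift_pi linearD.
Qed.

End EnvLift.

(* What is used of A^e and its module A; working with an abstract record keeps
   unification from unfolding the tensor product, at great cost.  Here [bt b a]
   is the tensor acting on bimodules by x |-> b x a. *)
Record envelope (K : fieldType) (A : algType K) := Envelope {
  eop :> algType K;
  bt : A -> A -> eop;
  btDl : forall b b' a, bt (b + b') a = bt b a + bt b' a;
  btDr : forall b a a', bt b (a + a') = bt b a + bt b a';
  btZl : forall k b a, bt (k *: b) a = k *: bt b a;
  btZr : forall k b a, bt b (k *: a) = k *: bt b a;
  bt11 : bt 1 1 = 1;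
  btM : forall b a b' a', bt b a * bt b' a' = bt (b * b') (a' * a);
  eop_ind : forall T : eop -> Prop, (forall x y, T x -> T y -> T (x + y)) ->
    (forall b a, T (bt b a)) -> forall t, T t;
  eop_lift : forall (V : lmodType K) (beta : A -> A -> V),
    (forall b, linear (beta b)) -> (forall a, linear (beta^~ a)) ->
    exists F : eop -> V, (forall s t, F (s + t) = F s + F t) /\
      (forall b a, F (bt b a) = beta b a);
  ereg : lmodType eop;
  toreg : A -> ereg;
  unreg : ereg -> A;
  toregK : cancel toreg unreg;
  unregK : cancel unreg toreg;
  toregD : forall x y, toreg (x + y) = toreg x + toreg y;
  bt_toreg : forall b a x, bt b a *: toreg x = toreg (b * x * a)
}.

Definition env_envelope (K : fieldType) (A : algType K) : envelope A.
Proof.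
refine (@Envelope K A (env A) (fun b a => tens a b) _ _ _ _ _ _ _ _
  (env_reg A) id id (fun=> erefl) (fun=> erefl) (fun _ _ => erefl) _).
- move=> b b' a; exact: (linear_add (tens_linearr a)).
- move=> b a a'; exact: (linear_add (tens_linearl b)).
- move=> k b a; exact: (linear_scale (tens_linearr a)).
- move=> k b a; exact: (linear_scale (tens_linearl b)).
- exact: tens11.
- by move=> b a b' a'; rewrite tensM.
- by move=> T TD Tt; apply: env_ind => // a b; apply: Tt.
- move=> V beta bl br; exists (env_lift beta); split; first exact: env_liftD.
  by move=> b a; apply: env_liftE.
- by move=> b a x; apply: tens_scaleE.
Defined.

Section Restriction.
Variables (K : fieldType) (R : algType K) (N : lmodType R).

(** Restriction of scalars along K -> R, for the K-linear targets that [path_act] and [eop_lift]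
    take. *)
Definition resK : Type := N.
HB.instance Definition _ := GRing.Zmodule.on resK.

Definition resK_scale (k : K) (x : resK) : resK := k%:A *: (x : N).

Lemma resK_scaleA k l x : resK_scale k (resK_scale l x) = resK_scale (k * l) x.
Proof. by rewrite /resK_scale scalerA -scalerAl mul1r scalerA. Qed.
Lemma resK_scale1 : left_id 1 resK_scale.
Proof. by move=> x; rewrite /resK_scale !scale1r. Qed.
Lemma resK_scaleDr : right_distributive resK_scale +%R.
Proof. by move=> k x y; rewrite /resK_scale scalerDr. Qed.
Lemma resK_scaleDl x : {morph resK_scale^~ x : a b / a + b}.
Proof. by move=> a b; rewrite /resK_scale !scalerDl. Qed.

HB.instance Definition _ := GRing.Zmodule_isLmodule.Build K resK
  resK_scaleA resK_scale1 resK_scaleDr resK_scaleDl.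

End Restriction.

(** * Induction on paths and modules over a path algebra *)

Section PathInduction.
Variables (K : fieldType) (Q : quiver).
Local Notation KQ := (path_alg K Q).

Lemma arrow_mul_path (a : qarr Q) (p : qpath Q) :
  qarrow K a * path_elt K p =
  if qtgt a == psrc p then
    path_elt K (odflt p (pcomp (arrow_path a) p)) else 0.
Proof.
rewrite path_eltM; have [ap|ap] := eqVneq.
  by have [r -> _] := @pcompE Q (arrow_path a) p ap.
by rewrite pcompN.
Qed.

(** A path is built by prepending arrows, which matches the way [path_act] and [der] are
    computed. *)
Lemma path_alg_ind (T : KQ -> Prop) :
  (forall x y, T x -> T y -> T (x + y)) -> (forall k x, T x -> T (k *: x)) ->
  (forall v, T (qidem K v)) -> (forall a x, T x -> T (qarrow K a * x)) ->
  forall x, T x.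
Proof.
move=> TD TZ Te Ta x; rewrite [x](@monalgE _ _ x).
have [v0 _] := card_gt0P (qvert_gt0 Q).
elim: (enum_fset _) => [|p s IH].
  by rewrite big_nil -(scale0r (qidem K v0)); apply: TZ.
rewrite big_cons; apply: TD => //; rewrite malg_scaleU; apply: TZ => {IH s x}.
case: p => -[v s] w; elim: s v w => [|a s IH] v w.
  by have := Te v; congr (T (bvec _)); apply: val_inj.
case/andP: (w) => /eqP av ws.
have [r er vr] := @pcompE Q (arrow_path a) (exist _ (qtgt a, s) ws) erefl.
have := Ta a _ (IH _ ws); rewrite [_ * _]path_eltM er.
by congr (T (bvec _)); apply: val_inj; rewrite vr; congr (_, _); apply: av.
Qed.

End PathInduction.

(** Paths compose from left to right, so under a left action the last arrow acts first; [E] at the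
    end vertex accounts for the trivial paths. *)
Definition path_act_basis (Q : quiver) (M : Type) (E : qvert Q -> M -> M)
  (X : qarr Q -> M -> M) (m : M) (p : qpath Q) : M :=
  foldr X (E (ptgt p) m) (parrs p).

HB.lock Definition path_act (K : fieldType) (Q : quiver) (M : lmodType K)
  (E : qvert Q -> M -> M) (X : qarr Q -> M -> M) (x : path_alg K Q) (m : M) : M :=
  lext (path_act_basis E X m) x.
Canonical path_act_unlockable := Unlockable path_act.unlock.

Section PathAction.
Variables (K : fieldType) (Q : quiver) (M : lmodType K).
Variables (E : qvert Q -> M -> M) (X : qarr Q -> M -> M).
Local Notation KQ := (path_alg K Q).
Hypothesis E_linear : forall v, linear (E v).
Hypothesis X_linear : forall a, linear (X a).
Hypothesis E_idem : forall v w m, E v (E w m) = if v == w then E v m else 0.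
Hypothesis X_src : forall a m, E (qsrc a) (X a m) = X a m.
Hypothesis X_tgt : forall a m, X a (E (qtgt a) m) = X a m.

Local Notation path_act := (path_act E X).
Local Notation path_act_basis := (path_act_basis E X).

Lemma path_act_linearl m : linear (path_act^~ m).
Proof. by move=> k x y; rewrite unlock linearP. Qed.

Lemma path_act0l m : path_act 0 m = 0.
Proof. exact: (linear_zero (path_act_linearl m)). Qed.
Lemma path_actDl x y m : path_act (x + y) m = path_act x m + path_act y m.
Proof. exact: (linear_add (path_act_linearl m)). Qed.
Lemma path_actZl k x m : path_act (k *: x) m = k *: path_act x m.
Proof. exact: (linear_scale (path_act_linearl m)). Qed.

Lemma path_actU p m : path_act (path_elt K p) m = path_act_basis m p.
Proof. rewrite unlock; exact: lextU. Qed.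

Lemma path_act_qidem v m : path_act (qidem K v) m = E v m.
Proof. exact: path_actU. Qed.

Lemma path_act_basis_src m p : E (psrc p) (path_act_basis m p) = path_act_basis m p.
Proof.
case: p => -[v [|a s]] w; rewrite /path_act_basis /ptgt /psrc /parrs /=.
  by rewrite E_idem eqxx.
by case/andP: (w) => /eqP av _; rewrite -[v]av; apply: X_src.
Qed.

Lemma path_act_arrow a x m : path_act (qarrow K a * x) m = X a (path_act x m).
Proof.
move: x; apply: (@eq_malg_linear K (qpath Q) M
  (fun x => path_act (qarrow K a * (x : KQ)) m) (fun x => X a (path_act x m))).
- by move=> k x y; rewrite mulrDr -scalerAr path_act_linearl.
- by move=> k x y; rewrite path_act_linearl X_linear.
move=> p; rewrite [path_act (bvec p) m]path_actU [_ * _]arrow_mul_path.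
have [ap|ap] := eqVneq.
  have [r er vr] := @pcompE Q (arrow_path a) p ap.
  have [_ _ rt rs] := pcompP er.
  by rewrite er path_actU /path_act_basis rt rs.
rewrite path_act0l -path_act_basis_src -X_tgt.
by rewrite E_idem (negPf ap) (linear_zero (X_linear a)).
Qed.

Lemma path_act_idem v x m : path_act (qidem K v * x) m = E v (path_act x m).
Proof.
move: x; apply: (@eq_malg_linear K (qpath Q) M
  (fun x => path_act (qidem K v * (x : KQ)) m) (fun x => E v (path_act x m))).
- by move=> k x y; rewrite mulrDr -scalerAr path_act_linearl.
- by move=> k x y; rewrite path_act_linearl E_linear.
move=> p; rewrite [path_act (bvec p) m]path_actU [_ * _]path_eltM pcomp_trivl.
rewrite -path_act_basis_src E_idem; case: eqP => [->|_].
  by rewrite path_actU path_act_basis_src.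
exact: path_act0l.
Qed.

Lemma path_actM x y m : path_act (x * y) m = path_act x (path_act y m).
Proof.
elim/path_alg_ind: x => [x x' hx hx'|k x hx|v|a x hx].
- by rewrite mulrDl !path_actDl hx hx'.
- by rewrite -scalerAl [LHS]path_actZl [RHS]path_actZl hx.
- by rewrite path_act_idem path_act_qidem.
- by rewrite -mulrA !path_act_arrow hx.
Qed.

Lemma path_act_linearr x : linear (path_act x).
Proof.
move=> k m n; elim/path_alg_ind: x => [x x' hx hx'|l x hx|v|a x hx].
- by rewrite !path_actDl hx hx' scalerDr addrACA.
- by rewrite !path_actZl hx scalerDr !scalerA mulrC.
- by rewrite !path_act_qidem E_linear.
- by rewrite !path_act_arrow hx X_linear.
Qed.

End PathAction.

(** * The bimodule resolution of a bound quiver algebra *)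

(* The start of the bimodule resolution of A = KQ/I, where I is generated by
   relations, each running from one vertex to another. *)
Section BimoduleResolution.
Variables (K : fieldType) (Q : quiver) (A : algType K) (Ae : envelope A) (J : finType).
Local Notation KQ := (path_alg K Q).
Variables (rel : J -> KQ) (rs rt : J -> qvert Q).
Variables (p : {lrmorphism KQ -> A}) (sec : A -> KQ).
Hypothesis rel_src : forall j, qidem K (rs j) * rel j = rel j.
Hypothesis rel_tgt : forall j, rel j * qidem K (rt j) = rel j.
Hypothesis sec_linear : linear sec.
Hypothesis secK : forall x, p (sec x) = x.
Hypothesis p_rel : forall j, p (rel j) = 0.
Hypothesis p_ker : forall x, p x = 0 -> ideal_gen (fun r => exists j, r = rel j) x.

Local Notation e v := (p (qidem K v)).
Local Notation ar a := (p (qarrow K a)).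
Local Notation bt := (@bt K A Ae).

Lemma pZ k f : p (k *: f) = k *: p f.
Proof. exact: linearZ. Qed.

Lemma pB f g : p (f - g) = p f - p g.
Proof. exact: rmorphB. Qed.
Lemma pM f g : p (f * g) = p f * p g.
Proof. exact: rmorphM. Qed.

Lemma qidemM v w : qidem K v * qidem K w = if v == w then qidem K v else 0 :> KQ.
Proof.
rewrite [LHS]path_eltM pcomp_trivl /psrc /=; case: eqP => [<-|] //.
Qed.

Lemma qidem_src a : qidem K (qsrc a) * qarrow K a = qarrow K a :> KQ.
Proof. by rewrite [LHS]path_eltM pcomp_trivl /psrc /= eqxx. Qed.

Lemma qidem_tgt a : qarrow K a * qidem K (qtgt a) = qarrow K a :> KQ.
Proof. by rewrite [LHS]path_eltM pcomp_trivr /ptgt /= eqxx. Qed.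

Lemma eM v w : e v * e w = if v == w then e v else 0.
Proof. by rewrite -rmorphM qidemM; case: eqP; rewrite ?rmorph0. Qed.

Lemma e_sum : \sum_v e v = 1.
Proof. by rewrite -rmorph_sum -(rmorph1 p). Qed.

Lemma e_src a : e (qsrc a) * ar a = ar a.
Proof. by rewrite -rmorphM qidem_src. Qed.

Lemma e_tgt a : ar a * e (qtgt a) = ar a.
Proof. by rewrite -rmorphM qidem_tgt. Qed.

Lemma bt0l (a : A) : bt 0 a = 0.
Proof. by rewrite -(scale0r 0) btZl scale0r. Qed.
Lemma bt0r (b : A) : bt b 0 = 0.
Proof. by rewrite -(scale0r 0) btZr scale0r. Qed.
Lemma btMl (b b' : A) : bt b 1 * bt b' 1 = bt (b * b') 1.
Proof. by rewrite btM mulr1. Qed.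
Lemma btMr (a a' : A) : bt 1 a * bt 1 a' = bt 1 (a' * a).
Proof. by rewrite btM mulr1. Qed.
Lemma btMlr (b a : A) : bt b 1 * bt 1 a = bt b a.
Proof. by rewrite btM !mulr1. Qed.
Lemma btMrl (b a : A) : bt 1 a * bt b 1 = bt b a.
Proof. by rewrite btM !mul1r. Qed.

Lemma bt_idem (b a : A) : b * b = b -> a * a = a -> bt b a * bt b a = bt b a.
Proof. by move=> bb aa; rewrite btM aa bb. Qed.

Lemma eidem v : e v * e v = e v.
Proof. by rewrite eM eqxx. Qed.

(** The left ideal generated by it is the bimodule A e_v (x) e_v A; for [eps1] and [eps2] the two
    ends of an arrow or of a relation take the place of v. *)
Definition eps0 (v : qvert Q) : Ae := bt (e v) (e v).
Definition eps1 (a : qarr Q) : Ae := bt (e (qsrc a)) (e (qtgt a)).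
Definition eps2 (j : J) : Ae := bt (e (rs j)) (e (rt j)).

Lemma eps0K v : eps0 v * eps0 v = eps0 v. Proof. exact: bt_idem (eidem _) (eidem _). Qed.
Lemma eps1K a : eps1 a * eps1 a = eps1 a. Proof. exact: bt_idem (eidem _) (eidem _). Qed.
Lemma eps2K j : eps2 j * eps2 j = eps2 j. Proof. exact: bt_idem (eidem _) (eidem _). Qed.

Definition B0 : lmodType Ae := idem_mod eps0.
Definition B1 : lmodType Ae := idem_mod eps1.
Definition B2 : lmodType Ae := idem_mod eps2.
Definition g0 v : B0 := igen eps0K v.
Definition g1 a : B1 := igen eps1K a.
Definition g2 j : B2 := igen eps2K j.

Lemma bt_fixr (N : lmodType Ae) (a b : A) (x : N) :
  a * a = a -> bt b a *: x = x -> bt 1 a *: x = x.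
Proof. by move=> aa abx; rewrite -abx scalerA btM aa mul1r. Qed.

Lemma bt_fixl (N : lmodType Ae) (a b : A) (x : N) :
  b * b = b -> bt b a *: x = x -> bt b 1 *: x = x.
Proof. by move=> bb abx; rewrite -abx scalerA btM bb mulr1. Qed.

Lemma g0r v : bt 1 (e v) *: g0 v = g0 v.
Proof. exact: bt_fixr (eidem v) (igenK eps0K v). Qed.
Lemma g0l v : bt (e v) 1 *: g0 v = g0 v.
Proof. exact: bt_fixl (eidem v) (igenK eps0K v). Qed.
Lemma g1r a : bt 1 (e (qtgt a)) *: g1 a = g1 a.
Proof. exact: bt_fixr (eidem _) (igenK eps1K a). Qed.
Lemma g1l a : bt (e (qsrc a)) 1 *: g1 a = g1 a.
Proof. exact: bt_fixl (eidem _) (igenK eps1K a). Qed.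

(** * The universal derivation *)

Section Derivation.

Local Notation M := (A * resK B1)%type.

Definition derE (v : qvert Q) (m : M) : M := (e v * m.1, bt (e v) 1 *: (m.2 : B1)).
(** With these operators f acts on A (+) B1 by a triangular matrix, with [p f] twice on the diagonal
    and the derivative of f in the corner; multiplicativity of the action is then the Leibniz rule
    [derM]. *)
Definition derX (a : qarr Q) (m : M) : M :=
  (ar a * m.1, bt 1 m.1 *: g1 a + bt (ar a) 1 *: (m.2 : B1)).

Lemma kA_comm (k : K) (t : Ae) (x : B1) : t *: (k%:A *: x) = k%:A *: (t *: x).
Proof. by rewrite !scalerA -scalerAr mulr1 -scalerAl mul1r. Qed.

Lemma btZl_scale (k : K) (b a : A) (x : B1) :
  bt (k *: b) a *: x = k%:A *: (bt b a *: x).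
Proof. by rewrite btZl scalerA -scalerAl mul1r. Qed.

Lemma derE_linear v : linear (derE v).
Proof.
move=> k [y m] [z n]; congr pair; rewrite /=; first by rewrite mulrDr scalerAr.
by rewrite scalerDr -[k *: m]/(k%:A *: (m : B1)) kA_comm.
Qed.

Lemma derX_linear a : linear (derX a).
Proof.
move=> k [y m] [z n]; congr pair; rewrite /=; first by rewrite mulrDr scalerAr.
have -> : bt 1 (k *: y + z) = k%:A * bt 1 y + bt 1 z :> Ae.
  by rewrite btDr btZr -scalerAl mul1r.
rewrite scalerDl scalerDr -scalerA -[k *: m]/(k%:A *: (m : B1)) kA_comm.
rewrite -[RHS]/(k%:A *: (bt 1 y *: g1 a + bt (ar a) 1 *: (m : B1)) + _).
by rewrite scalerDr addrACA.
Qed.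

Lemma derE_idem v w m : derE v (derE w m) = if v == w then derE v m else 0.
Proof.
rewrite /derE /= mulrA scalerA btMl eM; case: eqP => [->|] //.
by rewrite mul0r bt0l scale0r.
Qed.

Lemma derX_src a m : derE (qsrc a) (derX a m) = derX a m.
Proof.
rewrite /derE /derX /= mulrA e_src scalerDr !scalerA btMl e_src btMlr.
by rewrite -btMrl -scalerA g1l.
Qed.

Lemma derX_tgt a m : derX a (derE (qtgt a) m) = derX a m.
Proof.
rewrite /derE /derX /= mulrA e_tgt scalerA btMl e_tgt.
by rewrite -btMr -scalerA g1r.
Qed.

Local Notation act := (path_act derE derX).

(* The universal derivation, read off from the action of KQ on A (+) B1 that it
   defines. *)
Definition der (f : KQ) : B1 := (act f (1, 0)).2.

Lemma act_arrow a f m : act (qarrow K a * f) m = derX a (act f m).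
Proof.
exact: (path_act_arrow derX_linear derE_idem derX_src derX_tgt).
Qed.

Lemma act_fst f m : (act f m).1 = p f * m.1.
Proof.
elim/path_alg_ind: f => [f g hf hg|k f hf|v|a f hf].
- by rewrite path_actDl rmorphD mulrDl -hf -hg.
- by rewrite path_actZl pZ /= -scalerAl -hf.
- by rewrite path_act_qidem.
- by rewrite act_arrow rmorphM -mulrA -hf.
Qed.

Lemma derP f y n : act f (y, n) = (p f * y, bt 1 y *: der f + bt (p f) 1 *: (n : B1)).
Proof.
rewrite /der; elim/path_alg_ind: f => [f g hf hg|k f hf|v|a f hf].
- rewrite !path_actDl hf hg rmorphD; congr pair; first by rewrite /= mulrDl.
  by rewrite /= btDl scalerDr scalerDl [LHS]addrACA.
- rewrite !path_actZl hf pZ; congr pair; first by rewrite /= scalerAl.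
  rewrite /= btZl_scale -[k *: (act _ _).2]/(k%:A *: ((act f (1, 0)).2 : B1)).
  by rewrite kA_comm -scalerDr.
- by rewrite !path_act_qidem /derE /= !scaler0 add0r.
- rewrite !act_arrow hf /derX; congr pair; first by rewrite /= rmorphM mulrA.
  rewrite [in LHS]/= [in RHS]/= act_fst /= mulr1 rmorphM.
  by rewrite !scalerDr !scalerA !(btMl, btMr, btMlr, btMrl) addrA.
Qed.

Lemma der_arrow a f : der (qarrow K a * f) = bt 1 (p f) *: g1 a + bt (ar a) 1 *: der f.
Proof. by rewrite /der act_arrow [act f _]derP /= mulr1 scaler0 addr0 bt11 scale1r. Qed.

Lemma der_qidem v : der (qidem K v) = 0.
Proof. by rewrite /der path_act_qidem /= scaler0. Qed.

Lemma derD f g : der (f + g) = der f + der g.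
Proof. by rewrite /der path_actDl. Qed.

Lemma derZ k f : der (k *: f) = k%:A *: der f.
Proof. by rewrite /der path_actZl. Qed.

Lemma derB f g : der (f - g) = der f - der g.
Proof. by apply/eqP; rewrite eq_sym subr_eq -derD subrK. Qed.

Lemma derM f g : der (f * g) = bt 1 (p g) *: der f + bt (p f) 1 *: der g.
Proof.
rewrite /der (path_actM derE_linear derX_linear derE_idem derX_src derX_tgt).
by rewrite [act g _]derP derP /= mulr1 scaler0 addr0 bt11 scale1r.
Qed.

End Derivation.

(** [B0] is A (x)_E A, where E is spanned by the vertex idempotents, and this is its element 1 (x)
    1. Thus [bt b a *: gsum] is b (x) a, without reference to vertices. *)
Definition gsum : B0 := locked (\sum_v g0 v).

Lemma gsumE : gsum = \sum_v g0 v.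
Proof. by rewrite /gsum -lock. Qed.

Lemma g0_ortho v w : v != w -> bt (e v) 1 *: g0 w = 0 /\ bt 1 (e v) *: g0 w = 0.
Proof.
move=> vw; rewrite -(g0l w) scalerA btMl eM (negPf vw) bt0l scale0r.
by rewrite g0l -(g0r w) scalerA btMr eM eq_sym (negPf vw) bt0r scale0r.
Qed.

Lemma gsum_el v : bt (e v) 1 *: gsum = g0 v.
Proof.
rewrite gsumE scaler_sumr (bigD1 v) //= g0l big1 ?addr0 // => w wv.
by have [] := @g0_ortho v w; rewrite 1?eq_sym.
Qed.

Lemma gsum_er v : bt 1 (e v) *: gsum = g0 v.
Proof.
rewrite gsumE scaler_sumr (bigD1 v) //= g0r big1 ?addr0 // => w wv.
by have [] := @g0_ortho v w; rewrite 1?eq_sym.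
Qed.

Definition bdiff1 (a : qarr Q) : B0 := bt (ar a) 1 *: gsum - bt 1 (ar a) *: gsum.

Definition bd1 : {linear B1 -> B0} := ihom bdiff1.

Lemma bd1_gen a : bd1 (g1 a) = bt (ar a) 1 *: gsum - bt 1 (ar a) *: gsum.
Proof.
have -> : bd1 (g1 a) = eps1 a *: bdiff1 a := ihom_gen eps1K bdiff1 a.
have el : bt (ar a) (e (qtgt a)) *: gsum = bt (ar a) 1 *: gsum.
  by rewrite -btMlr -scalerA gsum_er -gsum_el scalerA btMl e_tgt.
have er : bt (e (qsrc a)) (ar a) *: gsum = bt 1 (ar a) *: gsum.
  by rewrite -btMrl -scalerA gsum_el -gsum_er scalerA btMr e_src.
by rewrite /bdiff1 scalerBr !scalerA !btM e_src e_tgt (mul1r (e _)) (mulr1 (e _)) el er.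
Qed.

(** Both sides are derivations of KQ in f, and they agree on vertices and arrows. *)
Lemma bd1_der f : bd1 (der f) = bt (p f) 1 *: gsum - bt 1 (p f) *: gsum.
Proof.
elim/path_alg_ind: f => [f g hf hg|k f hf|v|a f hf].
- rewrite derD linearD hf hg rmorphD btDl btDr !scalerDl opprD.
  exact: addrACA.
- rewrite derZ linearZ hf pZ /= btZl btZr scalerBr !scalerA.
  by rewrite -!scalerAl !mul1r.
- by rewrite der_qidem linear0 gsum_el gsum_er subrr.
rewrite der_arrow linearD !linearZ /= bd1_gen hf rmorphM !scalerBr !scalerA.
by rewrite btMl btMr btMlr btMrl addrC addrA subrK scalerN.
Qed.

Definition bd2 : {linear B2 -> B1} := ihom (fun j => der (rel j)).

Lemma bd2_gen j : bd2 (g2 j) = der (rel j).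
Proof.
have -> : bd2 (g2 j) = eps2 j *: der (rel j) := ihom_gen eps2K _ j.
rewrite /eps2 -btMlr -scalerA.
have -> : bt 1 (e (rt j)) *: der (rel j) = der (rel j).
  by rewrite -{2}rel_tgt derM der_qidem scaler0 addr0.
by rewrite -{2}rel_src derM der_qidem scaler0 add0r.
Qed.

Definition im2 (x : B1) : Prop := exists y, bd2 y = x.

Lemma im2D x y : im2 x -> im2 y -> im2 (x + y).
Proof. by move=> [u <-] [v <-]; exists (u + v); rewrite linearD. Qed.
Lemma im2Z r x : im2 x -> im2 (r *: x).
Proof. by move=> [u <-]; exists (r *: u); rewrite linearZ. Qed.
Lemma im2B x y : im2 x -> im2 y -> im2 (x - y).
Proof. by move=> [u <-] [v <-]; exists (u - v); rewrite linearB. Qed.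
Lemma im20 : im2 0.
Proof. by exists 0; rewrite linear0. Qed.

(** The f in the kernel of [p] with this property form a two-sided ideal, because the term of the
    Leibniz rule containing [p f] vanishes, and this ideal contains the relations. *)
Lemma im2_der f : p f = 0 -> im2 (der f).
Proof.
move=> /p_ker /(_ (fun f => p f = 0 /\ im2 (der f))) h.
apply: (proj2 (h _ _)) => [|_ [j ->]]; last by split=> //; exists (g2 j); rewrite bd2_gen.
have der0 : der 0 = 0 by have := derD 0 0; rewrite addr0 => /eqP; rewrite addrC -subr_eq subrr => /eqP.
split=> [|x y [x0 hx] [y0 hy]|a x [x0 hx]|x a [x0 hx]].
- by rewrite rmorph0 der0; split=> //; apply: im20.
- by rewrite pB x0 y0 subrr derB; split=> //; apply: im2B.
- by rewrite pM x0 mulr0 derM x0 bt0r scale0r add0r; split=> //; apply: im2Z.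
- by rewrite pM x0 mul0r derM x0 bt0l scale0r addr0; split=> //; apply: im2Z.
Qed.

Lemma bd1_bd2 x : bd1 (bd2 x) = 0.
Proof.
pose z : {linear B2 -> B0} := \0.
rewrite -[RHS]/(z x) -[LHS]/((bd1 \o bd2) x); move: x.
apply: (idem_mod_ext (eK := eps2K)) => j /=.
by rewrite -/(g2 j) bd2_gen bd1_der p_rel bt0l bt0r !scale0r subrr.
Qed.

Definition baug : {linear B0 -> ereg Ae} := ihom (fun=> toreg Ae 1).

Lemma toreg0 : toreg Ae 0 = 0.
Proof.
by have := toregD Ae 0 0; rewrite addr0 => /eqP; rewrite addrC -subr_eq subrr => /eqP.
Qed.

Lemma toreg_sum (I : Type) (s : seq I) (F : I -> A) :
  toreg Ae (\sum_(i <- s) F i) = \sum_(i <- s) toreg Ae (F i).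
Proof.
by elim: s => [|i s IH]; rewrite ?big_nil ?toreg0 // !big_cons toregD IH.
Qed.

Lemma baug_gen v : baug (g0 v) = toreg Ae (e v).
Proof. have -> : baug (g0 v) = eps0 v *: toreg Ae 1 := ihom_gen eps0K _ v.
by rewrite bt_toreg mulr1 eidem. Qed.

Lemma baug_gsum : baug gsum = toreg Ae 1.
Proof.
by rewrite gsumE linear_sum -e_sum toreg_sum; apply: eq_bigr => v _; rewrite baug_gen.
Qed.

Lemma baug_bd1 x : baug (bd1 x) = 0.
Proof.
pose z : {linear B1 -> ereg Ae} := \0.
rewrite -[RHS]/(z x) -[LHS]/((baug \o bd1) x); move: x.
apply: (idem_mod_ext (eK := eps1K)) => a /=.
rewrite -/(g1 a) bd1_gen linearB !linearZ /= baug_gsum scalerN !bt_toreg.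
by rewrite !mul1r !mulr1 subrr.
Qed.

Lemma B0_ind (T : B0 -> Prop) :
  (forall x y, T x -> T y -> T (x + y)) -> (forall b a, T (bt b a *: gsum)) ->
  forall x, T x.
Proof.
move=> TD Tg x; rewrite (idem_modE eps0K x).
have T0 : T 0 by have := Tg 0 0; rewrite bt0l scale0r.
elim/big_ind: _ => // v _; move: (icomp x v) => r {x}.
elim/eop_ind: r => [r s|b a]; first by rewrite scalerDl; apply: TD.
rewrite -/(g0 v) -gsum_el scalerA btM (mul1r a); exact: Tg.
Qed.

Lemma bimod_ind (I : finType) (eps : I -> Ae) (epsK : forall k, eps k * eps k = eps k)
    (T : idem_mod eps -> Prop) :
  (forall x y, T x -> T y -> T (x + y)) ->
  (forall b a k, T (bt b a *: igen epsK k)) -> T 0 -> forall x, T x.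
Proof.
move=> TD Tg T0 x; rewrite (idem_modE epsK x).
elim/big_ind: _ => // k _; move: (icomp x k) => r {x}.
elim/eop_ind: r => [r s|b a]; first by rewrite scalerDl; apply: TD.
exact: Tg.
Qed.

Lemma der_sec_mod f : im2 (der (sec (p f)) - der f).
Proof.
by rewrite -derB; apply: im2_der; rewrite pB secK subrr.
Qed.

(* A left inverse of [bd1] modulo the image of [bd2]: up to sign, b (x) a goes
   to b times the derivation of a. *)
Lemma contraction : exists s : B0 -> B1,
  [/\ forall x y, s (x + y) = s x + s y &
      forall b a, im2 (s (bt b a *: gsum) - bt b 1 *: der (sec a))].
Proof.
pose beta (b a : A) : resK B1 := bt b 1 *: der (sec a).
have betal b : linear (beta b).
  move=> k x y; rewrite /beta sec_linear derD derZ scalerDr kA_comm.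
  by [].
have betar a : linear (beta^~ a).
  by move=> k x y; rewrite /beta btDl scalerDl btZl_scale.
have [S [SD SE]] := @eop_lift _ _ Ae _ _ betal betar.
exists (fun x => \sum_v (S (icomp x v) : B1)); split=> [x y|b a].
  by rewrite -big_split; apply: eq_bigr => v _; rewrite icompD SD.
have -> : bt b 1 *: der (sec a) = \sum_v bt (b * e v) 1 *: der (sec a).
  rewrite -scaler_suml; congr (_ *: _).
  have {1}-> : b = \sum_v b * e v by rewrite -mulr_sumr e_sum mulr1.
  exact: (big_morph (fun x => bt x 1) (fun x y => @btDl _ _ Ae x y 1) (bt0l 1)).
rewrite -sumrB; elim/big_ind: _ => [|x y|v _]; [exact: im20|exact: im2D|].
have -> : icomp (bt b a *: gsum) v = bt (b * e v) (e v * a).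
  rewrite icompZ gsumE icomp_sum (bigD1 v) //= big1 => [|w wv].
    by rewrite addr0 icomp_gen eqxx btM.
  by rewrite icomp_gen eq_sym (negPf wv).
rewrite SE /beta.
(* [sec] is only linear, so [qidem K v * sec a] and [sec (e v * a)] agree modulo the kernel of [p],
   and their derivatives modulo [im2]. *)
have -> : bt (b * e v) 1 *: der (sec a) = bt (b * e v) 1 *: der (qidem K v * sec a).
  by rewrite derM der_qidem scaler0 add0r scalerA btMl -mulrA eidem.
rewrite -scalerBr; apply: im2Z.
by rewrite -{1}(secK a) -pM; apply: der_sec_mod.
Qed.

Lemma bexact1 x : bd1 x = 0 <-> exists y, bd2 y = x.
Proof.
split=> [|[y <-]]; last exact: bd1_bd2.
have [s [sD sE]] := contraction.
have s0 : s 0 = 0 by have := sD 0 0; rewrite addr0 => /eqP; rewrite addrC -subr_eq subrr => /eqP.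
(* For x = b g_c a, [s (bd1 x)] is b c D(sec a) - b D(sec (c a)) modulo [im2], and this is -x by the
   Leibniz rule for the product of c and sec a. *)
suff hx : im2 (s (bd1 x) + x).
  by move=> x0; move: hx; rewrite x0 s0 add0r.
elim/(@bimod_ind _ _ eps1K): x => [x y hx hy|b a c|].
- by rewrite linearD sD addrACA; apply: im2D.
- rewrite linearZ /= bd1_gen scalerBr !scalerA !btM mulr1 mul1r.
  set G1 := s _.
  have sN y : s (- y) = - s y.
    by apply/eqP; rewrite -addr_eq0 -sD addNr s0.
  rewrite /G1 sD sN.
  have h1 := sE (b * ar c) a; have h2 := sE b (ar c * a).
  have h3 := im2Z (bt b 1) (der_sec_mod (qarrow K c * sec a)).
  rewrite pM secK scalerBr der_arrow secK scalerDr !scalerA btMl btMlr in h3.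
  have := im2B h1 (im2D h2 h3).
  rewrite subrKA; congr im2.
  by rewrite opprB (addrC (bt b a *: _)) -!addrA addKr (addrC (- s _)).
- by rewrite linear0 s0 addr0; apply: im20.
Qed.

Lemma bexact0 x : baug x = 0 <-> exists y, bd1 y = x.
Proof.
split=> [|[y <-]]; last exact: baug_bd1.
have [s [sD sE]] := contraction.
(* For x = b (x) a, [s x] is b D(sec a) modulo the kernel of [bd1], and its boundary is ba (x) 1 - b
   (x) a. *)
suff hx : bd1 (s x) + x = bt (unreg (baug x)) 1 *: gsum.
  move=> x0; exists (- s x); rewrite linearN; apply/esym/eqP.
  rewrite -addr_eq0 addrC hx x0.
  suff -> : unreg (0 : ereg Ae) = 0 by rewrite bt0l scale0r.
  by rewrite -toreg0 toregK.
elim/B0_ind: x => [x y hx hy|b a].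
  rewrite sD !linearD /= addrACA hx hy -scalerDl -btDl; congr (bt _ _ *: _).
  by apply: (can_inj (@toregK _ _ Ae)); rewrite toregD !unregK.
have [y yE] := sE b a.
have -> : s (bt b a *: gsum) = bt b 1 *: der (sec a) + bd2 y.
  by rewrite yE addrC subrK.
rewrite linearD bd1_bd2 addr0 linearZ /= bd1_der secK scalerBr !scalerA btMl btMlr subrK.
by rewrite linearZ /= baug_gsum bt_toreg toregK mulr1.
Qed.

Lemma baug_surj m : exists x, baug x = m.
Proof.
exists (bt (unreg m) 1 *: gsum).
by rewrite linearZ /= baug_gsum bt_toreg !mulr1 unregK.
Qed.

Definition bimod_resolution : projective_resolution (ereg Ae) :=
  ext_resolution (idem_mod_projective eps0K) (idem_mod_projective eps1K)
    (idem_mod_projective eps2K) baug_surj bexact0 bexact1.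


(** * Cochains with values in the algebra *)

Local Notation reg := (ereg Ae).
Local Notation P := bimod_resolution.

Lemma unregD x y : unreg (x + y : reg) = unreg x + unreg y.
Proof. by apply: (can_inj (@toregK _ _ Ae)); rewrite toregD !unregK. Qed.
Lemma unreg0 : unreg (0 : reg) = 0.
Proof. by rewrite -toreg0 toregK. Qed.
Lemma unregN x : unreg (- x : reg) = - unreg x.
Proof. by apply/eqP; rewrite -addr_eq0 -unregD addNr unreg0. Qed.
Lemma unregB x y : unreg (x - y : reg) = unreg x - unreg y.
Proof. by rewrite unregD unregN. Qed.
Lemma unreg_inj : injective (@unreg _ _ Ae).
Proof. exact: (can_inj (@unregK _ _ Ae)). Qed.
Lemma unreg_bt b a x : unreg (bt b a *: x : reg) = b * unreg x * a.
Proof. by rewrite -{1}(unregK x) bt_toreg toregK. Qed.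
Lemma unreg_sum (I : Type) (s : seq I) (F : I -> reg) :
  unreg (\sum_(i <- s) F i) = \sum_(i <- s) unreg (F i).
Proof.
by elim: s => [|i s IH]; rewrite ?big_nil ?unreg0 // !big_cons unregD IH.
Qed.
Lemma unreg_scale (k : K) x : unreg (k%:A *: x : reg) = k *: unreg x.
Proof. by rewrite -bt11 -btZl unreg_bt mulr1 -scalerAl mul1r. Qed.

Definition hom1 (n : qarr Q -> A) : {linear B1 -> reg} := ihom (fun a => toreg Ae (n a)).
Definition hom2 (n : J -> A) : {linear B2 -> reg} := ihom (fun j => toreg Ae (n j)).

Definition parallel1 (n : qarr Q -> A) : Prop :=
  forall a, e (qsrc a) * n a * e (qtgt a) = n a.
Definition parallel2 (n : J -> A) : Prop :=
  forall j, e (rs j) * n j * e (rt j) = n j.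
(** These elements are the values at [gsum] of the bimodule maps from [B0]; see [hom0_gsum] and
    [hom_gsum_diagonal]. *)
Definition diagonal (z : A) : Prop := forall v, e v * z = z * e v.

(* The derivation of KQ into A with value n a at the arrow a. *)
Definition derivation (n : qarr Q -> A) (f : KQ) : A := unreg (hom1 n (der f)).

Definition values1 (f : {linear B1 -> reg}) (a : qarr Q) : A := unreg (f (g1 a)).
Definition values2 (f : {linear B2 -> reg}) (j : J) : A := unreg (f (g2 j)).

Lemma values1_parallel f : parallel1 (values1 f).
Proof. by move=> a; rewrite -unreg_bt -linearZ [_ *: _](igenK eps1K). Qed.
Lemma values2_parallel f : parallel2 (values2 f).
Proof. by move=> j; rewrite -unreg_bt -linearZ [_ *: _](igenK eps2K). Qed.

Lemma hom1_gen n a : parallel1 n -> unreg (hom1 n (g1 a)) = n a.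
Proof. move=> np.
have -> : hom1 n (g1 a) = eps1 a *: toreg Ae (n a) := ihom_gen eps1K _ a.
by rewrite unreg_bt toregK np. Qed.
Lemma hom2_gen n j : parallel2 n -> unreg (hom2 n (g2 j)) = n j.
Proof. move=> np.
have -> : hom2 n (g2 j) = eps2 j *: toreg Ae (n j) := ihom_gen eps2K _ j.
by rewrite unreg_bt toregK np. Qed.

Lemma hom1_values f : hom1 (values1 f) =1 f.
Proof.
apply: (idem_mod_ext (eK := eps1K)) => a; apply: unreg_inj.
by rewrite hom1_gen //; apply: values1_parallel.
Qed.
Lemma hom2_values f : hom2 (values2 f) =1 f.
Proof.
apply: (idem_mod_ext (eK := eps2K)) => a; apply: unreg_inj.
by rewrite hom2_gen //; apply: values2_parallel.
Qed.

Lemma derivation_arrow n a f : parallel1 n ->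
  derivation n (qarrow K a * f) = n a * p f + ar a * derivation n f.
Proof.
move=> np; rewrite /derivation der_arrow linearD !linearZ /= unregD !unreg_bt.
by rewrite hom1_gen // mul1r mulr1.
Qed.
Lemma derivationD n f g : derivation n (f + g) = derivation n f + derivation n g.
Proof. by rewrite /derivation derD linearD unregD. Qed.
Lemma derivation_qidem n v : derivation n (qidem K v) = 0.
Proof. by rewrite /derivation der_qidem linear0 unreg0. Qed.
Lemma derivation1 n a : parallel1 n -> derivation n (qarrow K a) = n a.
Proof.
move=> np; rewrite -[qarrow K a]qidem_tgt derivation_arrow // derivation_qidem mulr0 addr0.
by rewrite -np -mulrA eidem.
Qed.

Definition hom0 (z : A) : {linear B0 -> reg} := ihom (fun v => toreg Ae (e v * z)).

Lemma hom0_gsum z : diagonal z -> unreg (hom0 z gsum) = z.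
Proof.
move=> zd; rewrite gsumE linear_sum unreg_sum -[RHS]mul1r -e_sum mulr_suml.
apply: eq_bigr => v _.
have -> : hom0 z (g0 v) = eps0 v *: toreg Ae (e v * z) := ihom_gen eps0K _ v.
rewrite unreg_bt toregK.
by rewrite mulrA eidem -mulrA -zd mulrA eidem.
Qed.

Lemma hom_gsum_diagonal (f : {linear B0 -> reg}) : diagonal (unreg (f gsum)).
Proof.
move=> v; have := congr1 f (etrans (gsum_el v) (esym (gsum_er v))).
by rewrite !linearZ /= => /(congr1 (@unreg _ _ Ae)); rewrite !unreg_bt mulr1 mul1r.
Qed.

Lemma hom0_ext (f g : {linear B0 -> reg}) : unreg (f gsum) = unreg (g gsum) -> f =1 g.
Proof.
move=> /unreg_inj fg; apply: (idem_mod_ext (eK := eps0K)) => v.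
by rewrite -/(g0 v) -gsum_el !linearZ /= fg.
Qed.

Lemma hom1_ext (f g : {linear B1 -> reg}) : values1 f =1 values1 g -> f =1 g.
Proof.
by move=> fg; apply: (idem_mod_ext (eK := eps1K)) => a; apply/unreg_inj/fg.
Qed.

Lemma hom2_ext (f g : {linear B2 -> reg}) : values2 f =1 values2 g -> f =1 g.
Proof.
by move=> fg; apply: (idem_mod_ext (eK := eps2K)) => a; apply/unreg_inj/fg.
Qed.

Lemma hom_bd1 (f : {linear B0 -> reg}) a :
  unreg (f (bd1 (g1 a))) = ar a * unreg (f gsum) - unreg (f gsum) * ar a.
Proof. by rewrite bd1_gen linearB !linearZ /= scalerN unregB !unreg_bt mulr1 mul1r. Qed.

Section Combination.
Variables (B : lmodType Ae) (d : nat) (c : 'I_d -> K) (b : 'I_d -> {linear B -> reg}).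

Definition combination (x : B) : reg := \sum_i (c i)%:A *: b i x.

Lemma combination_linear : linear combination.
Proof.
move=> r y y'; rewrite scaler_sumr -big_split; apply: eq_bigr => i _ /=.
rewrite linearP scalerDr !scalerA -scalerAl mul1r -scalerAr mulr1.
by [].
Qed.

HB.instance Definition _ := GRing.isLinear.Build Ae B reg _ combination
  combination_linear.

Lemma unreg_combination x :
  unreg (combination x) = \sum_i c i *: unreg (b i x).
Proof. by rewrite unreg_sum; apply: eq_bigr => i _; rewrite unreg_scale. Qed.

End Combination.

Lemma HH0_criterion d (z : 'I_d -> A) :
  (forall i, diagonal (z i)) -> (forall i a, ar a * z i = z i * ar a) ->
  (forall x, diagonal x -> (forall a, ar a * x = x * ar a) ->
     exists c : 'I_d -> K, x = \sum_i c i *: z i) ->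
  (forall c : 'I_d -> K, \sum_i c i *: z i = 0 -> c =1 (fun=> 0)) ->
  Ext_dim 0 reg reg d.
Proof.
move=> zd zc span indep; apply: (Ext_dim_resolution (Q := P)).
have cocE (f : {linear B0 -> reg}) :
    (forall x, f (bd1 x) = 0) <-> forall a, ar a * unreg (f gsum) = unreg (f gsum) * ar a.
  split=> [f0 a|fc].
    by apply/eqP; rewrite -subr_eq0 -hom_bd1 f0 unreg0.
  apply: (@hom1_ext (f \o bd1) \0) => a.
  by rewrite /values1 /= hom_bd1 fc subrr unreg0.
apply: (@cohomology_dimI _ _ _ reg P 0 d (fun i => hom0 (z i))) => [i|f cf|c c0].
- by apply/cocE => a; rewrite hom0_gsum.
- have [c cE] := span _ (hom_gsum_diagonal f) ((cocE f).1 cf); exists c => x /=.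
  apply/eqP; rewrite subr_eq0; apply/eqP; move: x.
  apply: (@hom0_ext f (combination c (fun i => hom0 (z i)))).
  rewrite unreg_combination cE; apply: eq_bigr => i _.
  by rewrite hom0_gsum.
- apply: indep; have := congr1 (@unreg _ _ Ae) (c0 gsum).
  rewrite -/(combination c (fun i => hom0 (z i)) gsum) unreg_combination unreg0.
  by move=> cE; rewrite -[RHS]cE; apply: eq_bigr => i _; rewrite hom0_gsum.
Qed.

Lemma HH1_criterion d (b : 'I_d -> qarr Q -> A) :
  (forall i, parallel1 (b i)) -> (forall i j, derivation (b i) (rel j) = 0) ->
  (forall n, parallel1 n -> (forall j, derivation n (rel j) = 0) ->
     exists c : 'I_d -> K, exists2 z, diagonal z &
       forall a, n a - \sum_i c i *: b i a = ar a * z - z * ar a) ->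
  (forall (c : 'I_d -> K) z, diagonal z ->
     (forall a, \sum_i c i *: b i a = ar a * z - z * ar a) -> c =1 (fun=> 0)) ->
  Ext_dim 1 reg reg d.
Proof.
move=> bp bc span indep; apply: (Ext_dim_resolution (Q := P)).
have cocE (f : {linear B1 -> reg}) :
    (forall x, f (bd2 x) = 0) <-> forall j, derivation (values1 f) (rel j) = 0.
  split=> [f0 j|fc]; first by rewrite /derivation hom1_values -bd2_gen f0 unreg0.
  apply: (@hom2_ext (f \o bd2) \0) => j.
  rewrite /values2 /= bd2_gen unreg0 -[RHS](fc j).
  by rewrite /derivation hom1_values.
have cobE (f : {linear B1 -> reg}) :
    (exists g : {linear B0 -> reg}, forall x, f x = g (bd1 x)) <->
    exists2 z, diagonal z & forall a, values1 f a = ar a * z - z * ar a.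
  split=> [[g gE]|[z zd zE]].
    exists (unreg (g gsum)) => [|a]; first exact: hom_gsum_diagonal.
    by rewrite /values1 gE hom_bd1.
  exists (hom0 z); apply: (@hom1_ext f (hom0 z \o bd1)) => a.
  by rewrite zE /values1 /= hom_bd1 hom0_gsum.
have vb i : values1 (hom1 (b i)) =1 b i by move=> a; rewrite /values1 hom1_gen.
apply: (@cohomology_dimI _ _ _ reg P 1 d (fun i => hom1 (b i))) => [i|f cf|c c0].
- apply/cocE => j; rewrite -[RHS](bc i j) /derivation.
  by rewrite hom1_values.
- have [c [z zd zE]] := span _ (values1_parallel f) ((cocE f).1 cf); exists c.
  apply/(cobE (f \- combination c (fun i => hom1 (b i)))).
  exists z => // a; rewrite -zE /values1 /= unregB unreg_combination; congr (_ - _).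
  by apply: eq_bigr => i _; rewrite -[in RHS]vb.
- have /(cobE (combination c (fun i => hom1 (b i))))[z zd zE] := c0.
  apply: (indep c z zd) => a; rewrite -zE /values1 unreg_combination.
  by apply: eq_bigr => i _; rewrite -[in LHS]vb.
Qed.

(** Phrased through the kernel of [bd2], because the next term of the resolution is merely a free
    cover of that kernel. *)
Definition cocycle2 (n : J -> A) : Prop := forall x, bd2 x = 0 -> hom2 n x = 0.

Lemma HH2_criterion d (b : 'I_d -> J -> A) :
  (forall i, parallel2 (b i)) -> (forall i, cocycle2 (b i)) ->
  (forall n, parallel2 n -> cocycle2 n ->
     exists c : 'I_d -> K, exists2 m, parallel1 m &
       forall j, n j - \sum_i c i *: b i j = derivation m (rel j)) ->
  (forall (c : 'I_d -> K) m, parallel1 m ->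
     (forall j, \sum_i c i *: b i j = derivation m (rel j)) -> c =1 (fun=> 0)) ->
  Ext_dim 2 reg reg d.
Proof.
move=> bp bc span indep; apply: (Ext_dim_resolution (Q := P)).
have cocE (f : {linear B2 -> reg}) :
    @cocycle _ _ _ reg P 2 f <-> cocycle2 (values2 f).
  split=> [fc x /(ext_exactS bexact1 (n := 1))[y <-]|fc x].
    by rewrite hom2_values; apply: (fc y).
  have := fc (res_diff P 2 x); rewrite hom2_values; apply.
  by apply: (ext_exactS bexact1 (n := 1) _).2; exists x.
have cobE (f : {linear B2 -> reg}) :
    (exists g : {linear B1 -> reg}, forall x, f x = g (bd2 x)) <->
    exists2 m, parallel1 m & forall j, values2 f j = derivation m (rel j).
  split=> [[g gE]|[m mp mE]].
    exists (values1 g) => [|j]; first exact: values1_parallel.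
    by rewrite /values2 gE bd2_gen /derivation hom1_values.
  exists (hom1 m); apply: (@hom2_ext f (hom1 m \o bd2)) => j.
  by rewrite mE /values2 /= bd2_gen.
have vb i : values2 (hom2 (b i)) =1 b i by move=> a; rewrite /values2 hom2_gen.
apply: (@cohomology_dimI _ _ _ reg P 2 d (fun i => hom2 (b i))) => [i|f cf|c c0].
- by apply/cocE => x /bc; rewrite hom2_values.
- have [c [m mp mE]] := span _ (values2_parallel f) ((cocE f).1 cf); exists c.
  apply/(cobE (f \- combination c (fun i => hom2 (b i)))).
  exists m => // j; rewrite -mE /values2 /= unregB unreg_combination; congr (_ - _).
  by apply: eq_bigr => i _; rewrite -[in RHS]vb.
- have /(cobE (combination c (fun i => hom2 (b i))))[m mp mE] := c0.
  apply: (indep c m mp) => j; rewrite -mE /values2 unreg_combination.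
  by apply: eq_bigr => i _; rewrite -[in LHS]vb.
Qed.

(* The map B2 -> A with values n on the generators kills ker(bd2) as soon as it
   factors through bd2 by a map that is merely left A-linear. *)
Lemma cocycle2_left (n : J -> A) (G : qarr Q -> A -> A) :
  parallel2 n -> (forall a, linear (G a)) ->
  (forall L : B1 -> A, (forall x y, L (x + y) = L x + L y) ->
     (forall b a y, L (bt b y *: g1 a) = b * e (qsrc a) * G a (e (qtgt a) * y)) ->
     forall j y, L (bt 1 y *: der (rel j)) = n j * y) ->
  cocycle2 n.
Proof.
move=> np Gl h.
have betal (a : qarr Q) b : linear (fun y : A => b * G a y).
  by move=> k y z; rewrite Gl mulrDr scalerAr.
have betar (a : qarr Q) (y : A) : linear (fun b : A => b * G a y).
  by move=> k b c; rewrite mulrDl scalerAl.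
have /choice[S SE] a := @eop_lift _ _ Ae _ _ (betal a) (betar a).
pose L (x : B1) := \sum_a S a (icomp x a).
have S0 a : S a 0 = 0.
  by have [_ SB] := SE a; rewrite -(bt0l 0) SB mul0r.
have LD x y : L (x + y) = L x + L y.
  rewrite /L -big_split; apply: eq_bigr => a _; rewrite icompD.
  by have [-> _] := SE a.
have LE b a y : L (bt b y *: g1 a) = b * e (qsrc a) * G a (e (qtgt a) * y).
  rewrite /L (bigD1 a) //= big1 => [|c ca].
    by rewrite icompZ icomp_gen eqxx btM addr0; have [_ ->] := SE a.
  by rewrite icompZ icomp_gen (negPf ca) mulr0 S0.
have L0 : L 0 = 0 by rewrite /L big1 // => a _; rewrite icomp0 S0.
have Ll b x : L (bt b 1 *: x) = b * L x.
  elim/(@bimod_ind _ _ eps1K): x => [x y hx hy|c y a|].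
  - by rewrite scalerDr !LD hx hy mulrDr.
  - by rewrite scalerA btM mulr1 !LE !mulrA.
  - by rewrite scaler0 L0 mulr0.
have {}h := h L LD LE.
suff hL x : unreg (hom2 n x) = L (bd2 x).
  by move=> x x0; apply: unreg_inj; rewrite hL x0 L0 unreg0.
elim/(@bimod_ind _ _ eps2K): x => [x y hx hy|b y j|].
- by rewrite (linearD (hom2 n)) (linearD bd2) unregD LD hx hy.
- rewrite (linearZZ (hom2 n)) (linearZZ bd2) /= -/(g2 j) bd2_gen unreg_bt hom2_gen //.
  by rewrite -btMlr -scalerA Ll h mulrA.
- by rewrite (linear0 (hom2 n)) (linear0 bd2) unreg0 L0.
Qed.

(** This turns an explicit syzygy, listed as tensors at generators, into an equation on the values
    of a cocycle. *)
Lemma cocycle2_zero (n : J -> A) (I : Type) (s : seq I) (b a : I -> A) (j : I -> J) :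
  parallel2 n -> cocycle2 n ->
  \sum_(i <- s) bt (b i) (a i) *: der (rel (j i)) = 0 ->
  \sum_(i <- s) b i * n (j i) * a i = 0.
Proof.
move=> np nc h; have := nc (\sum_(i <- s) bt (b i) (a i) *: g2 (j i)).
rewrite !linear_sum /=.
have -> : \sum_(i <- s) bd2 (bt (b i) (a i) *: g2 (j i)) =
          \sum_(i <- s) bt (b i) (a i) *: der (rel (j i)).
  by apply: eq_bigr => i _; rewrite linearZ /= bd2_gen.
move=> /(_ h) /(congr1 (@unreg _ _ Ae)); rewrite unreg0 unreg_sum => nE.
by rewrite -[RHS]nE; apply: eq_bigr => i _; rewrite linearZ /= unreg_bt hom2_gen.
Qed.

End BimoduleResolution.

(** * A basis of the algebra *)

Inductive leaf := l1 | l2 | l3.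

(** Rotation of the leaves is an automorphism of the bound quiver, so identities stated in i, [nx i]
    and [nx2 i] cover all leaves at once. *)
Definition nx (i : leaf) : leaf := match i with l1 => l2 | l2 => l3 | l3 => l1 end.
Notation nx2 i := (nx (nx i)).

Definition leaf_vertex (i : leaf) : vertex :=
  match i with l1 => v1 | l2 => v2 | l3 => v3 end.
Definition arrow_in (i : leaf) : arrow :=
  match i with l1 => alpha | l2 => xi | l3 => gamma end.
Definition arrow_out (i : leaf) : arrow :=
  match i with l1 => beta | l2 => epsilon | l3 => delta end.

Lemma nx3 i : nx (nx2 i) = i. Proof. by case: i. Qed.

Lemma vertexP (T : vertex -> Prop) : (forall i, T (leaf_vertex i)) -> T v4 -> forall v, T v.
Proof. by move=> Ti T4; case; [apply: (Ti l1)|apply: (Ti l2)|apply: (Ti l3)|]. Qed.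

Lemma arrowP (T : arrow -> Prop) :
  (forall i, T (arrow_in i)) -> (forall i, T (arrow_out i)) -> forall a, T a.
Proof.
move=> Ti To; case; [exact: (Ti l1)|exact: (To l1)|exact: (Ti l2)|
  exact: (To l2)|exact: (Ti l3)|exact: (To l3)].
Qed.

(* Names for a basis of the algebra: with a_i, b_i the arrows into and out of
   the vertex 4 and c_i = b_i a_i, these stand for e_4, c_1, c_2, c_1 c_2, e_i, a_i,
   b_i, a_i b_(i+1), a_i b_(i+2), a_i c_(i+1), c_(i+1) b_i, a_i c_(i+1) b_i. *)
Inductive basis := E4 | C1 | C2 | S4 | Ei of leaf | Ai of leaf | Bi of leaf
  | W1 of leaf | W2 of leaf | Ti of leaf | Ui of leaf | Si of leaf.

Definition leaf_code (i : leaf) : nat := match i with l1 => 0 | l2 => 1 | l3 => 2 end.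
Definition leaf_decode (n : nat) : leaf := nth l1 [:: l1; l2; l3] n.
Lemma leaf_codeK : cancel leaf_code leaf_decode. Proof. by case. Qed.
HB.instance Definition _ := Countable.copy leaf (can_type leaf_codeK).

Lemma leaf_eqE i : ((i == nx i) = false) * ((nx i == i) = false) *
  ((i == nx2 i) = false) * ((nx2 i == i) = false) *
  ((nx i == nx2 i) = false) * ((nx2 i == nx i) = false).
Proof. by case: i. Qed.

Definition basis_code (x : basis) : nat * nat :=
  match x with
  | E4 => (0, 0) | C1 => (0, 1) | C2 => (0, 2) | S4 => (0, 3)
  | Ei i => (1, leaf_code i) | Ai i => (2, leaf_code i) | Bi i => (3, leaf_code i)
  | W1 i => (4, leaf_code i) | W2 i => (5, leaf_code i) | Ti i => (6, leaf_code i)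
  | Ui i => (7, leaf_code i) | Si i => (8, leaf_code i)
  end%N.
Definition basis_decode (n : nat * nat) : basis :=
  nth (fun=> E4) [:: fun=> nth E4 [:: E4; C1; C2; S4] n.2; Ei; Ai; Bi; W1; W2; Ti; Ui; Si]
    n.1 (leaf_decode n.2).
Lemma basis_codeK : cancel basis_code basis_decode.
Proof. by case=> // -[]. Qed.
HB.instance Definition _ := Countable.copy basis (can_type basis_codeK).

Definition bsrc (x : basis) : vertex :=
  match x with
  | E4 | C1 | C2 | S4 | Bi _ | Ui _ => v4
  | Ei i | Ai i | W1 i | W2 i | Ti i | Si i => leaf_vertex i
  end.
Definition btgt (x : basis) : vertex :=
  match x with
  | E4 | C1 | C2 | S4 | Ai _ | Ti _ => v4
  | Ei i | Bi i | Ui i | Si i => leaf_vertex i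
  | W1 i => leaf_vertex (nx i)
  | W2 i => leaf_vertex (nx2 i)
  end.

(** * The regular representation in coordinates *)

Section Regular.
Variable K : fieldType.
Local Notation V := {malg K[basis]}.
Local Notation "[ x ]" := (bvec x : V) (at level 0, x at level 99).

Definition delta_leaf (i j : leaf) (x : V) : V := if i == j then x else 0.

(** The products a_i x that the relations force. Since c_1 + c_2 + c_3 = 0 and a_i c_i = 0, the
    products a_i c_(i+1) and a_i c_(i+2) are opposite, which explains the signs. *)
Definition left_in (i : leaf) (x : basis) : V :=
  match x with
  | E4 => [Ai i]
  | C1 => match i with l1 => 0 | l2 => - [Ti l2] | l3 => [Ti l3] end
  | C2 => match i with l1 => [Ti l1] | l2 => 0 | l3 => - [Ti l3] end
  | Bi j => delta_leaf (nx i) j [W1 i] + delta_leaf (nx2 i) j [W2 i]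
  | Ui j => delta_leaf i j [Si i]
  | _ => 0
  end.

Definition leaf_loop (i : leaf) : V :=
  match i with l1 => [C1] | l2 => [C2] | l3 => - [C1] - [C2] end.

Definition left_out (i : leaf) (x : basis) : V :=
  match x with
  | Ei j => delta_leaf i j [Bi i]
  | Ai j => delta_leaf i j (leaf_loop i)
  | W1 j => delta_leaf i j (- [Ui (nx i)])
  | W2 j => delta_leaf i j [Ui (nx2 i)]
  | Ti j => delta_leaf i j [S4]
  | _ => 0
  end.

Definition left_arrow (x : arrow) : basis -> V :=
  match x with
  | alpha => left_in l1 | xi => left_in l2 | gamma => left_in l3
  | beta => left_out l1 | epsilon => left_out l2 | delta => left_out l3
  end.

Definition regE (v : vertex) : V -> V := lext (fun x => if v == bsrc x then [x] else 0).
Definition regX (x : arrow) : V -> V := lext (left_arrow x).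

Lemma regE_linear v : linear (regE v). Proof. exact: lext_is_linear. Qed.
Lemma regX_linear x : linear (regX x). Proof. exact: lext_is_linear. Qed.

Lemma regEU v x : regE v [x] = if v == bsrc x then [x] else 0.
Proof. exact: lextU. Qed.
Lemma regXU x y : regX x [y] = left_arrow x y.
Proof. exact: lextU. Qed.

Lemma malg_ext (f g : V -> V) : linear f -> linear g ->
  (forall x, f [x] = g [x]) -> f =1 g.
Proof. exact: eq_malg_linear. Qed.

Lemma regE0 v : regE v 0 = 0. Proof. exact: linear0. Qed.
Lemma regEN v x : regE v (- x) = - regE v x. Proof. exact: linearN. Qed.
Lemma regED v x y : regE v (x + y) = regE v x + regE v y. Proof. exact: linearD. Qed.
Lemma regX0 v : regX v 0 = 0. Proof. exact: linear0. Qed.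
Lemma regXN v x : regX v (- x) = - regX v x. Proof. exact: linearN. Qed.
Lemma regXD v x y : regX v (x + y) = regX v x + regX v y. Proof. exact: linearD. Qed.

Lemma comp_linear (f g : V -> V) : linear f -> linear g -> linear (f \o g).
Proof. by move=> lf lg k x y; rewrite /= lg lf. Qed.

Lemma add_linear (f g : V -> V) : linear f -> linear g -> linear (fun x => f x + g x).
Proof. by move=> lf lg k x y; rewrite lg lf scalerDr addrACA. Qed.

Lemma regE_idem v w x : regE v (regE w x) = if v == w then regE v x else 0.
Proof.
move: x; apply: malg_ext => [||x].
- exact: (comp_linear (regE_linear v) (regE_linear w)).
- by case: eqP => _; [exact: regE_linear|move=> k y z; rewrite scaler0 addr0].
rewrite !regEU; have [->|wx] := eqVneq w (bsrc x); first by rewrite regEU; case: eqP.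
by rewrite regE0; case: eqP => [->|//]; rewrite (negPf wx).
Qed.

Lemma regX_src y x : regE (arrow_src y) (regX y x) = regX y x.
Proof.
move: x; apply: malg_ext => [||x].
- exact: (comp_linear (regE_linear _) (regX_linear y)).
- exact: regX_linear.
rewrite regXU; case: y; case: x => [| | | |[]|[]|[]|[]|[]|[]|[]|[]] //=;
  by rewrite ?(regE0, regEN, regED, regEU) //= ?eqxx ?addr0.
Qed.

Lemma regX_tgt y x : regX y (regE (arrow_tgt y) x) = regX y x.
Proof.
move: x; apply: malg_ext => [||x].
- exact: (comp_linear (regX_linear y) (regE_linear _)).
- exact: regX_linear.
rewrite regEU regXU; case: eqP => [_|]; first by rewrite regXU.
rewrite regX0.
by case: y; case: x => [| | | |[]|[]|[]|[]|[]|[]|[]|[]].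
Qed.

(** Together with [regX_out_in]: the relations act by zero, so the tables define a module over the
    algebra, in which the names of the basis are independent by construction. *)
Lemma regX_in_out i x : regX (arrow_in i) (regX (arrow_out i) x) = 0.
Proof.
move: x; apply: malg_ext => [||x]; first exact: (comp_linear (regX_linear _) (regX_linear _)).
  by move=> k x y; rewrite scaler0 addr0.
rewrite regXU; case: i; case: x => [| | | |[]|[]|[]|[]|[]|[]|[]|[]] //=;
  by rewrite ?(regX0, regXN, regXD, regXU) //= ?(oppr0, addr0, subrr, addNr).
Qed.

Lemma regX_out_in x : \sum_(i <- [:: l1; l2; l3]) regX (arrow_out i) (regX (arrow_in i) x) = 0.
Proof.
rewrite !big_cons big_nil addr0 addrA; move: x; apply: malg_ext => [||x].
- have L i := comp_linear (regX_linear (arrow_out i)) (regX_linear (arrow_in i)).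
  exact: (add_linear (add_linear (L l1) (L l2)) (L l3)).
- by move=> k x y; rewrite scaler0 addr0.
rewrite !regXU; case: x => [| | | |[]|[]|[]|[]|[]|[]|[]|[]] //=;
  rewrite ?(regX0, regXN, regXD, regXU) //= ?(oppr0, addr0, add0r, subrr, addNr, opprK) //.
by rewrite /delta_leaf /= -opprD subrr.
Qed.

Definition reg1 : V := [Ei l1] + [Ei l2] + [Ei l3] + [E4].

End Regular.

Lemma leaf_vertexE : (forall i j, (leaf_vertex i == leaf_vertex j) = (i == j)) *
  (forall i, (leaf_vertex i == v4) = false) * (forall i, (v4 == leaf_vertex i) = false).
Proof.
do !split; try by move=> i; apply/negbTE/eqP; case: i.
have inj : injective leaf_vertex by case=> -[].
by move=> i j; apply: inj_eq.
Qed.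

(** * Multiplication in the algebra *)

Section Products.
Variables (K : fieldType) (A : algType K).
Local Notation KQ := (path_alg K quiver9).
Variable p : {lrmorphism KQ -> A}.
Hypothesis p_rel : forall r, relation9' r -> p r = 0.

Definition idv (v : vertex) : A := p (@qidem K quiver9 v).
Definition arr (a : arrow) : A := p (@qarrow K quiver9 a).

Local Notation e4 := (idv v4).
Local Notation e i := (idv (leaf_vertex i)).
Local Notation a i := (arr (arrow_in i)).
Local Notation b i := (arr (arrow_out i)).

(* Locked, so that unification does not see products in them. *)
Definition cyc (i : leaf) : A := locked (b i * a i).
Local Notation c := cyc.
Lemma cycE i : c i = b i * a i. Proof. by rewrite /cyc -lock. Qed.

Lemma idvM v w : idv v * idv w = if v == w then idv v else 0.
Proof. exact: eM. Qed.

Lemma src_arr x : idv (arrow_src x) * arr x = arr x.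
Proof. exact: (e_src p x). Qed.

Lemma arr_tgt x : arr x * idv (arrow_tgt x) = arr x.
Proof. exact: (e_tgt p x). Qed.

Lemma idv_sum : e l1 + e l2 + e l3 + e4 = 1.
Proof.
rewrite -(e_sum p) (bigD1 v1) // (bigD1 v2) /= ?(introN eqP) //.
rewrite (bigD1 v3) /= ?(introN eqP) // (bigD1 v4) /= ?(introN eqP) //.
rewrite big1 ?addr0 ?addrA //.
by case; rewrite /= ?eqxx ?andbF.
Qed.

Lemma idv_leaf i : e i * e i = e i. Proof. by rewrite idvM eqxx. Qed.
Lemma ea i : e i * a i = a i. Proof. by have := src_arr (arrow_in i); case: i. Qed.
Lemma ae i : a i * e4 = a i. Proof. by have := arr_tgt (arrow_in i); case: i. Qed.
Lemma eb i : e4 * b i = b i. Proof. by have := src_arr (arrow_out i); case: i. Qed.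
Lemma be i : b i * e i = b i. Proof. by have := arr_tgt (arrow_out i); case: i. Qed.

Lemma ab i : a i * b i = 0.
Proof.
case: i; rewrite -rmorphM; apply: p_rel.
- exact: Rel_alphabeta.
- exact: Rel_xiepsilon.
- exact: Rel_gammadelta.
Qed.

Lemma c_sum123 : c l1 + c l2 + c l3 = 0.
Proof. by rewrite !cycE -(p_rel (Rel_sum K)) !rmorphD !rmorphM. Qed.

Lemma c_sum i : c i + c (nx i) + c (nx2 i) = 0.
Proof.
case: i => /=; first exact: c_sum123.
  by rewrite addrC addrA c_sum123.
by rewrite -addrA addrC c_sum123.
Qed.

Lemma ac i : a i * c i = 0. Proof. by rewrite cycE mulrA ab mul0r. Qed.
Lemma cb i : c i * b i = 0. Proof. by rewrite cycE -mulrA ab mulr0. Qed.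
Lemma cc i : c i * c i = 0. Proof. by rewrite {2}cycE mulrA cb mul0r. Qed.

Definition tt (i : leaf) : A := locked (a i * c (nx i)).
Definition uu (i : leaf) : A := locked (c (nx i) * b i).
(** Together with [s4], these elements span the socle. *)
Definition sl (i : leaf) : A := locked (a i * (c (nx i) * b i)).
Definition s4 : A := locked (c l1 * c l2).

Lemma ac1 i : a i * c (nx i) = tt i. Proof. by rewrite /tt -lock. Qed.
Lemma cb1 i : c (nx i) * b i = uu i. Proof. by rewrite /uu -lock. Qed.

Lemma ac2 i : a i * c (nx2 i) = - tt i.
Proof.
apply/eqP; rewrite -addr_eq0 addrC.
by have := congr1 (fun x => a i * x) (c_sum i); rewrite !mulrDr ac add0r mulr0 ac1 => ->.
Qed.

Lemma cb2 i : c (nx2 i) * b i = - uu i.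
Proof.
apply/eqP; rewrite -addr_eq0 addrC.
by have := congr1 (fun x => x * b i) (c_sum i); rewrite !mulrDl cb add0r mul0r cb1 => ->.
Qed.

(** Multiply c_i + c_(i+1) + c_(i+2) = 0 by c_(i+2) on the right. This makes [s4] invariant under
    rotation, while the products in reverse order acquire a sign. *)
Lemma cc_nx_shift i : c (nx i) * c (nx2 i) = c i * c (nx i).
Proof.
have := congr1 (fun x => x * c (nx2 i)) (c_sum i).
rewrite !mulrDl cc addr0 mul0r {1}cycE -mulrA ac2 mulrN -ac1 mulrA -cycE addrC.
by move=> /eqP; rewrite subr_eq0 => /eqP.
Qed.

Lemma cc1 i : c i * c (nx i) = s4.
Proof.
have h1 : c l1 * c (nx l1) = s4 by rewrite /s4 -lock.
by case: i; rewrite ?(cc_nx_shift l2) ?(cc_nx_shift l1).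
Qed.

Lemma cc2 i : c i * c (nx2 i) = - s4.
Proof. by rewrite cycE -mulrA ac2 mulrN -ac1 mulrA -cycE cc1. Qed.

Lemma cc1' i : c (nx i) * c i = - s4.
Proof. by rewrite -{2}(nx3 i) cc2. Qed.

Lemma as4 i : a i * s4 = 0.
Proof. by rewrite -(cc1 i) mulrA ac mul0r. Qed.
Lemma s4b i : s4 * b i = 0.
Proof. by rewrite -(cc1 (nx2 i)) nx3 -mulrA cb mulr0. Qed.
Lemma cs4 i : c i * s4 = 0.
Proof. by rewrite cycE -mulrA as4 mulr0. Qed.
Lemma s4c i : s4 * c i = 0.
Proof. by rewrite cycE mulrA s4b mul0r. Qed.

Lemma leafP (T : leaf -> Prop) i : T i -> T (nx i) -> T (nx2 i) -> forall j, T j.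
Proof. by case: i => ? ? ? []. Qed.

Lemma au i : a i * uu i = sl i. Proof. by rewrite /sl -lock cb1. Qed.
Lemma au1 i : a i * uu (nx i) = 0.
Proof. by rewrite -cb1 mulrA ac2 mulNr -ac1 -mulrA cb mulr0 oppr0. Qed.
Lemma au2 i : a i * uu (nx2 i) = 0.
Proof. by rewrite -cb1 nx3 mulrA ac mul0r. Qed.
Lemma tb i : tt i * b i = sl i. Proof. by rewrite -ac1 -mulrA cb1 au. Qed.
Lemma tb1 i : tt i * b (nx i) = 0.
Proof. by rewrite -ac1 -mulrA cb mulr0. Qed.
Lemma tb2 i : tt i * b (nx2 i) = 0.
Proof. by rewrite -[tt i]opprK -ac2 mulNr -mulrA cb mulr0 oppr0. Qed.
Lemma bt4 i : b i * tt i = s4. Proof. by rewrite -ac1 mulrA -cycE cc1. Qed.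
Lemma ua4 i : uu i * a i = - s4. Proof. by rewrite -cb1 -mulrA -cycE cc1'. Qed.
Lemma bsl i : b i * sl i = 0. Proof. by rewrite -tb mulrA bt4 s4b. Qed.
Lemma sla i : sl i * a i = 0. Proof. by rewrite -au -mulrA ua4 mulrN as4 oppr0. Qed.

Lemma bw1 i : b (nx2 i) * (a (nx2 i) * b i) = - uu i.
Proof. by rewrite mulrA -cycE cb2. Qed.
Lemma bw2 i : b (nx i) * (a (nx i) * b i) = uu i.
Proof. by rewrite mulrA -cycE cb1. Qed.

Definition qpath_of (x : basis) : KQ :=
  let E v := @qidem K quiver9 v in
  let a i := @qarrow K quiver9 (arrow_in i) in
  let b i := @qarrow K quiver9 (arrow_out i) in
  match x with
  | E4 => E v4 | C1 => b l1 * a l1 | C2 => b l2 * a l2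
  | S4 => b l1 * (a l1 * (b l2 * a l2))
  | Ei i => E (leaf_vertex i) | Ai i => a i | Bi i => b i
  | W1 i => a i * b (nx i) | W2 i => a i * b (nx2 i)
  | Ti i => a i * (b (nx i) * a (nx i))
  | Ui i => b (nx i) * (a (nx i) * b i)
  | Si i => a i * (b (nx i) * (a (nx i) * b i))
  end.

Definition basA (x : basis) : A :=
  match x with
  | E4 => e4 | C1 => c l1 | C2 => c l2 | S4 => s4
  | Ei i => e i | Ai i => a i | Bi i => b i
  | W1 i => a i * b (nx i) | W2 i => a i * b (nx2 i)
  | Ti i => tt i | Ui i => uu i | Si i => sl i
  end.

Lemma p_qpath_of x : p (qpath_of x) = basA x.
Proof.
case: x => [| | | |i|i|i|i|i|i|i|i] //=.
- by rewrite rmorphM cycE.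
- by rewrite rmorphM cycE.
- by rewrite !rmorphM /s4 -lock !cycE mulrA.
- by rewrite rmorphM.
- by rewrite rmorphM.
- by rewrite !rmorphM -ac1 cycE.
- by rewrite !rmorphM -cb1 cycE mulrA.
- by rewrite !rmorphM -au -cb1 cycE !mulrA.
Qed.

Lemma basA_src x : idv (bsrc x) * basA x = basA x.
Proof.
case: x => [| | | |i|i|i|i|i|i|i|i] /=.
- by rewrite idvM eqxx.
- by rewrite cycE mulrA eb.
- by rewrite cycE mulrA eb.
- by rewrite -(cc1 l1) cycE !mulrA eb.
- exact: idv_leaf.
- exact: ea.
- exact: eb.
- by rewrite mulrA ea.
- by rewrite mulrA ea.
- by rewrite -ac1 mulrA ea.
- by rewrite -cb1 cycE !mulrA eb.
- by rewrite -au mulrA ea.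
Qed.

Lemma basA_tgt x : basA x * idv (btgt x) = basA x.
Proof.
case: x => [| | | |i|i|i|i|i|i|i|i] /=.
- by rewrite idvM eqxx.
- by rewrite cycE -mulrA ae.
- by rewrite cycE -mulrA ae.
- by rewrite -(cc1 l1) cycE -!mulrA cycE -!mulrA ae.
- exact: idv_leaf.
- exact: ae.
- exact: be.
- by rewrite -mulrA be.
- by rewrite -mulrA be.
- by rewrite -ac1 cycE -!mulrA ae.
- by rewrite -cb1 -!mulrA be.
- by rewrite -tb -mulrA be.
Qed.

(** * Linear independence of the basis *)

Local Notation V := {malg K[basis]}.

(** It intertwines the tables with left multiplication in A, see [decA_act], and [coord] is its
    inverse. *)
Definition decA (v : V) : A := lext basA v.

Lemma decAU x : decA (bvec x) = basA x. Proof. exact: lextU. Qed.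
Lemma decA_linear : linear decA. Proof. exact: lext_is_linear. Qed.
Lemma decA0 : decA 0 = 0. Proof. exact: linear0. Qed.
Lemma decAN x : decA (- x) = - decA x. Proof. exact: linearN. Qed.
Lemma decAD x y : decA (x + y) = decA x + decA y. Proof. exact: linearD. Qed.

Lemma decA_regE v x : decA (regE v x) = idv v * decA x.
Proof.
move: x; apply: eq_malg_linear => [k x y|k x y|x].
- by rewrite regE_linear decA_linear.
- by rewrite decA_linear mulrDr scalerAr.
rewrite regEU decAU; case: eqP => [->|/eqP vx]; first by rewrite decAU basA_src.
by rewrite decA0 -basA_src mulrA idvM (negPf vx) mul0r.
Qed.

Lemma arr_bas0 y x : bsrc x != arrow_tgt y -> arr y * basA x = 0.
Proof.
by move=> xy; rewrite -arr_tgt -basA_src mulrA -(mulrA (arr y)) idvM eq_sym (negPf xy) mulr0 mul0r.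
Qed.

Lemma in_bas0 i x : bsrc x != v4 -> a i * basA x = 0.
Proof. by move=> x4; apply: arr_bas0; case: i. Qed.

Lemma out_bas0 i x : bsrc x != leaf_vertex i -> b i * basA x = 0.
Proof. by move=> xi; apply: arr_bas0; case: i xi. Qed.

Lemma left_in_bas i x : decA (left_in K i x) = a i * basA x.
Proof.
case: x => [| | | |j|j|j|j|j|j|j|j];
  try by rewrite in_bas0 /= ?leaf_vertexE // decA0.
- by rewrite [LHS]decAU ae.
- case: i => /=; rewrite ?decA0 ?decAN ?decAU.
  + exact/esym/(ac l1).
  + exact/esym/(ac2 l2).
  + exact/esym/(ac1 l3).
- case: i => /=; rewrite ?decA0 ?decAN ?decAU.
  + exact/esym/(ac1 l1).
  + exact/esym/(ac l2).
  + exact/esym/(ac2 l3).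
- by rewrite [LHS]decA0 as4.
- rewrite /=; move: j; apply: (@leafP _ i); rewrite /delta_leaf ?eqxx ?leaf_eqE.
  + by rewrite addr0 decA0 ab.
  + by rewrite addr0 decAU.
  + by rewrite add0r decAU.
- rewrite /=; move: j; apply: (@leafP _ i); rewrite /delta_leaf ?eqxx ?leaf_eqE.
  + by rewrite decAU au.
  + by rewrite decA0 au1.
  + by rewrite decA0 au2.
Qed.

Lemma left_out_bas i x : decA (left_out K i x) = b i * basA x.
Proof.
have [xi|xi] := eqVneq (bsrc x) (leaf_vertex i); last first.
  rewrite (out_bas0 xi) -[RHS]decA0; congr decA.
  case: x xi => [| | | |j|j|j|j|j|j|j|j] //=;
    by rewrite leaf_vertexE eq_sym /delta_leaf => /negPf ->.
case: x xi => [| | | |j|j|j|j|j|j|j|j] /= /eqP; rewrite leaf_vertexE // => /eqP ->;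
  rewrite /delta_leaf ?eqxx.
- by rewrite decAU be.
- rewrite -cycE; case: i => /=; rewrite ?decAD ?decAN ?decAU //=.
  by apply/eqP; rewrite eq_sym -subr_eq0 opprD !opprK addrC c_sum123.
- by rewrite decAN decAU /= -bw1 nx3.
- by rewrite decAU /= -bw2 nx3.
- by rewrite decAU /= bt4.
- by rewrite decA0 bsl.
Qed.

Lemma decA_regX y x : decA (regX y x) = arr y * decA x.
Proof.
move: x; apply: eq_malg_linear => [k x z|k x z|x].
- by rewrite regX_linear decA_linear.
- by rewrite decA_linear mulrDr scalerAr.
rewrite regXU decAU; case: y.
- exact: (left_in_bas l1).
- exact: (left_out_bas l1).
- exact: (left_in_bas l2).
- exact: (left_out_bas l2).
- exact: (left_in_bas l3).
- exact: (left_out_bas l3).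
Qed.

Lemma decA_reg1 : decA (reg1 K) = 1.
Proof. by rewrite /reg1 !decAD !decAU /= idv_sum. Qed.

Local Notation act := (@path_act K quiver9 V (@regE K) (@regX K)).

Lemma act_arrow9 y f v : act (@qarrow K quiver9 y * f) v = regX y (act f v).
Proof.
exact: (@path_act_arrow K quiver9 V (@regE K) (@regX K) (@regX_linear K) (@regE_idem K) (@regX_src K) (@regX_tgt K)).
Qed.

Lemma act_arrow1 y v : act (@qarrow K quiver9 y) v = regX y v.
Proof.
by rewrite -[@qarrow K quiver9 y]qidem_tgt act_arrow9 path_act_qidem [RHS](esym (regX_tgt _ _)).
Qed.

Lemma act_mul f g v : act (f * g) v = act f (act g v).
Proof.
exact: (@path_actM K quiver9 V (@regE K) (@regX K) (@regE_linear K) (@regX_linear K) (@regE_idem K) (@regX_src K) (@regX_tgt K)).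
Qed.

Lemma act_lin f : linear (act f).
Proof.
exact: (@path_act_linearr K quiver9 V (@regE K) (@regX K) (@regE_linear K) (@regX_linear K) (@regE_idem K) (@regX_src K) (@regX_tgt K)).
Qed.

Lemma act_rel r v : relation9' r -> act r v = 0.
Proof.
case; last 3 first.
- by rewrite act_mul !act_arrow1; apply: (regX_in_out l1).
- by rewrite act_mul !act_arrow1; apply: (regX_in_out l2).
- by rewrite act_mul !act_arrow1; apply: (regX_in_out l3).
rewrite 2!path_actDl !act_mul !act_arrow1 -[RHS](regX_out_in v) !big_cons big_nil.
by rewrite addr0 addrA.
Qed.

Lemma decA_act f v : decA (act f v) = p f * decA v.
Proof.
elim/path_alg_ind: f => [f g hf hg|k f hf|w|y f hf].
- by rewrite path_actDl decAD hf hg rmorphD mulrDl.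
- by rewrite path_actZl (linear_scale decA_linear) hf pZ scalerAl.
- by rewrite path_act_qidem decA_regE.
- by rewrite act_arrow9 decA_regX hf rmorphM mulrA.
Qed.

(** Linear independence comes from here: each chosen path sends the coordinates of 1 to its own
    basis vector. *)
Lemma act_bas x : act (qpath_of x) (reg1 K) = bvec x.
Proof.
case: x => [| | | |i|i|i|i|i|i|i|i] /=; rewrite ?act_arrow9 ?act_arrow1 ?path_act_qidem;
 try case: i; rewrite /reg1 ?(regXD, regXU, regED, regEU) /= /delta_leaf /=
  ?(regXD, regXU, regXN, regX0, addr0, add0r) /= /delta_leaf /=
  ?(regXD, regXU, regXN, regX0, addr0, add0r) /= /delta_leaf /=
  ?(regXD, regXU, regXN, regX0, addr0, add0r) /= ?opprK ?subr0 //;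
  by do ![case: eqP => // _]; rewrite ?addr0 ?add0r.
Qed.

Hypothesis p_ker : forall f, p f = 0 -> ideal_gen (@relation9' K) f.
Variable rep : A -> KQ.
Hypothesis repK : forall x, p (rep x) = x.

(** The elements acting by zero form an ideal that contains the relations, so the action descends to
    A. *)
Lemma act_ker f v : p f = 0 -> act f v = 0.
Proof.
move=> /p_ker /(_ (fun f => forall v, act f v = 0)) h; apply: h => [|r hr w].
  split=> [w|f1 f2 h1 h2 w|f1 f2 h2 w|f1 f2 h1 w].
  - exact: path_act0l.
  - by rewrite -scaleN1r path_actDl path_actZl h1 h2 scaler0 addr0.
  - by rewrite act_mul h2 (linear_zero (act_lin f1)).
  - by rewrite act_mul h1.
exact: act_rel.
Qed.

Definition coord (x : A) : V := act (rep x) (reg1 K).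

Lemma coord_p f : coord (p f) = act f (reg1 K).
Proof.
have : act (rep (p f) - f) (reg1 K) = 0 by apply: act_ker; rewrite pB repK subrr.
by rewrite -scaleN1r path_actDl path_actZl scaleN1r => /eqP; rewrite subr_eq0 => /eqP.
Qed.

Lemma coord_linear : linear coord.
Proof.
move=> k x y; rewrite -(repK x) -(repK y) -pZ -rmorphD !coord_p.
by rewrite path_actDl path_actZl.
Qed.

Lemma coord_bas x : coord (basA x) = bvec x.
Proof. by rewrite -p_qpath_of coord_p act_bas. Qed.

Lemma decA_coord x : decA (coord x) = x.
Proof. by rewrite decA_act decA_reg1 mulr1 repK. Qed.

Lemma coord_decA v : coord (decA v) = v.
Proof.
move: v; apply: eq_malg_linear => [k x y|//|x].
  by rewrite decA_linear coord_linear.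
by rewrite decAU coord_bas.
Qed.

Definition sec9 (x : A) : KQ := lext (qpath_of : basis -> KQ) (coord x).

Lemma sec9_linear : linear sec9.
Proof. by move=> k x y; rewrite /sec9 coord_linear linearP. Qed.

Lemma sec9K x : p (sec9 x) = x.
Proof.
rewrite -[RHS]decA_coord /sec9; move: (coord x); apply: eq_malg_linear => [k y z|k y z|y].
- by rewrite linearP; apply: (linearP p).
- exact: decA_linear.
- by rewrite lextU decAU p_qpath_of.
Qed.

Lemma A_ind (T : A -> Prop) :
  (forall x y, T x -> T y -> T (x + y)) -> (forall k x, T x -> T (k *: x)) ->
  (forall x, T (basA x)) -> forall x, T x.
Proof.
move=> TD TZ Tb x; rewrite -(decA_coord x) [coord x](@monalgE _ _ (coord x)).
elim: (enum_fset _) => [|y s IH].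
  by rewrite big_nil -(scale0r (0 : V)) (linear_scale decA_linear); apply/TZ; rewrite decA0 -(scale0r (basA E4)); apply: TZ.
rewrite big_cons decAD; apply: TD => //.
by rewrite malg_scaleU (linear_scale decA_linear) decAU; apply: TZ.
Qed.

Lemma basA_mid v w x : idv v * basA x * idv w =
  if (v == bsrc x) && (w == btgt x) then basA x else 0.
Proof.
have [->|/negPf vx] := eqVneq v (bsrc x); last first.
  by rewrite -basA_src mulrA idvM vx !mul0r.
have [->|/negPf wx] := eqVneq w (btgt x); first by rewrite basA_src basA_tgt.
by rewrite -basA_tgt -!mulrA idvM eq_sym wx !mulr0.
Qed.

(** * Spaces of parallel elements *)

Section Span.
Variables v w : vertex.

Lemma mid_span (s : seq basis) :
  (forall x, bsrc x = v -> btgt x = w -> x \in s) ->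
  uniq s ->
  forall x, exists k : basis -> K, idv v * x * idv w = \sum_(y <- s) k y *: basA y.
Proof.
move=> hs us; apply: A_ind => [x y [k kE] [l lE]|k x [l lE]|x].
- exists (fun z => k z + l z); rewrite mulrDr mulrDl kE lE -big_split.
  by apply: eq_bigr => z _; rewrite scalerDl.
- exists (fun z => k * l z); rewrite -scalerAr -scalerAl lE scaler_sumr.
  by apply: eq_bigr => z _; rewrite scalerA.
rewrite basA_mid; case: ifP => [/andP[/eqP vx /eqP wx]|_].
  exists (fun z => (z == x)%:R); rewrite (bigD1_seq x) ?hs //= eqxx scale1r.
  by rewrite big1 ?addr0 // => z /negPf ->; rewrite scale0r.
by exists (fun=> 0); rewrite big1 // => z _; rewrite scale0r.
Qed.

End Span.

Lemma span_leaf i x : e i * x * e i = x -> exists k l, x = k *: e i + l *: sl i.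
Proof.
have [|//|k kE] := @mid_span (leaf_vertex i) (leaf_vertex i) [:: Ei i; Si i] _ _ x.
  case=> [| | | |j|j|j|j|j|j|j|j] /= /eqP; rewrite ?leaf_vertexE // => /eqP -> /eqP;
    by rewrite ?leaf_vertexE ?leaf_eqE // => _; rewrite !inE eqxx ?orbT.
by rewrite kE => <-; exists (k (Ei i)), (k (Si i)); rewrite !big_cons big_nil addr0.
Qed.

Lemma span_in i x : e i * x * e4 = x -> exists k l, x = k *: a i + l *: tt i.
Proof.
have [|//|k kE] := @mid_span (leaf_vertex i) v4 [:: Ai i; Ti i] _ _ x.
  case=> [| | | |j|j|j|j|j|j|j|j] /= /eqP; rewrite ?leaf_vertexE // => /eqP -> /eqP;
    by rewrite ?leaf_vertexE ?leaf_eqE // => _; rewrite !inE eqxx ?orbT.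
by rewrite kE => <-; exists (k (Ai i)), (k (Ti i)); rewrite !big_cons big_nil addr0.
Qed.

Lemma span_out i x : e4 * x * e i = x -> exists k l, x = k *: b i + l *: uu i.
Proof.
have [|//|k kE] := @mid_span v4 (leaf_vertex i) [:: Bi i; Ui i] _ _ x.
  case=> [| | | |j|j|j|j|j|j|j|j] /= /eqP; rewrite ?leaf_vertexE // => _ /eqP;
    by rewrite ?leaf_vertexE // => /eqP ->; rewrite !inE eqxx ?orbT.
by rewrite kE => <-; exists (k (Bi i)), (k (Ui i)); rewrite !big_cons big_nil addr0.
Qed.

Lemma span_4 x : e4 * x * e4 = x ->
  exists k m1 m2 l, x = k *: e4 + m1 *: c l1 + m2 *: c l2 + l *: s4.
Proof.
have [|//|k kE] := @mid_span v4 v4 [:: E4; C1; C2; S4] _ _ x.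
  by case=> [| | | |j|j|j|j|j|j|j|j] //= /eqP; rewrite ?leaf_vertexE // => _ /eqP;
    rewrite ?leaf_vertexE.
rewrite kE => <-; exists (k E4), (k C1), (k C2), (k S4).
by rewrite !big_cons big_nil addr0 !addrA.
Qed.

Lemma decA_eq0 v : decA v = 0 -> v = 0.
Proof.
by move=> v0; rewrite -(coord_decA v) v0 -decA0 coord_decA.
Qed.

Lemma indep2 (x y : basis) (k l : K) : x != y ->
  k *: basA x + l *: basA y = 0 -> k = 0 /\ l = 0.
Proof.
move=> xy; rewrite -!decAU -!(linear_scale decA_linear) -decAD => /decA_eq0 /malgP h.
have := h x; have := h y; rewrite !mcoeffD !mcoeffZ !mcoeff_bvec !eqxx (negPf xy).
by rewrite eq_sym (negPf xy) !mcoeff0 !mulr1 !mulr0 add0r addr0 => -> ->.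
Qed.

Lemma indep_leaf i k l : k *: e i + l *: sl i = 0 -> k = 0 /\ l = 0.
Proof. by apply: (@indep2 (Ei i) (Si i)); case: i. Qed.
Lemma indep_in i k l : k *: a i + l *: tt i = 0 -> k = 0 /\ l = 0.
Proof. by apply: (@indep2 (Ai i) (Ti i)); case: i. Qed.
Lemma indep_out i k l : k *: b i + l *: uu i = 0 -> k = 0 /\ l = 0.
Proof. by apply: (@indep2 (Bi i) (Ui i)); case: i. Qed.

Lemma indep_4 k m1 m2 l :
  k *: e4 + m1 *: c l1 + m2 *: c l2 + l *: s4 = 0 -> [/\ k = 0, m1 = 0, m2 = 0 & l = 0].
Proof.
move=> h; have : decA (k *: bvec E4 + m1 *: bvec C1 + m2 *: bvec C2 + l *: bvec S4) = 0.
  by rewrite !decAD !(linear_scale decA_linear) !decAU.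
move=> /decA_eq0 /malgP {}h; have := h E4; have := h C1; have := h C2; have := h S4.
rewrite !mcoeffD !mcoeffZ !mcoeff_bvec !mcoeff0 /= ?(mulr1, mulr0, addr0, add0r).
by [].
Qed.

Lemma indep_4_eq k m1 m2 l k' m1' m2' l' :
  k *: e4 + m1 *: c l1 + m2 *: c l2 + l *: s4 =
  k' *: e4 + m1' *: c l1 + m2' *: c l2 + l' *: s4 ->
  [/\ k = k', m1 = m1', m2 = m2' & l = l'].
Proof.
move/eqP; rewrite -subr_eq0 !opprD -!scaleNr (addrACA _ (l *: _)).
rewrite (addrACA _ (m2 *: _)) (addrACA _ (m1 *: _)) -!scalerDl => /eqP/indep_4.
by case=> /eqP + /eqP + /eqP + /eqP; rewrite !subr_eq0 => /eqP-> /eqP-> /eqP-> /eqP->.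
Qed.

(** * Relations, and derivations with given values on the arrows *)

Variable Ae : envelope A.
Local Notation bt := (@bt K A Ae).
Local Notation qa i := (@qarrow K quiver9 (arrow_in i)).
Local Notation qb i := (@qarrow K quiver9 (arrow_out i)).

(** There is exactly one relation at each vertex, and it runs from that vertex to itself; hence the
    index type [vertex] and the end maps [id]. *)
Definition rel9 (v : vertex) : KQ :=
  match v with
  | v1 => qa l1 * qb l1 | v2 => qa l2 * qb l2 | v3 => qa l3 * qb l3
  | v4 => qb l1 * qa l1 + qb l2 * qa l2 + qb l3 * qa l3
  end.

Lemma rel9_leaf i : rel9 (leaf_vertex i) = qa i * qb i.
Proof. by case: i. Qed.

Lemma qidem_in i : @qidem K quiver9 (leaf_vertex i) * qa i = qa i.
Proof. by have := @qidem_src K quiver9 (arrow_in i); case: i. Qed.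
Lemma qidem_out i : @qidem K quiver9 v4 * qb i = qb i.
Proof. by have := @qidem_src K quiver9 (arrow_out i); case: i. Qed.
Lemma qin_idem i : qa i * @qidem K quiver9 v4 = qa i.
Proof. by have := @qidem_tgt K quiver9 (arrow_in i); case: i. Qed.
Lemma qout_idem i : qb i * @qidem K quiver9 (leaf_vertex i) = qb i.
Proof. by have := @qidem_tgt K quiver9 (arrow_out i); case: i. Qed.

Lemma rel9_src v : @qidem K quiver9 v * rel9 v = rel9 v.
Proof.
elim/vertexP: v => [i|]; first by rewrite rel9_leaf mulrA qidem_in.
by rewrite /rel9 2!mulrDr 3!mulrA !qidem_out.
Qed.

Lemma rel9_tgt v : rel9 v * @qidem K quiver9 v = rel9 v.
Proof.
elim/vertexP: v => [i|]; first by rewrite rel9_leaf -mulrA qout_idem.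
by rewrite /rel9 2!mulrDl -3!mulrA !qin_idem.
Qed.

Lemma rel9_rel v : relation9' (rel9 v).
Proof.
case: v; [exact: Rel_alphabeta|exact: Rel_xiepsilon|exact: Rel_gammadelta|
  exact: Rel_sum].
Qed.

Lemma rel9_p v : p (rel9 v) = 0.
Proof. exact/p_rel/rel9_rel. Qed.

Lemma rel9_ker f : p f = 0 -> ideal_gen (fun r => exists v, r = rel9 v) f.
Proof.
move=> /p_ker pf I iI hI; apply: pf => // r hr; apply: hI.
by case: hr; [exists v4|exists v1|exists v2|exists v3].
Qed.

Local Notation reg := (ereg Ae).
Local Notation par1 := (@parallel1 K quiver9 A p).
Local Notation par2 := (@parallel2 K quiver9 A vertex id id p).
Local Notation diag := (@diagonal K quiver9 A p).
Local Notation drv := (@derivation K quiver9 A Ae p).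

Lemma par1P n : par1 n <->
  (forall i, e i * n (arrow_in i) * e4 = n (arrow_in i)) /\
  (forall i, e4 * n (arrow_out i) * e i = n (arrow_out i)).
Proof.
split=> [h|[hi ho]].
  by split=> i; [have := h (arrow_in i)|have := h (arrow_out i)]; case: i.
by case; [apply: (hi l1)|apply: (ho l1)|apply: (hi l2)|
  apply: (ho l2)|apply: (hi l3)|apply: (ho l3)].
Qed.

Lemma par1_span n : par1 n -> exists x y x' y' : leaf -> K,
  (forall i, n (arrow_in i) = x i *: a i + y i *: tt i) /\
  (forall i, n (arrow_out i) = x' i *: b i + y' i *: uu i).
Proof.
move=> /par1P[hi ho].
have hin i : exists k : K * K, n (arrow_in i) = k.1 *: a i + k.2 *: tt i.
  by have [k [l ->]] := span_in (hi i); exists (k, l).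
have hout i : exists k : K * K, n (arrow_out i) = k.1 *: b i + k.2 *: uu i.
  by have [k [l ->]] := span_out (ho i); exists (k, l).
have [k kE] := choice hin; have [l lE] := choice hout.
by exists (fun i => (k i).1), (fun i => (k i).2), (fun i => (l i).1), (fun i => (l i).2).
Qed.

Definition family1 (x y x' y' : leaf -> K) (z : arrow) : A :=
  match z with
  | alpha => x l1 *: a l1 + y l1 *: tt l1
  | xi => x l2 *: a l2 + y l2 *: tt l2
  | gamma => x l3 *: a l3 + y l3 *: tt l3
  | beta => x' l1 *: b l1 + y' l1 *: uu l1
  | epsilon => x' l2 *: b l2 + y' l2 *: uu l2
  | delta => x' l3 *: b l3 + y' l3 *: uu l3
  end.

Lemma family1_in x y x' y' i : family1 x y x' y' (arrow_in i) = x i *: a i + y i *: tt i.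
Proof. by case: i. Qed.
Lemma family1_out x y x' y' i : family1 x y x' y' (arrow_out i) = x' i *: b i + y' i *: uu i.
Proof. by case: i. Qed.

Lemma et i : e i * tt i = tt i. Proof. exact: (basA_src (Ti i)). Qed.
Lemma te i : tt i * e4 = tt i. Proof. exact: (basA_tgt (Ti i)). Qed.
Lemma eu i : e4 * uu i = uu i. Proof. exact: (basA_src (Ui i)). Qed.
Lemma ue i : uu i * e i = uu i. Proof. exact: (basA_tgt (Ui i)). Qed.
Lemma es i : e i * sl i = sl i. Proof. exact: (basA_src (Si i)). Qed.
Lemma se i : sl i * e i = sl i. Proof. exact: (basA_tgt (Si i)). Qed.
Lemma ec i : e4 * c i = c i. Proof. by rewrite cycE mulrA eb. Qed.
Lemma ce i : c i * e4 = c i. Proof. by rewrite cycE -mulrA ae. Qed.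
Lemma es4 : e4 * s4 = s4. Proof. exact: (basA_src S4). Qed.
Lemma s4e : s4 * e4 = s4. Proof. exact: (basA_tgt S4). Qed.

Lemma family1_par x y x' y' : par1 (family1 x y x' y').
Proof.
apply/par1P; split=> i.
  by rewrite family1_in mulrDr mulrDl -!scalerAr -!scalerAl ea ae et te.
by rewrite family1_out mulrDr mulrDl -!scalerAr -!scalerAl eb be eu ue.
Qed.

Lemma drv_mul n y z : par1 n ->
  drv n (@qarrow K quiver9 y * @qarrow K quiver9 z) = n y * arr z + arr y * n z.
Proof. by move=> np; rewrite derivation_arrow // derivation1. Qed.

Lemma drv_leaf n i : par1 n ->
  drv n (rel9 (leaf_vertex i)) = n (arrow_in i) * b i + a i * n (arrow_out i).
Proof. by move=> np; rewrite rel9_leaf drv_mul. Qed.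

Lemma drv_4 n : par1 n -> drv n (rel9 v4) =
  (n (arrow_out l1) * a l1 + b l1 * n (arrow_in l1)) +
  (n (arrow_out l2) * a l2 + b l2 * n (arrow_in l2)) +
  (n (arrow_out l3) * a l3 + b l3 * n (arrow_in l3)).
Proof. by move=> np; rewrite /rel9 2!derivationD !drv_mul. Qed.

Section DerivationValues.
Variables (n : arrow -> A) (x y x' y' : leaf -> K).
Hypothesis np : par1 n.
Hypothesis n_in : forall i, n (arrow_in i) = x i *: a i + y i *: tt i.
Hypothesis n_out : forall i, n (arrow_out i) = x' i *: b i + y' i *: uu i.

Lemma drv_leafE i : drv n (rel9 (leaf_vertex i)) = (y i + y' i) *: sl i.
Proof.
rewrite drv_leaf // n_in n_out mulrDl mulrDr -!scalerAl -!scalerAr ab tb au.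
by rewrite !scaler0 !add0r -scalerDl.
Qed.

(** The minus sign comes from u_i a_i = - s_4 against b_i t_i = s_4, whereas at the leaf both t_i
    b_i and a_i u_i equal [sl i]. This difference is the source of the factor 2. *)
Lemma drv_4_term i : n (arrow_out i) * a i + b i * n (arrow_in i) =
  (x i + x' i) *: c i + (y i - y' i) *: s4.
Proof.
rewrite n_in n_out mulrDl mulrDr -!scalerAl -!scalerAr -!cycE ua4 bt4.
by rewrite addrACA -scalerDl (addrC (x' i)) scalerN (addrC (- _)) -scalerBl.
Qed.

Lemma c3E : c l3 = - c l1 - c l2.
Proof. by apply/eqP; rewrite -opprD -addr_eq0 addrC c_sum123. Qed.

Lemma drv_4E : drv n (rel9 v4) =
  0 *: e4 + ((x l1 + x' l1) - (x l3 + x' l3)) *: c l1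
  + ((x l2 + x' l2) - (x l3 + x' l3)) *: c l2
  + ((y l1 - y' l1) + (y l2 - y' l2) + (y l3 - y' l3)) *: s4.
Proof.
rewrite drv_4 // !drv_4_term c3E scale0r add0r.
set X1 := x l1 + _; set X2 := x l2 + _; set X3 := x l3 + _.
rewrite (addrACA (X1 *: _)) [LHS]addrACA -!scalerDl; congr (_ + _).
by rewrite scalerBr scalerN addrACA -!scalerBl.
Qed.

End DerivationValues.


(** The factor by which m1 c_1 + m2 c_2 turns a_i into t_i and b_i into u_i. The three values are
    arbitrary up to having sum zero, which makes the sum of the y_i an invariant modulo inner
    derivations. *)
Definition mu (m1 m2 : K) (i : leaf) : K :=
  match i with l1 => m2 | l2 => - m1 | l3 => m1 - m2 end.

Lemma a_cc m1 m2 i : a i * (m1 *: c l1 + m2 *: c l2) = mu m1 m2 i *: tt i.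
Proof.
rewrite mulrDr -!scalerAr; case: i.
- by rewrite (ac l1) (ac1 l1) scaler0 add0r.
- by rewrite (ac2 l2) (ac l2) scaler0 addr0 scalerN scaleNr.
- by rewrite (ac1 l3) (ac2 l3) scalerN -scalerBl.
Qed.

Lemma cc_b m1 m2 i : (m1 *: c l1 + m2 *: c l2) * b i = mu m1 m2 i *: uu i.
Proof.
rewrite mulrDl -!scalerAl; case: i.
- by rewrite (cb l1) (cb1 l1) scaler0 add0r.
- by rewrite (cb2 l2) (cb l2) scaler0 addr0 scalerN scaleNr.
- by rewrite (cb1 l3) (cb2 l3) scalerN -scalerBl.
Qed.

(** * Commutators with diagonal elements *)

Section Commutators.
Variables (z : A) (k l : leaf -> K) (k4 m1 m2 l4 : K).
Hypothesis zd : diag z.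
Hypothesis z_leaf : forall i, e i * z * e i = k i *: e i + l i *: sl i.
Hypothesis z_4 : e4 * z * e4 = k4 *: e4 + m1 *: c l1 + m2 *: c l2 + l4 *: s4.

Lemma in_z i : a i * z = k4 *: a i + mu m1 m2 i *: tt i.
Proof.
have -> : a i * z = a i * (e4 * z * e4).
  by rewrite -mulrA -zd !mulrA -(mulrA (a i)) idvM eqxx ae.
rewrite z_4 -(addrA (k4 *: _)) mulrDr mulrDr a_cc -!scalerAr ae as4 scaler0 addr0.
by [].
Qed.

Lemma z_in i : z * a i = k i *: a i.
Proof.
have -> : z * a i = e i * z * e i * a i.
  by rewrite zd -!mulrA !ea.
by rewrite z_leaf mulrDl -!scalerAl ea sla scaler0 addr0.
Qed.

Lemma out_z i : b i * z = k i *: b i.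
Proof.
have -> : b i * z = b i * (e i * z * e i).
  by rewrite -mulrA -zd !mulrA !be.
by rewrite z_leaf mulrDr -!scalerAr be bsl scaler0 addr0.
Qed.

Lemma z_out i : z * b i = k4 *: b i + mu m1 m2 i *: uu i.
Proof.
have -> : z * b i = e4 * z * e4 * b i.
  by rewrite zd -!mulrA !eb.
rewrite z_4 -(addrA (k4 *: _)) mulrDl mulrDl cc_b -!scalerAl eb s4b scaler0 addr0.
by [].
Qed.

Lemma comm_in i : a i * z - z * a i = (k4 - k i) *: a i + mu m1 m2 i *: tt i.
Proof. by rewrite in_z z_in scalerBl addrAC. Qed.

Lemma comm_out i : b i * z - z * b i = (k i - k4) *: b i + (- mu m1 m2 i) *: uu i.
Proof. by rewrite out_z z_out opprD addrA scalerBl scaleNr. Qed.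

End Commutators.

Lemma diag_span z : diag z -> exists k l : leaf -> K, exists k4 m1 m2 l4 : K,
  (forall i, e i * z * e i = k i *: e i + l i *: sl i) /\
  e4 * z * e4 = k4 *: e4 + m1 *: c l1 + m2 *: c l2 + l4 *: s4.
Proof.
move=> zd.
have hl i : exists k : K * K, e i * z * e i = k.1 *: e i + k.2 *: sl i.
  have [|k [l ->]] := @span_leaf i (e i * z * e i); last by exists (k, l).
  by rewrite !mulrA idv_leaf -mulrA idv_leaf.
have [k kE] := choice hl.
have [|k4 [m1 [m2 [l4 ->]]]] := @span_4 (e4 * z * e4).
  by rewrite !mulrA idvM eqxx -mulrA idvM eqxx.
by exists (fun i => (k i).1), (fun i => (k i).2), k4, m1, m2, l4.
Qed.

Lemma diag_sum z : diag z ->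
  z = e l1 * z * e l1 + e l2 * z * e l2 + e l3 * z * e l3 + e4 * z * e4.
Proof.
move=> zd; rewrite !zd -!mulrA !idvM !eqxx -!mulrDr.
by rewrite idv_sum mulr1.
Qed.

(** Representatives of the diagonal elements modulo the centre: a multiple of 1 removes the
    coefficient of [e4], and the socle is central. *)
Definition diag_elt (k : leaf -> K) (m1 m2 : K) : A :=
  k l1 *: e l1 + k l2 *: e l2 + k l3 *: e l3 + (m1 *: c l1 + m2 *: c l2).

Lemma idv_leafM i j : e i * e j = if i == j then e i else 0.
Proof. by rewrite idvM leaf_vertexE. Qed.
Lemma e4_leaf i : e4 * e i = 0. Proof. by rewrite idvM leaf_vertexE. Qed.
Lemma e_leaf4 i : e i * e4 = 0. Proof. by rewrite idvM leaf_vertexE. Qed.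
Lemma ei_c i j : e i * c j = 0. Proof. by rewrite -ec mulrA e_leaf4 mul0r. Qed.
Lemma c_ei i j : c j * e i = 0. Proof. by rewrite -ce -mulrA e4_leaf mulr0. Qed.

Lemma leaf_diag_elt k m1 m2 i : e i * diag_elt k m1 m2 = k i *: e i.
Proof.
rewrite /diag_elt !mulrDr -!scalerAr !ei_c !idv_leafM !scaler0 !addr0.
by case: i; rewrite ?eqxx /= ?scaler0 ?addr0 ?add0r.
Qed.

Lemma diag_elt_leaf k m1 m2 i : diag_elt k m1 m2 * e i = k i *: e i.
Proof.
rewrite /diag_elt !mulrDl -!scalerAl !c_ei !idv_leafM !scaler0 !addr0.
by case: i; rewrite ?eqxx /= ?scaler0 ?addr0 ?add0r.
Qed.

Lemma e4_diag_elt k m1 m2 : e4 * diag_elt k m1 m2 = m1 *: c l1 + m2 *: c l2.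
Proof. by rewrite /diag_elt !mulrDr -!scalerAr !ec !e4_leaf !scaler0 !add0r. Qed.
Lemma diag_elt_e4 k m1 m2 : diag_elt k m1 m2 * e4 = m1 *: c l1 + m2 *: c l2.
Proof. by rewrite /diag_elt !mulrDl -!scalerAl !ce !e_leaf4 !scaler0 !add0r. Qed.

Lemma diag_elt_diag k m1 m2 : diag (diag_elt k m1 m2).
Proof.
move=> v; rewrite -/(idv v); elim/vertexP: v => [i|].
  by rewrite leaf_diag_elt diag_elt_leaf.
by rewrite e4_diag_elt diag_elt_e4.
Qed.

Lemma diag_elt_in k m1 m2 i : a i * diag_elt k m1 m2 - diag_elt k m1 m2 * a i =
  (- k i) *: a i + mu m1 m2 i *: tt i.
Proof.
rewrite (@comm_in _ k (fun=> 0) 0 m1 m2 0) ?sub0r //.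
- exact: diag_elt_diag.
- by move=> j; rewrite leaf_diag_elt -scalerAl idv_leaf scale0r addr0.
- by rewrite e4_diag_elt mulrDl -!scalerAl !ce !scale0r add0r addr0.
Qed.

Lemma diag_elt_out k m1 m2 i : b i * diag_elt k m1 m2 - diag_elt k m1 m2 * b i =
  k i *: b i + (- mu m1 m2 i) *: uu i.
Proof.
rewrite (@comm_out _ k (fun=> 0) 0 m1 m2 0) ?subr0 //.
- exact: diag_elt_diag.
- by move=> j; rewrite leaf_diag_elt -scalerAl idv_leaf scale0r addr0.
- by rewrite e4_diag_elt mulrDl -!scalerAl !ce !scale0r add0r addr0.
Qed.

(** * Degree 0: the centre *)

Definition center_basis (i : 'I_5) : A := nth 0 [:: 1; sl l1; sl l2; sl l3; s4] i.

Lemma sl_diag i : diag (sl i).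
Proof.
move=> v; rewrite -/(idv v); have [->|vi] := eqVneq v (leaf_vertex i).
  by rewrite es se.
rewrite -[in LHS]es -[in RHS]se mulrA -[RHS]mulrA !idvM.
by rewrite [leaf_vertex i == v]eq_sym (negPf vi) mul0r mulr0.
Qed.

Lemma s4_diag : diag s4.
Proof.
move=> v; rewrite -/(idv v); have [->|vi] := eqVneq v v4.
  by rewrite es4 s4e.
rewrite -[in LHS]es4 -[in RHS]s4e mulrA -[RHS]mulrA !idvM.
by rewrite [v4 == v]eq_sym (negPf vi) mul0r mulr0.
Qed.

Lemma sl_in i j : sl i * a j = 0.
Proof.
have [->|ij] := eqVneq i j; first exact: sla.
by rewrite -se -ea mulrA -(mulrA (sl i)) idv_leafM (negPf ij) mulr0 mul0r.
Qed.
Lemma out_sl i j : b j * sl i = 0.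
Proof.
have [->|ij] := eqVneq j i; first exact: bsl.
by rewrite -be -es mulrA -(mulrA (b j)) idv_leafM (negPf ij) mulr0 mul0r.
Qed.
Lemma in_sl i j : a j * sl i = 0.
Proof. by rewrite -ae -es mulrA -(mulrA (a j)) e4_leaf mulr0 mul0r. Qed.
Lemma sl_out i j : sl i * b j = 0.
Proof. by rewrite -se -eb mulrA -(mulrA (sl i)) e_leaf4 mulr0 mul0r. Qed.
Lemma s4_in j : s4 * a j = 0.
Proof. by rewrite -s4e -ea mulrA -(mulrA s4) e4_leaf mulr0 mul0r. Qed.
Lemma out_s4 j : b j * s4 = 0.
Proof. by rewrite -be -es4 mulrA -(mulrA (b j)) e_leaf4 mulr0 mul0r. Qed.

Lemma e_sl i j : e i * sl j = if i == j then sl j else 0.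
Proof.
rewrite -es mulrA idv_leafM; case: eqP => [->|_]; first by rewrite es.
by rewrite mul0r.
Qed.
Lemma e_s4 i : e i * s4 = 0.
Proof. by rewrite -es4 mulrA e_leaf4 mul0r. Qed.

Lemma center_dim : Ext_dim 0 reg reg 5.
Proof.
apply: (HH0_criterion rel9_src rel9_tgt sec9_linear sec9K rel9_p rel9_ker
  (z := center_basis)) => [[[|[|[|[|[|//]]]]] //= ?]|[[|[|[|[|[|//]]]]] //= ?]|x xd xc|k h].
- by move=> v; rewrite mul1r mulr1.
- exact: sl_diag.
- exact: sl_diag.
- exact: sl_diag.
- exact: s4_diag.
- by move=> y; rewrite mul1r mulr1.
- by elim/arrowP=> i; rewrite -/(arr _) ?in_sl ?sl_in ?out_sl ?sl_out.
- by elim/arrowP=> i; rewrite -/(arr _) ?in_sl ?sl_in ?out_sl ?sl_out.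
- by elim/arrowP=> i; rewrite -/(arr _) ?in_sl ?sl_in ?out_sl ?sl_out.
- by elim/arrowP=> i; rewrite -/(arr _) ?as4 ?s4_in ?out_s4 ?s4b.
- have [k [l [k4 [m1 [m2 [l4 [hl h4]]]]]]] := diag_span xd.
  (* Commuting with the a_i alone already forces equal coefficients of the idempotents and m1 = m2 =
     0. *)
  have h i : (k4 - k i) *: a i + mu m1 m2 i *: tt i = 0.
    by rewrite -(comm_in xd hl h4) [a i * x](xc (arrow_in i)) subrr.
  have kE i : k i = k4.
    by have [/eqP + _] := indep_in (h i); rewrite subr_eq0 => /eqP.
  have [_ m20] := indep_in (h l1); have [_ m10] := indep_in (h l2).
  exists (fun i : 'I_5 => nth 0 [:: k4; l l1; l l2; l l3; l4] i).
  rewrite !big_ord_recl big_ord0 /= /center_basis /=.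
  rewrite (diag_sum xd) !hl h4 !kE.
  move: m20 m10 => /= -> /eqP; rewrite oppr_eq0 => /eqP ->.
  rewrite !scale0r !addr0 -idv_sum !scalerDr.
  by rewrite (addrACA (k4 *: _)) (addrACA (k4 *: _ + _)) [LHS]addrACA -!addrA.
- have {}h : k (inord 0) *: 1 + k (inord 1) *: sl l1 + k (inord 2) *: sl l2
    + k (inord 3) *: sl l3 + k (inord 4) *: s4 = 0.
    rewrite -h !big_ord_recl big_ord0 addr0 /center_basis /= !addrA.
    by do ![congr (_ + _)]; congr (k _ *: _); apply: val_inj; rewrite /= inordK.
  (* Multiplication by e_i isolates the coefficients of 1 and [sl i]. *)
  have hl i : k (inord 0) = 0 /\ k (inord (leaf_code i).+1) = 0.
    apply: (@indep_leaf i); have := congr1 (fun x => e i * x) h.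
    rewrite /= !mulrDr -!scalerAr mulr1 mulr0 !e_sl e_s4 scaler0 addr0 => <-.
    by case: i; rewrite ?eqxx /= ?scaler0 ?addr0.
  have [k0 k1] := hl l1; have [_ k2] := hl l2; have [_ k3] := hl l3.
  have h4 : 0 *: e4 + 0 *: c l1 + 0 *: c l2 + k (inord 4) *: s4 = 0.
    have := congr1 (fun x => e4 * x) h.
    rewrite /= k0 k1 k2 k3 !scale0r !add0r -scalerAr es4 mulr0 => ->.
    by [].
  have [_ _ _ k4] := indep_4 h4.
  move=> i; rewrite -[i]inord_val.
  by case: i => -[|[|[|[|[|//]]]]] /= _.
Qed.

(** * Degree 1: derivations modulo inner derivations *)

Lemma par1_ext n n' : (forall i, n (arrow_in i) = n' (arrow_in i)) ->
  (forall i, n (arrow_out i) = n' (arrow_out i)) -> forall y, n y = n' y :> A.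
Proof. by move=> hi ho; elim/arrowP. Qed.

Section Cocycle1.
Variables (n : arrow -> A) (x y x' y' : leaf -> K).
Hypothesis np : par1 n.
Hypothesis n_in : forall i, n (arrow_in i) = x i *: a i + y i *: tt i.
Hypothesis n_out : forall i, n (arrow_out i) = x' i *: b i + y' i *: uu i.

(** The relations at the leaves force y'_i = - y_i, and then y_i - y'_i = 2 y_i in the socle part at
    4. *)
Lemma cocycle1P : (forall v, drv n (rel9 v) = 0) <->
  [/\ forall i, y' i = - y i, forall i, x i + x' i = x l3 + x' l3 &
      (y l1 + y l2 + y l3) *+ 2 = 0].
Proof.
have yE : (forall i, y' i = - y i) -> (y l1 - y' l1) + (y l2 - y' l2) + (y l3 - y' l3)
    = (y l1 + y l2 + y l3) *+ 2.
  by move=> yy; rewrite !yy !opprK !mulrnDl !mulr2n.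
split=> [h|[hy hx h2] v].
  have hy i : y' i = - y i.
    have h0 : 0 *: e i + (y i + y' i) *: sl i = 0.
      by rewrite -(drv_leafE np n_in n_out) h scale0r addr0.
    by have [_ /eqP] := indep_leaf h0; rewrite addrC addr_eq0 => /eqP.
  have := h v4; rewrite (drv_4E np n_in n_out) => /indep_4[_ /eqP h1 /eqP h2 h3].
  split=> //; last by rewrite -yE.
  by case=> //; apply/eqP; rewrite -subr_eq0.
elim/vertexP: v => [i|]; first by rewrite (drv_leafE np n_in n_out) hy subrr scale0r.
rewrite (drv_4E np n_in n_out) yE // h2 !hx subrr.
by rewrite !scale0r !addr0.
Qed.

End Cocycle1.

(** The derivation of the grading in which the arrows into the vertex 4 have degree 1 and the others
    degree 0; all relations are homogeneous of degree 1. *)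
Definition euler : arrow -> A := family1 (fun=> 1) (fun=> 0) (fun=> 0) (fun=> 0).
Definition at1 (k : K) (i : leaf) : K := if i is l1 then k else 0.
(** Its invariant, the sum of the y_i, is 1, so it is not inner; being a cocycle requires twice this
    sum to vanish. *)
Definition twist : arrow -> A :=
  family1 (fun=> 0) (at1 1) (fun=> 0) (fun i => - at1 1 i).

Lemma euler_cocycle v : drv euler (rel9 v) = 0.
Proof.
move: v; apply/(cocycle1P (family1_par _ _ _ _) (family1_in _ _ _ _) (family1_out _ _ _ _)).
by split=> [i|i|]; rewrite ?oppr0 // !addr0 mul0rn.
Qed.

Lemma twist_cocycle v : (2%:R : K) = 0 -> drv twist (rel9 v) = 0.
Proof.
move=> k2; move: v.
apply/(cocycle1P (family1_par _ _ _ _) (family1_in _ _ _ _) (family1_out _ _ _ _)).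
by split=> //=; rewrite !addr0.
Qed.

Lemma HH1_span n : par1 n -> (forall v, drv n (rel9 v) = 0) ->
  exists k y : K, y *+ 2 = 0 /\ exists2 z, diag z &
    forall g : arrow, n g - (k *: euler g + y *: twist g) = arr g * z - z * arr g.
Proof.
move=> np nc; have [x [y [x' [y' [n_in n_out]]]]] := par1_span np.
have [hy hx h2] := (cocycle1P np n_in n_out).1 nc.
set Y := y l1 + y l2 + y l3 in h2.
exists (x l3 + x' l3), Y; split=> //.
(* [x'] clears the coefficients of the b_i; the other two arguments solve mu_i = [y i - at1 Y i],
   which is possible as these values have sum zero. *)
exists (diag_elt x' (- y l2) (y l1 - Y)); first exact: diag_elt_diag.
have muE i : mu (- y l2) (y l1 - Y) i = y i - at1 Y i.
  by case: i; rewrite /= /Y; ring.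
apply: par1_ext => i.
  rewrite n_in diag_elt_in muE /euler /twist !family1_in !scale0r !addr0 add0r scale1r.
  rewrite opprD addrACA scalerA -!scalerBl -(hx i) opprD addrA subrr sub0r.
  by congr (_ + _ *: _); case: i; rewrite /= ?mulr1 ?mulr0.
rewrite n_out diag_elt_out muE /euler /twist !family1_out !scale0r !addr0 add0r scaler0 add0r.
rewrite -addrA scalerA -scalerBl hy.
by congr (_ + _ *: _); case: i; rewrite /= ?mulrN ?mulr1 ?mulr0 opprB ?opprK addrC.
Qed.

(** In a commutator the coefficients of a_i and b_i are opposite and the mu_i have sum zero, whereas
    [euler] has coefficients 1 and 0, and [twist] has a single nonzero y_i. *)
Lemma HH1_indep (k y : K) z : diag z ->
  (forall g : arrow, k *: euler g + y *: twist g = arr g * z - z * arr g) ->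
  k = 0 /\ y = 0.
Proof.
move=> zd h; have [q [l [k4 [m1 [m2 [l4 [hl h4]]]]]]] := diag_span zd.
have hin i : (k - (k4 - q i)) *: a i + (y * at1 1 i - mu m1 m2 i) *: tt i = 0.
  have := h (arrow_in i); rewrite (comm_in zd hl h4) /euler /twist !family1_in.
  rewrite !scale0r addr0 add0r scale1r scalerA => /eqP; rewrite -subr_eq0 => /eqP.
  by rewrite opprD addrACA -!scalerBl.
have hout i : (- (q i - k4)) *: b i + (- (y * at1 1 i) + mu m1 m2 i) *: uu i = 0.
  have := h (arrow_out i); rewrite (comm_out zd hl h4) /euler /twist !family1_out.
  rewrite !scale0r addr0 add0r scaler0 add0r scalerA => /eqP; rewrite -subr_eq0 => /eqP.
  by rewrite opprD addrCA -scaleNr -scalerBl mulrN opprK.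
have [k0 t1] := indep_in (hin l1); have [_ t2] := indep_in (hin l2).
have [_ t3] := indep_in (hin l3); have [q0 _] := indep_out (hout l1).
split.
  have -> : k = k - (k4 - q l1) + - (q l1 - k4) by ring.
  by rewrite k0 q0 addr0.
move: t1 t2 t3 => /=; rewrite mulr1 !mulr0 !sub0r => t1 /eqP.
rewrite !oppr_eq0 => /eqP m10; rewrite m10 sub0r opprK => m20.
by move: t1; rewrite m20 subr0.
Qed.

Lemma HH1_dim_neq2 : (2%:R : K) != 0 -> Ext_dim 1 reg reg 1.
Proof.
move=> k2.
apply: (HH1_criterion rel9_src rel9_tgt sec9_linear sec9K rel9_p rel9_ker
  (b := fun _ : 'I_1 => euler)) => [i|i v|n np nc|k z zd h].
- exact: family1_par.
- exact: euler_cocycle.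
- have [k [y [y2 [z zd zE]]]] := HH1_span np nc.
  exists (fun=> k), z => // g; rewrite big_ord1 -zE.
  suff -> : y = 0 by rewrite scale0r addr0.
  by move/eqP: y2; rewrite -mulr_natr mulf_eq0 (negPf k2) orbF => /eqP.
- have [|k0 _] := @HH1_indep (k ord0) 0 z zd.
    by move=> g; rewrite scale0r addr0 -(h g) big_ord1.
  by move=> i; rewrite ord1.
Qed.

Lemma HH1_dim_2 : (2%:R : K) = 0 -> Ext_dim 1 reg reg 2.
Proof.
move=> k2.
apply: (HH1_criterion rel9_src rel9_tgt sec9_linear sec9K rel9_p rel9_ker
  (b := fun i : 'I_2 => if i == ord0 then euler else twist)) => [i|i v|n np nc|k z zd h].
- by case: ifP => _; apply: family1_par.
- by case: ifP => _; [apply: euler_cocycle|apply: twist_cocycle].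
- have [k [y [_ [z zd zE]]]] := HH1_span np nc.
  exists (fun i : 'I_2 => if i == ord0 then k else y), z => // g.
  by rewrite !big_ord_recl big_ord0 /= addr0 -zE.
- have [|k0 k1] := @HH1_indep (k ord0) (k (lift ord0 ord0)) z zd.
    by move=> g; rewrite -(h g) !big_ord_recl big_ord0 /= addr0.
  by move=> i; case: (unliftP ord0 i) => [j|] ->; rewrite ?ord1.
Qed.

(** * Explicit syzygies *)

Local Notation lv i := (leaf_vertex i).
Local Notation gi i := (@g1 K quiver9 A Ae p (arrow_in i)).
Local Notation go i := (@g1 K quiver9 A Ae p (arrow_out i)).
Local Notation dr v := (@der K quiver9 A Ae p (rel9 v)).
Local Notation leaves := [:: l1; l2; l3].

Lemma btNl x y : bt (- x) y = - bt x y.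
Proof. by rewrite -scaleN1r btZl scaleN1r. Qed.
Lemma btNr x y : bt x (- y) = - bt x y.
Proof. by rewrite -scaleN1r btZr scaleN1r. Qed.

Lemma der_mul y z : @der K quiver9 A Ae p (@qarrow K quiver9 y * @qarrow K quiver9 z) =
  bt 1 (arr z) *: @g1 K quiver9 A Ae p y + bt (arr y) 1 *: @g1 K quiver9 A Ae p z.
Proof.
rewrite der_arrow; congr (_ + _ *: _).
by rewrite -[@qarrow K quiver9 z]qidem_tgt der_arrow der_qidem scaler0 addr0 g1r.
Qed.

Lemma bt_der_leaf x y i : bt x y *: dr (lv i) =
  bt x (b i * y) *: gi i + bt (x * a i) y *: go i.
Proof. by rewrite rel9_leaf der_mul scalerDr !scalerA !btM !mulr1 mul1r. Qed.

Lemma bt_der_4 x y : bt x y *: dr v4 =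
  \sum_(k <- leaves) (bt x (a k * y) *: go k + bt (x * b k) y *: gi k).
Proof.
rewrite !big_cons big_nil addr0 addrA /rel9 2!derD !der_mul.
by rewrite 2!scalerDr !(scalerDr _ (_ *: _)) !scalerA !btM !mulr1 !mul1r.
Qed.

Lemma sum_leaves (V : zmodType) (F : leaf -> V) i :
  \sum_(k <- leaves) F k = F i + F (nx i) + F (nx2 i).
Proof.
rewrite !big_cons big_nil addr0 addrA; case: i => //=.
  by rewrite -addrA addrC.
by rewrite addrC addrA.
Qed.

Lemma cancel6 (V : zmodType) (X1 X2 X3 X4 X5 X6 : V) :
  X1 + ((- X1 - X2 - X3) + ((X2 + X4) + ((X3 + X5) + ((- X4 - X5 - X6) + X6)))) = 0.
Proof.
rewrite subrK (addrACA X3) subrr addr0 (addrACA X2) subrr addr0.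
by rewrite -(addrA (- X1)) -opprD subrK subrr.
Qed.

(** The sum of (-1)^|x| x (x) x' over the basis x of e_i A, where |x| is the length and x' the dual
    basis element, so that x x' = [sl i]. For instance, the dual of a_i b_(i+2) is - a_(i+2) b_i. *)
Definition leaf_syzygy i : seq (A * A * vertex) :=
  [:: (e i, sl i, lv i); (- a i, uu i, v4);
      (a i * b (nx i), a (nx i) * b i, lv (nx i));
      (- (a i * b (nx2 i)), a (nx2 i) * b i, lv (nx2 i));
      (- tt i, b i, v4); (sl i, e i, lv i)].

(** A relation at the middle vertex sends one of its arrows into x or into x'; the same tensor
    arises from a neighbouring basis element, with the opposite sign because the lengths differ by
    one. *)
Lemma leaf_syzygy0 i : \sum_(t <- leaf_syzygy i) bt t.1.1 t.1.2 *: dr t.2 = 0.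
Proof.
set w1 := a i * b (nx i); set w2 := a i * b (nx2 i).
have e1 : w1 * a (nx i) = tt i by rewrite -mulrA -cycE ac1.
have e2 : w2 * a (nx2 i) = - tt i by rewrite -mulrA -cycE ac2.
have b1 : a (nx i) * uu i = 0 by rewrite -{2}(nx3 i) au2.
have b2 : a (nx2 i) * uu i = 0 by rewrite -{2}(nx3 i) au1.
pose X1 := bt (a i) (sl i) *: go i; pose X2 := bt w1 (uu i) *: gi (nx i).
pose X3 := bt w2 (uu i) *: gi (nx2 i).
pose X4 := bt (tt i) (a (nx i) * b i) *: go (nx i).
pose X5 := bt (tt i) (a (nx2 i) * b i) *: go (nx2 i).
pose X6 := bt (sl i) (b i) *: gi i.
rewrite -[RHS](cancel6 X1 X2 X3 X4 X5 X6) !big_cons big_nil addr0 /=.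
congr (_ + (_ + (_ + (_ + (_ + _))))).
- by rewrite bt_der_leaf bsl ea bt0r scale0r add0r.
- rewrite bt_der_4 (sum_leaves _ i) au b1 b2 !mulNr ab oppr0 !(bt0r, bt0l) !scale0r.
  by rewrite addr0 !add0r !btNl !scaleNr.
- by rewrite bt_der_leaf bw2 e1.
- by rewrite bt_der_leaf bw1 mulNr e2 opprK btNl btNr opprK.
- rewrite bt_der_4 (sum_leaves _ i) ab !mulNr tb tb1 tb2 oppr0 !(bt0r, bt0l) !scale0r.
  by rewrite add0r !addr0 !btNl !scaleNr -addrA addrC.
- by rewrite bt_der_leaf be sla bt0l scale0r addr0.
Qed.

(** The same sum for e_4 A, with x x' = s_4; the dual of c_1 is c_2 and that of c_2 is - c_1. *)
Definition center_syzygy : seq (A * A * vertex) :=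
  [:: (e4, s4, v4); (s4, e4, v4); (c l1, c l2, v4); (- c l2, c l1, v4)] ++
  ([seq (- b k, tt k, lv k) | k <- leaves] ++ [seq (uu k, a k, lv k) | k <- leaves]).

Lemma sum_center (V : zmodType) (F : A * A * vertex -> V) :
  \sum_(t <- center_syzygy) F t = F (e4, s4, v4) + (F (s4, e4, v4) +
    ((F (c l1, c l2, v4) + F (- c l2, c l1, v4)) +
    (\sum_(k <- leaves) F (- b k, tt k, lv k) + \sum_(k <- leaves) F (uu k, a k, lv k)))).
Proof.
by rewrite /center_syzygy !big_cat !big_map !big_cons !big_nil /= !addr0 !addrA.
Qed.

(** The tensor c_1 (x) c_2 - c_2 (x) c_1 is unchanged by rotation, since c_3 = - c_1 - c_2; hence
    the result has the same shape at every leaf. *)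
Lemma casimir k :
  bt (c l1) (a k * c l2) *: go k + bt (c l1 * b k) (c l2) *: gi k
  + (bt (- c l2) (a k * c l1) *: go k + bt (- c l2 * b k) (c l1) *: gi k)
  = bt (c k) (tt k) *: go k - bt (uu k) (c k) *: gi k.
Proof.
case: k.
- rewrite (ac1 l1) (cb l1) (ac l1) mulNr (cb1 l1).
  by rewrite !(bt0l, bt0r) !scale0r addr0 add0r btNl scaleNr.
- rewrite (ac l2) (cb2 l2) (ac2 l2) mulNr (cb l2) oppr0 !(bt0l, bt0r) !scale0r.
  by rewrite add0r addr0 !(btNl, btNr) opprK scaleNr addrC.
- rewrite (ac2 l3) (cb1 l3) (ac1 l3) mulNr (cb2 l3) opprK addrACA -!scalerDl.
  rewrite c3E !(btDl, btDr, btNl, btNr); congr (_ + _).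
  by rewrite -opprD scaleNr opprK addrC.
Qed.

Lemma cancel4 (V : zmodType) (X Y Z U : V) :
  X + (Y + ((Z - U) + ((- X - Z) + (U - Y)))) = 0.
Proof.
rewrite (addrC (- X)) (addrACA (- Z)) (addrA (Z - U)) (addrACA Z) subrr addNr.
by rewrite addr0 add0r addrA -opprD subrr.
Qed.

Lemma center_syzygy0 : \sum_(t <- center_syzygy) bt t.1.1 t.1.2 *: dr t.2 = 0.
Proof.
pose X k := bt (b k) s4 *: gi k; pose Y k := bt s4 (a k) *: go k.
pose Z k := bt (c k) (tt k) *: go k; pose U k := bt (uu k) (c k) *: gi k.
have E1 : bt e4 s4 *: dr v4 = \sum_(k <- leaves) X k.
  rewrite bt_der_4; apply: eq_bigr => k _.
  by rewrite as4 bt0r scale0r add0r eb.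
have E2 : bt s4 e4 *: dr v4 = \sum_(k <- leaves) Y k.
  rewrite bt_der_4; apply: eq_bigr => k _.
  by rewrite s4b bt0l scale0r addr0 ae.
have E3 : bt (c l1) (c l2) *: dr v4 + bt (- c l2) (c l1) *: dr v4 =
    \sum_(k <- leaves) (Z k - U k).
  by rewrite !bt_der_4 -big_split; apply: eq_bigr => k _; apply: casimir.
have E4 k : bt (- b k) (tt k) *: dr (lv k) = - X k - Z k.
  by rewrite bt_der_leaf bt4 mulNr -cycE !btNl !scaleNr.
have E5 k : bt (uu k) (a k) *: dr (lv k) = U k - Y k.
  by rewrite bt_der_leaf -cycE ua4 btNl scaleNr.
rewrite sum_center /= E1 E2 E3 (eq_bigr _ (fun k _ => E4 k)) (eq_bigr _ (fun k _ => E5 k)).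
by rewrite -!big_split big1 // => k _; apply: cancel4.
Qed.

(** * Necessary conditions on 2-cocycles *)

Section Cocycle2.
Variables (n : vertex -> A) (P Q : leaf -> K) (k4 m1 m2 l4 : K).
Hypothesis np : par2 n.
Hypothesis nc : @cocycle2 K quiver9 A Ae vertex rel9 id id p n.
Hypothesis n_leaf : forall i, n (lv i) = P i *: e i + Q i *: sl i.
Hypothesis n_4 : n v4 = k4 *: e4 + m1 *: c l1 + m2 *: c l2 + l4 *: s4.

Lemma slsl i : sl i * sl i = 0.
Proof. by rewrite -{1}tb -mulrA bsl mulr0. Qed.

Lemma n_sl i : n (lv i) * sl i = P i *: sl i.
Proof. by rewrite n_leaf mulrDl -!scalerAl slsl es scaler0 addr0. Qed.
Lemma sl_n i : sl i * n (lv i) = P i *: sl i.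
Proof. by rewrite n_leaf mulrDr -!scalerAr slsl se scaler0 addr0. Qed.

Lemma tu i : tt i * uu i = 0.
Proof. by rewrite -ac1 -cb1 -mulrA (mulrA (c _)) cc mul0r mulr0. Qed.

Lemma a_n4 i : a i * n v4 = k4 *: a i + mu m1 m2 i *: tt i.
Proof.
by rewrite n_4 -(addrA (k4 *: _)) mulrDr mulrDr a_cc -!scalerAr ae as4 scaler0 addr0.
Qed.
Lemma n4_b i : n v4 * b i = k4 *: b i + mu m1 m2 i *: uu i.
Proof.
by rewrite n_4 -(addrA (k4 *: _)) mulrDl mulrDl cc_b -!scalerAl eb s4b scaler0 addr0.
Qed.

Lemma b_n i : b i * n (lv i) = P i *: b i.
Proof. by rewrite n_leaf mulrDr -!scalerAr be bsl scaler0 addr0. Qed.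
Lemma n_a i : n (lv i) * a i = P i *: a i.
Proof. by rewrite n_leaf mulrDl -!scalerAl ea sla scaler0 addr0. Qed.

(** In x n x' only the identity part of n survives, as longer products exceed the socle. In the
    basis of e_i A two elements end at i and one at each other leaf, all of even length, and two end
    at 4, of odd length. *)
Lemma cocycle2_leaf i : P i *+ 2 + P (nx i) + P (nx2 i) = k4 *+ 2.
Proof.
have := cocycle2_zero rel9_src rel9_tgt np nc (leaf_syzygy0 i).
rewrite !big_cons big_nil addr0 /= !mulNr.
rewrite -(mulrA (e i)) n_sl -scalerAr es a_n4 mulrDl -!scalerAl au tu scaler0 addr0.
rewrite -(mulrA (a i) (b (nx i))) b_n -!scalerAr -scalerAl -(mulrA (a i)) bw2 au.
rewrite -(mulrA (a i) (b (nx2 i))) b_n -!scalerAr -scalerAl -(mulrA (a i)) bw1 mulrN au.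
rewrite -(mulrA (tt i)) n4_b mulrDr -!scalerAr tb tu scaler0 addr0 sl_n -scalerAl se.
rewrite scalerN opprK -!scaleNr -!scalerDl => h.
have h0 : 0 *: e i + (P i + (- k4 + (P (nx i) + (P (nx2 i) + (- k4 + P i))))) *: sl i = 0.
  by rewrite h scale0r addr0.
have [_ /eqP] := indep_leaf h0; rewrite -subr_eq0 => /eqP {}h.
apply/eqP; rewrite -subr_eq0 -[X in _ == X]h; apply/eqP; ring.
Qed.

(** The basis of e_4 A has four elements ending at 4, of even length, and two ending at each leaf,
    of odd length. *)
Lemma cocycle2_center : k4 *+ 4 = (P l1 + P l2 + P l3) *+ 2.
Proof.
have := cocycle2_zero rel9_src rel9_tgt np nc center_syzygy0.
rewrite sum_center /=.
have ss : s4 * s4 = 0 by rewrite -{2}(bt4 l1) mulrA s4b mul0r.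
have E1 : e4 * n v4 * s4 = k4 *: s4.
  by rewrite -mulrA n_4 !mulrDl -!scalerAl es4 !cs4 ss !scaler0 !addr0 -scalerAr es4.
have E2 : s4 * n v4 * e4 = k4 *: s4.
  by rewrite n_4 !mulrDr -!scalerAr s4e !s4c ss !scaler0 !addr0 -scalerAl s4e.
have cn j : c j * n v4 = k4 *: c j + mu m1 m2 j *: s4.
  by rewrite cycE -mulrA a_n4 mulrDr -!scalerAr bt4.
have E3 : c l1 * n v4 * c l2 + - c l2 * n v4 * c l1 = (k4 *+ 2) *: s4.
  rewrite mulNr !cn !mulNr !mulrDl -!scalerAl !s4c !scaler0 !addr0 (cc1 l1) (cc1' l1).
  by rewrite scalerN opprK -scalerDl.
have E4 k : - b k * n (lv k) * tt k = - P k *: s4.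
  by rewrite !mulNr b_n -scalerAl bt4 scaleNr.
have E5 k : uu k * n (lv k) * a k = - P k *: s4.
  by rewrite -mulrA n_a -scalerAr ua4 scalerN scaleNr.
rewrite E1 E2 E3 (eq_bigr _ (fun k _ => E4 k)) (eq_bigr _ (fun k _ => E5 k)).
rewrite !big_cons !big_nil !addr0 -!scalerDl => h.
set r := (X in X *: s4) in h.
have [_ _ _ {}h] : [/\ (0 : K) = 0, (0 : K) = 0, (0 : K) = 0 & r = 0].
  by apply: indep_4; rewrite h !scale0r !addr0.
by apply/eqP; rewrite -subr_eq0 -[X in _ == X]h /r; apply/eqP; ring.
Qed.

End Cocycle2.

(** * 2-cocycles from left linear maps *)

Definition table (t : basis -> V) : V -> V := lext t.
Lemma tableU t x : table t (bvec x) = t x. Proof. exact: lextU. Qed.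
Lemma table_linear t : linear (table t). Proof. exact: lext_is_linear. Qed.
Lemma table0 t : table t 0 = 0. Proof. exact: linear0. Qed.
Lemma tableN t x : table t (- x) = - table t x. Proof. exact: linearN. Qed.
Lemma tableD t x y : table t (x + y) = table t x + table t y. Proof. exact: linearD. Qed.

Section LeftLift.
Variables (n : vertex -> A) (N : vertex -> basis -> V) (t : arrow -> basis -> V).
Hypothesis np : par2 n.
Hypothesis t_src : forall y x, regE (arrow_src y) (t y x) = t y x.
Hypothesis nN : forall v x, bsrc x = v -> n v * basA x = decA (N v x).
Hypothesis N_leaf : forall i x, bsrc x = lv i ->
  table (t (arrow_in i)) (left_out K i x) + regX (arrow_in i) (t (arrow_out i) x)
  = N (lv i) x.
Hypothesis N_4 : forall x, bsrc x = v4 ->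
  \sum_(k <- leaves)
    (table (t (arrow_out k)) (left_in K k x) + regX (arrow_out k) (t (arrow_in k) x))
  = N v4 x.

Lemma table_src y u : regE (arrow_src y) (table (t y) u) = table (t y) u.
Proof.
move: u; apply: malg_ext => [||x]; last by rewrite tableU t_src.
  exact: (comp_linear (regE_linear _) (table_linear _)).
exact: table_linear.
Qed.

Lemma table_in i u : regE (lv i) (table (t (arrow_in i)) u) = table (t (arrow_in i)) u.
Proof. by have := table_src (arrow_in i) u; case: i. Qed.
Lemma table_out i u : regE v4 (table (t (arrow_out i)) u) = table (t (arrow_out i)) u.
Proof. by have := table_src (arrow_out i) u; case: i. Qed.

Lemma regX_off y x : bsrc x != arrow_tgt y -> regX y (bvec x : V) = 0.
Proof. by move=> xy; rewrite -regX_tgt regEU eq_sym (negPf xy) regX0. Qed.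

(** By the Leibniz rule D(a_i b_i) = g_(a_i) b_i + a_i g_(b_i); this is the value on D(a_i b_i) u of
    the left linear map given by the tables, and [lift_4] is its analogue at the vertex 4. *)
Definition lift_leaf i (u : V) : V :=
  table (t (arrow_in i)) (regX (arrow_out i) u)
  + regX (arrow_in i) (table (t (arrow_out i)) (regE (lv i) u)).
Definition lift_4 (u : V) : V :=
  \sum_(k <- leaves) (table (t (arrow_out k)) (regX (arrow_in k) u)
     + regX (arrow_out k) (table (t (arrow_in k)) (regE v4 u))).

Lemma n_off v x : bsrc x != v -> n v * basA x = 0.
Proof.
move=> xv; have nv : n v * idv v = n v.
  rewrite -[in LHS](np v) -mulrA -!/(idv v) [idv v * idv v]idvM eqxx; exact: np.
by rewrite -nv -basA_src -mulrA (mulrA (idv v)) idvM eq_sym (negPf xv) mul0r mulr0.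
Qed.

Lemma lift_leafE i u : decA (lift_leaf i u) = n (lv i) * decA u.
Proof.
move: u; apply: eq_malg_linear => [k x y|k x y|x].
- rewrite /lift_leaf !(regX_linear, regE_linear, table_linear) addrACA -scalerDr.
  exact: decA_linear.
- by rewrite decA_linear mulrDr scalerAr.
have regXout : regX (arrow_out i) (bvec x : V) = left_out K i x.
  by rewrite regXU; case: i.
rewrite decAU /lift_leaf regEU; have [xi|xi] := eqVneq (bsrc x) (lv i).
  by rewrite tableU regXout N_leaf // nN.
rewrite regX_off; last by case: i xi {regXout}.
by rewrite !table0 regX0 addr0 decA0 n_off.
Qed.

Lemma lift_4E u : decA (lift_4 u) = n v4 * decA u.
Proof.
move: u; apply: eq_malg_linear => [k x y|k x y|x].
- rewrite -decA_linear; congr decA; rewrite scaler_sumr -big_split.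
  apply: eq_bigr => i _ /=.
  by rewrite !(regX_linear, regE_linear, table_linear) scalerDr addrACA.
- by rewrite decA_linear mulrDr scalerAr.
have regXin i : regX (arrow_in i) (bvec x : V) = left_in K i x.
  by rewrite regXU; case: i.
rewrite decAU; have [x4|x4] := eqVneq (bsrc x) v4.
  rewrite (nN x4) -(N_4 x4) /lift_4 regEU x4 eqxx; congr decA.
  by apply: eq_bigr => k _; rewrite tableU regXin.
rewrite n_off // /lift_4 big1 ?decA0 // => k _.
rewrite regEU eq_sym (negPf x4) table0 regX0 addr0 regX_off ?table0 //.
by case: k.
Qed.

(** [N_leaf] and [N_4] are the hypothesis of [cocycle2_left] on basis elements, so a cocycle is
    certified by a finite computation with tables. *)
Lemma left_lift_cocycle : @cocycle2 K quiver9 A Ae vertex rel9 id id p n.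
Proof.
pose G y (x : A) := decA (table (t y) (coord x)).
have GE y u : G y (decA u) = decA (table (t y) u) by rewrite /G coord_decA.
have Gl y : linear (G y).
  by move=> k x z; rewrite /G coord_linear table_linear decA_linear.
apply: (cocycle2_left rel9_src rel9_tgt (G := G) np Gl) => L LD LE v y.
have Lin x z i : L (bt x z *: gi i) = x * e i * G (arrow_in i) (e4 * z).
  by have := LE x (arrow_in i) z; case: i.
have Lout x z i : L (bt x z *: go i) = x * e4 * G (arrow_out i) (e i * z).
  by have := LE x (arrow_out i) z; case: i.
have L0 : L 0 = 0 by have := LD 0 0; rewrite addr0 => /eqP; rewrite addrC -subr_eq subrr => /eqP.
rewrite -(decA_coord y); move: (coord y) => {y} u.
elim/vertexP: v => [i|].
  rewrite bt_der_leaf LD Lin Lout -lift_leafE decAD !mul1r; congr (_ + _).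
    by rewrite mulrA eb -decA_regX GE -decA_regE table_in.
  by rewrite ae -decA_regE GE decA_regX.
rewrite bt_der_4 -lift_4E (big_morph L LD L0) (big_morph decA decAD decA0).
apply: eq_bigr => k _; rewrite LD Lin Lout decAD !mul1r; congr (_ + _).
  by rewrite mulrA ea -decA_regX GE -decA_regE table_out.
by rewrite be -decA_regE GE decA_regX.
Qed.

End LeftLift.

Section CharTwo.
Hypothesis char2 : (2%:R : K) = 0.

Lemma oppV (x : V) : - x = x.
Proof.
apply/eqP; rewrite -subr_eq0 -opprD oppr_eq0 -mulr2n -scaler_nat char2.
by rewrite scale0r.
Qed.

Lemma addVV (x : V) : x + x = 0.
Proof. by rewrite -{2}(oppV x) subrr. Qed.
Lemma addVK (x y : V) : x + (x + y) = y.
Proof. by rewrite addrA addVV add0r. Qed.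

(* Sends c_i, c_(i+1), c_(i+2) to x, x, 0; recall c_3 = - c_1 - c_2. *)
Definition on_loops (i : leaf) (x : V) (y : basis) : V :=
  match y, i with C1, l1 | C1, l3 | C2, l1 | C2, l2 => x | _, _ => 0 end.

(* Each pair of tables below gives, on the basis, the left A-linear map that
   shows that the cochain idleaf, id4 or soc4 of the same name is a cocycle (for
   soc4 the second table is 0). *)
Definition idleaf_in (i : leaf) (x : basis) : V :=
  match x with
  | C1 | C2 => on_loops i (bvec (Ai i)) x
  | Bi j => delta_leaf i j (bvec (Ei i))
  | Ui j => delta_leaf (nx i) j (bvec (W1 i))
  | _ => 0
  end.
Definition idleaf_out (i : leaf) (x : basis) : V :=
  match x with
  | W2 j => delta_leaf i j (bvec (Bi (nx2 i)))
  | Ti j => delta_leaf i j (leaf_loop K (nx i))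
  | Si j => delta_leaf i j (bvec (Ui i))
  | _ => 0
  end.
Definition id4_in (i : leaf) (x : basis) : V :=
  match x with
  | C1 | C2 => on_loops i (bvec (Ai i)) x
  | Ui j => delta_leaf (nx2 i) j (bvec (W2 i))
  | S4 => bvec (Ti i)
  | _ => 0
  end.
Definition id4_out (i : leaf) (x : basis) : V :=
  match x with
  | Ai j => delta_leaf i j (bvec E4)
  | W2 j => delta_leaf i j (bvec (Bi (nx2 i)))
  | Ti j => delta_leaf i j (leaf_loop K (nx2 i))
  | _ => 0
  end.
Definition soc4_in (i : leaf) (x : basis) : V :=
  match i, x with l1, E4 => bvec (Ti l1) | _, _ => 0 end.

Definition arrow_table (tin tout : leaf -> basis -> V) (y : arrow) : basis -> V :=
  match y with
  | alpha => tin l1 | xi => tin l2 | gamma => tin l3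
  | beta => tout l1 | epsilon => tout l2 | delta => tout l3
  end.

(** In characteristic 2 the necessary conditions leave the P_i equal and k_4 free, which gives
    [idleaf] and [id4]; [soc4] is the socle direction that coboundaries then miss. *)
Definition idleaf (v : vertex) : A := if v == v4 then 0 else idv v.
Definition id4 (v : vertex) : A := if v == v4 then e4 else 0.
Definition soc4 (v : vertex) : A := if v == v4 then s4 else 0.

Lemma idleaf_par : par2 idleaf.
Proof.
move=> v; rewrite /idleaf; case: ifP => _; first by rewrite mulr0 mul0r.
by rewrite -!/(idv _) !idvM eqxx idvM eqxx.
Qed.
Lemma id4_par : par2 id4.
Proof.
move=> v; rewrite /id4; case: eqP => [->|_]; last by rewrite mulr0 mul0r.
by rewrite -!/(idv _) !idvM eqxx idvM eqxx.
Qed.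
Lemma soc4_par : par2 soc4.
Proof.
move=> v; rewrite /soc4; case: eqP => [->|_]; last by rewrite mulr0 mul0r.
by rewrite -!/(idv _) es4 s4e.
Qed.

Ltac table_tac := rewrite ?(tableD, tableN, tableU, table0, regXD, regXN, regXU, regX0)
  /= /delta_leaf /= ?(addr0, add0r).

Ltac leaf_cases := case=> [| | | |j|j|j|j|j|j|j|j] //= /eqP; rewrite leaf_vertexE // => /eqP ->.
Ltac center_cases := case=> [| | | |j|j|[]|j|j|j|[]|j] //= /eqP; rewrite ?leaf_vertexE // => _.

Lemma arrow_table_src tin tout :
  (forall i x, regE (lv i) (tin i x) = tin i x) ->
  (forall i x, regE v4 (tout i x) = tout i x) ->
  forall y x, regE (arrow_src y) (arrow_table tin tout y x) = arrow_table tin tout y x.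
Proof. by move=> hi ho; case; [apply: (hi l1)|apply: ho|apply: (hi l2)|apply: ho|
  apply: (hi l3)|apply: ho]. Qed.

Lemma regE_delta v i j (x : V) : regE v x = x ->
  regE v (delta_leaf i j x) = delta_leaf i j x.
Proof. by rewrite /delta_leaf; case: ifP; rewrite ?regE0. Qed.

Lemma regE_bas v x : bsrc x = v -> regE v (bvec x : V) = bvec x.
Proof. by move=> <-; rewrite regEU eqxx. Qed.

Lemma regE_loop i : regE v4 (leaf_loop K i) = leaf_loop K i.
Proof. by case: i; rewrite /= ?regED ?regEN !regE_bas. Qed.

Lemma idleaf_cocycle : @cocycle2 K quiver9 A Ae vertex rel9 id id p idleaf.
Proof.
apply: (@left_lift_cocycle idleaf (fun v x => if v == v4 then 0 else bvec x)
  (arrow_table idleaf_in idleaf_out) idleaf_par) => [|v x xv|i|].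
- apply: arrow_table_src => i [| | | |j|j|j|j|j|j|j|j]; rewrite /=;
    do ?[exact: regE0|exact: regE_loop|exact: regE_bas|apply: regE_delta|
      by case: i; rewrite ?regE0 ?regE_bas].
- by rewrite /idleaf -xv; case: ifP => _; rewrite ?mul0r ?decA0 // basA_src decAU.
- by leaf_cases; rewrite leaf_vertexE; case: i; do 4 table_tac; rewrite ?(oppV, add0r, addr0, addVV).
- by center_cases; rewrite eqxx !big_cons big_nil; do 4 table_tac;
    rewrite ?oppV ?addVV // -?addrA ?addVK ?addVV //.
Qed.

Lemma id4_cocycle : @cocycle2 K quiver9 A Ae vertex rel9 id id p id4.
Proof.
apply: (@left_lift_cocycle id4 (fun v x => if v == v4 then bvec x else 0)
  (arrow_table id4_in id4_out) id4_par) => [|v x xv|i|].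
- apply: arrow_table_src => i [| | | |j|j|j|j|j|j|j|j]; rewrite /=;
    do ?[exact: regE0|exact: regE_loop|exact: regE_bas|apply: regE_delta|
      by case: i; rewrite ?regE0 ?regE_bas].
- rewrite /id4; case: eqP => [v4E|_]; last by rewrite mul0r decA0.
  by rewrite -v4E -xv basA_src decAU.
- by leaf_cases; rewrite leaf_vertexE; case: i; do 4 table_tac; rewrite ?(oppV, add0r, addr0, addVV).
- by center_cases; rewrite eqxx !big_cons big_nil; do 4 table_tac;
    rewrite ?oppV ?addVV // -?addrA ?addVK ?addVV ?addr0 // addrCA addVV addr0.
Qed.

Definition mul_soc4 (x : basis) : V := if x is E4 then bvec S4 else 0.

Lemma mul_soc4E x : s4 * basA x = decA (mul_soc4 x).
Proof.
case: x => [| | | |i|i|i|i|i|i|i|i]; rewrite /= ?decAU ?decA0.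
- exact: s4e.
- exact: s4c.
- exact: s4c.
- by rewrite -{2}(bt4 l1) mulrA s4b mul0r.
- by rewrite -s4e -mulrA e4_leaf mulr0.
- exact: s4_in.
- exact: s4b.
- by rewrite mulrA s4_in mul0r.
- by rewrite mulrA s4_in mul0r.
- by rewrite -ac1 mulrA s4_in mul0r.
- by rewrite -cb1 mulrA s4c mul0r.
- by rewrite -tb -ac1 !mulrA s4_in !mul0r.
Qed.

Lemma soc4_cocycle : @cocycle2 K quiver9 A Ae vertex rel9 id id p soc4.
Proof.
apply: (@left_lift_cocycle soc4 (fun v x => if v == v4 then mul_soc4 x else 0)
  (arrow_table soc4_in (fun _ _ => 0)) soc4_par) => [|v x _|i|].
- apply: arrow_table_src => i x; last exact: regE0.
  by case: i; case: x => *; rewrite /= ?regE0 ?regE_bas.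
- rewrite /soc4; case: ifP => _; last by rewrite mul0r decA0.
  exact: mul_soc4E.
- by leaf_cases; rewrite leaf_vertexE; case: i; do 4 table_tac; rewrite ?(oppr0, addr0).
- by center_cases; rewrite eqxx !big_cons big_nil; do 4 table_tac; rewrite ?(oppr0, addr0).
Qed.

Definition class2 (i : 'I_3) : vertex -> A := nth (fun=> 0) [:: idleaf; id4; soc4] i.

Lemma class2_par i : par2 (class2 i).
Proof.
by case: i => -[|[|[|//]]] ?; [exact: idleaf_par|exact: id4_par|exact: soc4_par].
Qed.

Lemma class2_cocycle i : @cocycle2 K quiver9 A Ae vertex rel9 id id p (class2 i).
Proof.
by case: i => -[|[|[|//]]] ?; [exact: idleaf_cocycle|exact: id4_cocycle|
  exact: soc4_cocycle].
Qed.

End CharTwo.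

(** * Degree 2: cocycles modulo coboundaries *)

Lemma par2_span n : par2 n -> exists P Q : leaf -> K, exists k4 m1 m2 l4 : K,
  (forall i, n (lv i) = P i *: e i + Q i *: sl i) /\
  n v4 = k4 *: e4 + m1 *: c l1 + m2 *: c l2 + l4 *: s4.
Proof.
move=> np.
have hl i : exists k : K * K, n (lv i) = k.1 *: e i + k.2 *: sl i.
  by have [k [l ->]] := @span_leaf i (n (lv i)) (np (lv i)); exists (k, l).
have [k kE] := choice hl.
have [k4 [m1 [m2 [l4 ->]]]] := @span_4 (n v4) (np v4).
by exists (fun i => (k i).1), (fun i => (k i).2), k4, m1, m2, l4.
Qed.

(* The coboundaries: both p-parts vanish, and the socle part at 4 is the sum of
   the y_i - y'_i, where y_i + y'_i is the socle part at the leaf i. *)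
Lemma coboundary2 (n : vertex -> A) (y Q : leaf -> K) (m1 m2 : K) :
  (forall i, n (lv i) = Q i *: sl i) ->
  n v4 = m1 *: c l1 + m2 *: c l2 +
    ((y l1 + y l2 + y l3) *+ 2 - (Q l1 + Q l2 + Q l3)) *: s4 ->
  exists2 m, par1 m & forall v, n v = drv m (rel9 v).
Proof.
(* Only differences with the third leaf enter the coefficients of c_1 and c_2, so x_3 = 0 and x' = 0
   may be chosen. *)
move=> nl n4; pose x i : K := match i with l1 => m1 | l2 => m2 | l3 => 0 end.
pose y' i := Q i - y i.
exists (family1 x y (fun=> 0) y'); first exact: family1_par.
elim/vertexP => [i|].
  rewrite (drv_leafE (family1_par _ _ _ _) (family1_in _ _ _ _) (family1_out _ _ _ _)).
  by rewrite nl /y' addrC subrK.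
rewrite (drv_4E (family1_par _ _ _ _) (family1_in _ _ _ _) (family1_out _ _ _ _)) n4.
rewrite scale0r add0r /= !addr0 !subr0; congr (_ + _ *: _).
by rewrite /y'; ring.
Qed.

Lemma HH2_dim_neq2 : (2%:R : K) != 0 -> Ext_dim 2 reg reg 0.
Proof.
move=> k2.
apply: (HH2_criterion rel9_src rel9_tgt sec9_linear sec9K rel9_p rel9_ker
  (b := fun (_ : 'I_0) _ => 0)) => [[]//|[]//|n np nc|k m mp _ []//].
have [P [Q [k4 [m1 [m2 [l4 [nl n4]]]]]]] := par2_span np.
have hl := cocycle2_leaf np nc nl n4; have h4 := cocycle2_center np nc nl n4.
have cancel2 z : z *+ 2 = 0 :> K -> z = 0.
  by move/eqP; rewrite -mulr_natr mulf_eq0 (negPf k2) orbF => /eqP.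
(* The left sides of the conditions at i and i+1 differ by P_i - P_(i+1). *)
have Pnx i : P (nx i) = P i.
  apply/eqP; rewrite -subr_eq0; apply/eqP.
  have h1 := hl i; have h2 := hl (nx i); rewrite nx3 in h2.
  have : (P i *+ 2 + P (nx i) + P (nx2 i)) - (P (nx i) *+ 2 + P (nx2 i) + P i) = 0.
    by rewrite h1 h2 subrr.
  by move=> h; rewrite -[RHS]oppr0 -h; ring.
have P12 : P l2 = P l1 := Pnx l1. have P23 : P l3 = P l2 := Pnx l2.
(* Halved, the two conditions read 2 P = k_4 and 2 k_4 = 3 P, whence P = 4 P - 3 P = 0, also in
   characteristic 3. *)
have h1 : P l1 *+ 2 - k4 = 0.
  by apply: cancel2; have := hl l1; rewrite /= P23 P12 => h; rewrite mulrnBl -h; ring.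
have h3 : k4 *+ 2 - P l1 *+ 3 = 0.
  by apply: cancel2; rewrite mulrnBl -mulrnA h4 P23 P12; ring.
have P0 : P l1 = 0.
  have -> : P l1 = (k4 *+ 2 - P l1 *+ 3) + (P l1 *+ 2 - k4) *+ 2 by ring.
  by rewrite h1 h3 mul0rn addr0.
have k40 : k4 = 0 by move/eqP: h1; rewrite P0 mul0rn sub0r oppr_eq0 => /eqP.
have PE i : P i = 0 by case: i; rewrite ?P23 ?P12.
exists (fun=> 0).
(* As 2 is invertible, 2 y_1 can be given the value that the socle part at 4 requires. *)
have [||m mp mE] := @coboundary2 n (at1 ((l4 + (Q l1 + Q l2 + Q l3)) / 2%:R)) Q m1 m2.
- by move=> i; rewrite nl PE scale0r add0r.
- rewrite n4 k40 scale0r add0r /= !addr0; congr (_ + _ *: _).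
  by rewrite -(mulr_natr (_ / _)) divfK // addrK.
- by exists m => // v; rewrite big_ord0 subr0.
Qed.

Lemma HH2_dim_2 : (2%:R : K) = 0 -> Ext_dim 2 reg reg 3.
Proof.
move=> k2.
apply: (HH2_criterion rel9_src rel9_tgt sec9_linear sec9K rel9_p rel9_ker
  (b := class2) class2_par (class2_cocycle k2)) => [n np nc|k m mp kE].
  have [P [Q [k4 [m1 [m2 [l4 [nl n4]]]]]]] := par2_span np.
  have hl := cocycle2_leaf np nc nl n4.
  have d2 (z : K) : z *+ 2 = 0 by rewrite -mulr_natr k2 mulr0.
  have oppK (z : K) : - z = z by apply/eqP; rewrite -subr_eq0 -opprD -mulr2n d2 oppr0.
  have Pnx i : P (nx i) = P (nx2 i).
    have := hl i; rewrite !d2 add0r => /eqP; rewrite addr_eq0 => /eqP ->.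
    exact: oppK.
  have PE i : P i = P l1.
    by case: i; rewrite // ?(Pnx l2) ?(Pnx l3) ?(Pnx l1) // -?(Pnx l3).
  (* With 2 = 0 a coboundary has socle part - (Q_1 + Q_2 + Q_3) at 4, so the multiple of [soc4] must
     be the deviation of l_4 from this value. *)
  exists (fun i : 'I_3 => nth 0 [:: P l1; k4; l4 + (Q l1 + Q l2 + Q l3)] i).
  have sumE v : \sum_(i < 3) nth 0 [:: P l1; k4; l4 + (Q l1 + Q l2 + Q l3)] i *: class2 i v
      = P l1 *: idleaf v + k4 *: id4 v + (l4 + (Q l1 + Q l2 + Q l3)) *: soc4 v.
    by rewrite !big_ord_recl big_ord0 /= addr0 addrA.
  apply: (@coboundary2 _ (fun=> 0) Q m1 m2) => [i|].
    rewrite sumE nl PE /idleaf /id4 /soc4 leaf_vertexE !scaler0 !addr0.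
    by rewrite addrC addKr.
  rewrite sumE n4 /idleaf /id4 /soc4 eqxx scaler0 add0r !addr0 d2 sub0r.
  rewrite opprD addrACA -scalerBl -(addrA (k4 *: _)) (addrC (k4 *: _)) addrK.
  by congr (_ + _ *: _); ring.
have sumE v : \sum_(i < 3) k i *: class2 i v =
    k ord0 *: idleaf v + k (lift ord0 ord0) *: id4 v + k (lift ord0 (lift ord0 ord0)) *: soc4 v.
  by rewrite !big_ord_recl big_ord0 /= addr0 addrA.
have [x [y [x' [y' [m_in m_out]]]]] := par1_span mp.
have hl i : k ord0 = 0 /\ - (y i + y' i) = 0.
  apply: (@indep_leaf i); rewrite scaleNr -(drv_leafE mp m_in m_out) -kE sumE.
  by rewrite /idleaf /id4 /soc4 leaf_vertexE !scaler0 !addr0 subrr.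
have [k0 _] := hl l1.
have yy i : y' i = - y i.
  by have [_ /eqP] := hl i; rewrite oppr_eq0 addrC addr_eq0 => /eqP.
have := kE v4; rewrite sumE (drv_4E mp m_in m_out) /idleaf /id4 /soc4 eqxx scaler0 add0r.
move=> h; have {}h := etrans _ h.
have [|k1 _ _ k3] := @indep_4_eq (k (lift ord0 ord0)) 0 0
  (k (lift ord0 (lift ord0 ord0))) _ _ _ _ (h _ _).
  by rewrite !scale0r !addr0.
(* Once y'_i = - y_i, the socle part of the coboundary at 4 is twice the sum of the y_i. *)
have {}k3 : k (lift ord0 (lift ord0 ord0)) = 0.
  have d2 (z : K) : z + z = 0 by rewrite -mulr2n -mulr_natr k2 mulr0.
  by rewrite k3 !yy !opprK !d2.
move=> i; case: (unliftP ord0 i) => [j ->|-> //].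
by case: (unliftP ord0 j) => [l ->|-> //]; rewrite ord1.
Qed.
End Products.

(** * The quotient map and the conclusion *)

Section Projection.
Variables (K : fieldType) (L : algType K) (S : L -> Prop) (proper : ~ ideal_gen S 1).

Lemma quot_pi_linear : linear (quot_pi proper).
Proof. by move=> k x y; rewrite quot_piD quot_piZ. Qed.

Lemma quot_pi_monoid : monoid_morphism (quot_pi proper).
Proof. by split=> [|x y]; [exact: quot_pi1|exact: quot_piM]. Qed.

HB.instance Definition _ := GRing.isLinear.Build K L (quot_alg proper) _
  (quot_pi proper) quot_pi_linear.
HB.instance Definition _ := GRing.isMonoidMorphism.Build L (quot_alg proper)
  (quot_pi proper) quot_pi_monoid.

Definition quot_proj : {lrmorphism L -> quot_alg proper} := quot_pi proper.

Lemma quot_proj_eq0 x : quot_proj x = 0 <-> ideal_gen S x.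
Proof. by rewrite -(linear0 quot_proj) quot_piE subr0. Qed.

End Projection.

Local Close Scope ring_scope.

Theorem proposition6p5 (K : closedFieldType) :
  HH_dim (Lambda9' K) 0 5 /\
  ((2 \notin [pchar K]%R -> HH_dim (Lambda9' K) 1 1) /\
   (2 \in [pchar K]%R -> HH_dim (Lambda9' K) 1 2)) /\
  ((2 \notin [pchar K]%R -> HH_dim (Lambda9' K) 2 0) /\
   (2 \in [pchar K]%R -> HH_dim (Lambda9' K) 2 3)).
Proof.
have p_rel r (hr : relation9' r) : (quot_proj (@relation9'_proper K) r = 0)%R.
  apply/quot_proj_eq0; exact: ideal_gen_sub hr.
have p_ker r : (quot_proj (@relation9'_proper K) r = 0)%R -> ideal_gen (@relation9' K) r.
  by move/quot_proj_eq0.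
have repK := @quot_reprK K _ _ (@relation9'_proper K).
have two_eq0 : 2 \in [pchar K]%R -> (2%:R = 0 :> K)%R by rewrite inE => /andP[_ /eqP].
have two_neq0 : 2 \notin [pchar K]%R -> (2%:R != 0 :> K)%R by rewrite inE.
pose Ae := env_envelope (Lambda9' K).
split; [|split; split].
- exact: (center_dim p_rel p_ker repK (Ae := Ae)).
- by move=> /two_neq0 k2; exact: (HH1_dim_neq2 p_rel p_ker repK (Ae := Ae) k2).
- by move=> /two_eq0 k2; exact: (HH1_dim_2 p_rel p_ker repK (Ae := Ae) k2).
- by move=> /two_neq0 k2; exact: (HH2_dim_neq2 p_rel p_ker repK (Ae := Ae) k2).
- by move=> /two_eq0 k2; exact: (HH2_dim_2 p_rel p_ker repK (Ae := Ae) k2).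
Qed.
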